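(* A flat torus immersed in $S^3$ may be written as a product $$F=\overline{g_1}\,g_2$$ in the quaternions, where $g_1$ and $g_2$ are two horizontal closed curves in $S^3\subset\mathbb H$. (That is: if $F:M\to S^3\subset\mathbb H$ is an immersion of a flat torus, there are a covering map $\pi:\mathbb R^2\to M$ and two periodic horizontal curves $g_1,g_2:\mathbb R\to S^3$ such that $F(\pi(s,t))=\overline{g_1(s)}\,g_2(t)$ for all $(s,t)\in\mathbb R^2$.)
   Context: $\mathbb H$ is the algebra of (usual, real) quaternions with basis $1,I,J,K$, $\overline q$ is the quaternionic conjugate, $S^3\subset\mathbb H$ is the unit sphere. A unit speed curve $\gamma:\mathcal I\to S^3$ ($\mathcal I$ an interval) is horizontal (with respect to the Hopf fibration $S^3\to S^2\subset\operatorname{Im}\mathbb H$, $q\mapsto q^{-1}Iq$) if $\gamma'\gamma^{-1}=\cos\psi\ J+\sin\psi\ K$ for some function $\psi:\mathcal I\to\mathbb R$. A flat torus immersed in $S^3$ is a torus immersed in $S^3$ whose induced metric is flat. *)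

(* Defs.v *)
From HB Require Import structures.
From mathcomp Require Import all_boot all_order all_algebra.
From mathcomp Require Import all_classical all_reals all_analysis.

Set Implicit Arguments.
Unset Strict Implicit.
Unset Printing Implicit Defensive.

Import Order.TTheory GRing.Theory Num.Theory.
Import numFieldNormedType.Exports.

Local Open Scope classical_set_scope.
Local Open Scope ring_scope.

Section Smooth.
Context (R : realType).

Fixpoint Ck (V W : normedModType R) (k : nat) (f : V -> W) : Prop :=
  match k with
  | 0%N => continuous f
  | k'.+1 => (forall x, differentiable f x) /\ (forall v, Ck k' ('D_v f))
  end.

Definition smooth (V W : normedModType R) (f : V -> W) : Prop :=
  forall k, Ck k f.

Definition immersive (V W : normedModType R) (f : V -> W) : Prop :=
  (forall x, differentiable f x) /\ (forall x, injective ('d f x)).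

End Smooth.

Section Quaternions.
Context (R : realType).

(* The row (a, b, c, d) stands for a + b I + c J + d K. The norm that the
   library puts on row vectors is the sup norm, so Euclidean lengths are always
   expressed through [dot]. *)
Local Notation quat := 'rV[R]_4.

Definition mkq (a b c d : R) : quat := \row_(i < 4) nth 0 [:: a; b; c; d] i.
Definition co (q : quat) (k : nat) : R := q 0 (inord k).

Definition qI : quat := mkq 0 1 0 0.
Definition qJ : quat := mkq 0 0 1 0.
Definition qK : quat := mkq 0 0 0 1.

Definition qmul (p q : quat) : quat := mkq
  (co p 0 * co q 0 - co p 1 * co q 1 - co p 2 * co q 2 - co p 3 * co q 3)
  (co p 0 * co q 1 + co p 1 * co q 0 + co p 2 * co q 3 - co p 3 * co q 2)
  (co p 0 * co q 2 - co p 1 * co q 3 + co p 2 * co q 0 + co p 3 * co q 1)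
  (co p 0 * co q 3 + co p 1 * co q 2 - co p 2 * co q 1 + co p 3 * co q 0).

Definition qconj (q : quat) : quat :=
  mkq (co q 0) (- co q 1) (- co q 2) (- co q 3).

Definition dot (p q : quat) : R := \sum_(i < 4) p 0 i * q 0 i.

Definition qinv (q : quat) : quat := (dot q q)^-1 *: qconj q.

Definition S3 : set quat := [set q | dot q q = 1].

Definition unit_speed_S3 (g : R -> quat) : Prop :=
  [/\ smooth (g : R^o -> quat), (forall s, S3 (g s)) &
      forall s, dot (derive1 g s) (derive1 g s) = 1].

Definition horizontal (g : R -> quat) : Prop :=
  unit_speed_S3 g /\
  exists psi : R -> R, forall s,
    qmul (derive1 g s) (qinv (g s)) = cos (psi s) *: qJ + sin (psi s) *: qK.

Definition closed_curve (g : R -> quat) : Prop :=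
  exists2 L : R, 0 < L & periodic g L.

End Quaternions.

Section Flatness.
Context (R : realType).
Local Notation plane := 'rV[R]_2.

Definition partial (W : normedModType R) (i : 'I_2) (f : plane -> W) :
  plane -> W := 'D_(delta_mx 0 i) f.

Definition first_fundamental_form (f : plane -> 'rV[R]_4) (x : plane) : 'M[R]_2 :=
  \matrix_(i, j) dot (partial i f x) (partial j f x).

(* [christoffel g k i j] is Gamma^k_ij. *)
Definition christoffel (g : plane -> 'M[R]_2) (k i j : 'I_2) (x : plane) : R :=
  2^-1 * \sum_l invmx (g x) k l *
    (partial i (fun y => g y j l : R^o) x
     + partial j (fun y => g y i l : R^o) x
     - partial l (fun y => g y i j : R^o) x).

(* The component R^l_kij of R(d_i, d_j) d_k
   = nabla_i nabla_j d_k - nabla_j nabla_i d_k. *)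
Definition riemann (g : plane -> 'M[R]_2) (l k i j : 'I_2) (x : plane) : R :=
  partial i (christoffel g l j k : plane -> R^o) x
  - partial j (christoffel g l i k : plane -> R^o) x
  + \sum_m (christoffel g l i m x * christoffel g m j k x
            - christoffel g l j m x * christoffel g m i k x).

Definition flat_metric (g : plane -> 'M[R]_2) : Prop :=
  forall l k i j x, riemann g l k i j x = 0.

End Flatness.

Section Torus.
Context (R : realType) (M : topologicalType).
Local Notation plane := 'rV[R]_2.

(* A torus is R^2/Z^2 up to diffeomorphism: [p] identifies M with the quotient,
   as a space (p is open) and as a manifold, the smooth structure of M being
   the one that makes [p] a local diffeomorphism. *)
Definition torus (p : plane -> M) : Prop :=
  [/\ continuous p,
      (forall A, open A -> open (p @` A)),
      (forall m, exists x, p x = m) &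
      forall x y, p x = p y <-> forall i, (x - y) 0 i \is a Num.int].

(* Smoothness, the immersion property and the induced metric are local, hence
   read through the local diffeomorphism [p]. *)
Definition immersion_S3 (p : plane -> M) (F : M -> 'rV[R]_4) : Prop :=
  [/\ forall m, S3 (F m), smooth (F \o p) & immersive (F \o p)].

Definition flat (p : plane -> M) (F : M -> 'rV[R]_4) : Prop :=
  flat_metric (first_fundamental_form (F \o p)).

Definition covering_map (X Y : topologicalType) (f : X -> Y) : Prop :=
  [/\ continuous f, (forall y, exists x, f x = y) &
  forall y, exists U : set Y, open_nbhs y U /\
    exists (I : Type) (V : I -> set X),
      [/\ forall i, open (V i), trivIset setT V,
          f @^-1` U = \bigcup_i V i &
          forall i, set_bij (V i) U f /\
            (forall A, open A -> A `<=` V i -> open (f @` A))]].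

(* As R^2 is simply connected, a map R^2 -> M is smooth iff it has a smooth lift
   through the smooth covering [p], and it is then a local diffeomorphism iff
   the differential of the lift is injective. *)
Definition smooth_covering (p : plane -> M) (pi : plane -> M) : Prop :=
  covering_map pi /\
  exists phi : plane -> plane,
    [/\ smooth phi, immersive phi & forall x, pi x = p (phi x)].

Definition pt (s t : R) : plane := \row_(i < 2) nth 0 [:: s; t] i.

End Torus.

(* Main.v *)
(* Let f be the lift of F to the plane, N its unit normal, nu = conj f * N and
   mu = f * nu * conj f = N * conj f the two Gauss maps into the 2-sphere. By
   the Gauss equation a flat metric makes both d nu and d mu of rank one, with
   distinct kernels: d nu = b (x) u and d mu = c (x) v with |u| = |v| = 2 and
   closed 1-forms b, c. Their potentials T and S form a map Psi = (S, T) of the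
   plane. The forms b, c are periodic up to sign, so Psi has bounded second
   derivatives and boundedly invertible differentials; hence Psi is a global
   diffeomorphism, with inverse phi. In the asymptotic coordinates (s, t) the
   map nu depends on t alone and mu on s alone, which forces
   conj f * f_t = - nu * u / 2 to be independent of s, and integrating in t gives
   f(s, t) = f(s, 0) * conj f(0, 0) * f(0, t). The two factors, rotated by a unit
   quaternion taking mu(0) to I, are horizontal. Doubled lattice vectors act as
   translations in (s, t), which leave f invariant. As mu(s) has no arbitrarily
   small periods, by the pigeonhole principle some nonzero integer combination
   of these translations has vanishing s-component, so f(0, t) is closed; symmetrically
   for nu and f(s, 0). *)

Require Import Defs.
From HB Require Import structures.
From mathcomp Require Import all_boot all_order all_algebra.
From mathcomp Require Import all_classical all_reals all_analysis.
From mathcomp Require Import ring lra.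

Set Implicit Arguments.
Unset Strict Implicit.
Unset Printing Implicit Defensive.
Set SsrOldRewriteGoalsOrder.

Import Order.TTheory GRing.Theory Num.Theory.
Import numFieldNormedType.Exports.

Local Open Scope classical_set_scope.
Local Open Scope ring_scope.

(** Paired with the left-translated tangent vectors, d nu gives the matrix [- h] of the second
    fundamental form plus an antisymmetric term, of size the area density sqrt(D). Passing to mu (up
    to conjugation by f) reverses that term. The determinant is [det h + D] in both cases, and the
    Gauss equation of a flat metric says that this is 0. The two differentials differ by a tangent
    vector turned by a right angle, which is why no direction lies in both kernels. Since |u| is
    constant, u is orthogonal to du. Comparing mixed second derivatives of nu then shows at once
    that b is closed and that du vanishes on the kernel of b, so that u too depends on t alone. The
    length 2 is what gives the coordinate curves unit speed. The obstacle is global. The inverse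
    function theorem yields coordinates only near a point, and b, c may change sign under a lattice
    translation. Their absolute values are periodic, hence bounded, and this gives radii of
    invertibility that are the same at every point, as path lifting requires. *)

Lemma sum2 (V : nmodType) (F : 'I_2 -> V) : \sum_i F i = F 0 + F 1.
Proof. by rewrite big_ord_recl big_ord1; congr (_ + F _); exact: val_inj. Qed.

Lemma ord2P (i : 'I_2) : i = 0 \/ i = 1.
Proof. by case: i => -[|[|//]] i; [left|right]; exact: val_inj. Qed.

(** * Calculus of smooth maps *)

Section CkCalculus.
Context {R : realType} {V : normedModType R}.
Implicit Types (f g : V -> R^o) (k : nat) (v : V).

Lemma CkSP (W : normedModType R) k (f : V -> W) :
  Ck k.+1 f <-> (forall x, differentiable f x) /\ forall v, Ck k ('D_v f).
Proof. by []. Qed.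

Lemma Ck_continuous (W : normedModType R) k (f : V -> W) :
  Ck k f -> continuous f.
Proof. by case: k => [|k] //= [df _] x; exact: differentiable_continuous. Qed.

Lemma CkW (W : normedModType R) k (f : V -> W) : Ck k.+1 f -> Ck k f.
Proof.
elim: k f => [|k IH] f; first exact: (@Ck_continuous W 1).
by move=> [df Df]; split=> // v; apply: IH; exact: Df.
Qed.

Lemma Ck_cst (W : normedModType R) k (c : W) : Ck k (fun _ : V => c).
Proof.
elim: k c => [|k IH] c; first by move=> x; exact: cvg_cst.
apply/CkSP; split=> [x|v]; first exact: differentiable_cst.
have -> : 'D_v (fun _ : V => c) = fun _ => 0 by apply/funext => x; exact: derive_cst.
exact: IH.
Qed.

Lemma CkD (W : normedModType R) k (f g : V -> W) :
  Ck k f -> Ck k g -> Ck k (fun x => f x + g x).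
Proof.
elim: k f g => [|k IH] f g; first by move=> cf cg x; exact: cvgD (cf x) (cg x).
move=> /CkSP[df Df] /CkSP[dg Dg].
apply/CkSP; split=> [x|v]; first exact: differentiableD.
have -> : 'D_v (fun x => f x + g x) = fun x => 'D_v f x + 'D_v g x.
  by apply/funext => x; rewrite deriveD//; exact: diff_derivable.
by apply: IH; [exact: Df|exact: Dg].
Qed.

Lemma CkM k f g : Ck k f -> Ck k g -> Ck k (fun x => f x * g x : R^o).
Proof.
elim: k f g => [|k IH] f g; first by move=> cf cg x; exact: cvgM (cf x) (cg x).
move=> Hf Hg; case/CkSP: (Hf) => df Df; case/CkSP: (Hg) => dg Dg.
apply/CkSP; split=> [x|v]; first exact: differentiableM.
have -> : 'D_v (fun x => f x * g x : R^o) = fun x => f x * 'D_v g x + g x * 'D_v f x.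
  by apply/funext => x; rewrite deriveM//; exact: diff_derivable.
by apply: CkD; apply: IH => //; exact: CkW.
Qed.

Lemma CkZl (W : normedModType R) k f (w : W) :
  Ck k f -> Ck k (fun x => f x *: w).
Proof.
elim: k f => [|k IH] f; first by move=> cf x; exact: cvgZr_tmp (cf x).
move=> /CkSP[df Df]; apply/CkSP; split=> [x|v]; first exact: differentiableZl.
have -> : 'D_v (fun x => f x *: w) = fun x => 'D_v f x *: w.
  apply/funext => x; rewrite !deriveE//; last exact: differentiableZl.
  by rewrite diffZl.
exact/IH/Df.
Qed.

Lemma CkV k f : (forall x, f x != 0) -> Ck k f -> Ck k (fun x => (f x)^-1 : R^o).
Proof.
move=> f0; elim: k => [|k IH].
  by move=> cf x; exact: cvgV (f0 x) (cf x).
move=> Hf; case/CkSP: (Hf) => df Df; have cf := IH (CkW Hf).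
apply/CkSP; split=> [x|v]; first exact: differentiableV.
have -> : 'D_v (fun x => (f x)^-1 : R^o) =
          fun x => (-1 * ((f x)^-1 * (f x)^-1)) * 'D_v f x.
  apply/funext => x; rewrite deriveV//; last exact: diff_derivable.
  by rewrite mulN1r -expr2 exprVn.
by apply: CkM => //; apply: CkM; [exact: Ck_cst|exact: CkM].
Qed.

(** Regularity of [h'] is asked only along [f], and differentiability of [h] only at the values of
    [f]. This admits the square root on positive functions; its derivative contains the root again,
    so induction on [k] applies. *)
Lemma Ck_comp1 k (h h' : R^o -> R^o) f :
  (forall x, is_derive (f x) (1 : R^o) h (h' (f x))) ->
  (Ck k (fun x => h' (f x))) -> Ck k.+1 f -> Ck k.+1 (fun x => h (f x)).
Proof.
move=> hh Hh /CkSP[df Df].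
have dh x : differentiable h (f x).
  by apply/derivable1_diffP; have [] := hh x.
have dhf x : differentiable (h \o f) x by exact: differentiable_comp.
apply/CkSP; split=> // v.
have -> : 'D_v (fun x => h (f x)) = fun x => h' (f x) * 'D_v f x.
  apply/funext => x; rewrite deriveE; last exact: dhf.
  rewrite [X in X v](@diff_comp _ _ _ _ f h)//= deriveE//.
  rewrite diff1E//= mulrC; congr (_ * _).
  by rewrite derive1E; have [_ ->] := hh x.
by apply: CkM => //; exact: Df.
Qed.

Lemma Ck_sqrt k f : (forall x, 0 < f x) -> Ck k f ->
  Ck k (fun x => Num.sqrt (f x) : R^o).
Proof.
move=> f0; elim: k => [|k IH] Hf.
  by move=> x; apply: continuous_comp; [exact: Hf|exact: sqrt_continuous].
apply: (@Ck_comp1 _ _ (fun y => (2 * Num.sqrt y)^-1)) => // [x|].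
  exact: is_derive1_sqrt.
have cf := IH (CkW Hf).
apply: (@CkV k (fun x => 2 * Num.sqrt (f x))) => [x|].
  by rewrite mulf_neq0// gt_eqF// sqrtr_gt0.
by apply: CkM => //; exact: Ck_cst.
Qed.

(** Joint induction: up to sign, each function is the derivative of the other. *)
Lemma Ck_cos_sin k f : Ck k f ->
  Ck k (fun x => cos (f x) : R^o) /\ Ck k (fun x => sin (f x) : R^o).
Proof.
elim: k => [|k IH] Hf.
  split=> x; apply: continuous_comp; try exact: Hf.
    exact: continuous_cos.
  exact: continuous_sin.
have [cf sf] := IH (CkW Hf).
split.
- apply: (@Ck_comp1 _ _ (fun y => - sin y)) => //.
  have -> : (fun x => - sin (f x) : R^o) = fun x => -1 * sin (f x).
    by apply/funext => x; rewrite mulN1r.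
  by apply: CkM => //; exact: Ck_cst.
- exact: (@Ck_comp1 _ _ (fun y => cos y)).
Qed.

End CkCalculus.

Section CkRows.
Context {R : realType} {V : normedModType R} {n : nat}.
Implicit Types (k : nat) (v : V).

Lemma Ck_sum (W : normedModType R) k (I : Type) (r : seq I) (F : I -> V -> W) :
  (forall i, Ck k (F i)) -> Ck k (fun x => \sum_(i <- r) F i x).
Proof.
move=> HF; elim: r => [|i r IH].
  have -> : (fun x => \sum_(i <- [::]) F i x) = fun _ : V => 0.
    by apply/funext => x; rewrite big_nil.
  exact: Ck_cst.
have -> : (fun x => \sum_(i <- i :: r) F i x)
          = fun x => F i x + \sum_(i <- r) F i x.
  by apply/funext => x; rewrite big_cons.
exact: CkD.
Qed.

Lemma derive_coord (f : V -> 'rV[R]_n) v x i : differentiable f x ->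
  'D_v (fun y => f y 0 i : R^o) x = 'D_v f x 0 i.
Proof. by move=> df; rewrite derive_mx ?mxE//; exact: diff_derivable. Qed.

Lemma differentiable_row_coord (f : V -> 'rV[R]_n) x i : differentiable f x ->
  differentiable (fun y => f y 0 i : R^o) x.
Proof.
move=> df.
apply: (@differentiable_comp _ _ _ _ f (fun y : 'rV[R]_n => y 0 i : R^o)) => //.
exact: differentiable_coord.
Qed.

Lemma Ck_coord k (f : V -> 'rV[R]_n) i :
  Ck k f -> Ck k (fun x => f x 0 i : R^o).
Proof.
elim: k f => [|k IH] f.
  move=> cf x; apply: (@continuous_comp _ _ _ f (fun y => y 0 i : R^o)).
    exact: cf.
  exact: coord_continuous.
move=> /CkSP[df Df]; apply/CkSP; split=> [x|v].
  exact: differentiable_row_coord.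
have -> : 'D_v (fun x => f x 0 i : R^o) = fun x => 'D_v f x 0 i.
  by apply/funext => x; exact: derive_coord.
exact/IH/Df.
Qed.

Lemma Ck_row k (f : V -> 'rV[R]_n) :
  (forall i, Ck k (fun x => f x 0 i : R^o)) -> Ck k f.
Proof.
move=> Hf.
have -> : f = fun x => \sum_i f x 0 i *: delta_mx 0 i.
  by apply/funext => x; exact: row_sum_delta.
by apply: Ck_sum => i; exact: CkZl.
Qed.

Lemma diff_row (W : normedModType R) (h : 'rV[R]_n -> W) y w : differentiable h y ->
  'd h y w = \sum_i w 0 i *: 'D_(delta_mx 0 i) h y.
Proof.
move=> dh; rewrite {1}(row_sum_delta w) linear_sum; apply: eq_bigr => i _.
by rewrite linearZ deriveE.
Qed.

Lemma derive_comp_row (W : normedModType R) (h : 'rV[R]_n -> W)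
    (f : V -> 'rV[R]_n) v x :
  differentiable h (f x) -> differentiable f x ->
  'D_v (fun y => h (f y)) x =
  \sum_i 'D_v f x 0 i *: 'D_(delta_mx 0 i) h (f x).
Proof.
move=> dh df; rewrite deriveE; last exact: (@differentiable_comp _ _ _ _ f h).
by rewrite [X in X v](@diff_comp _ _ _ _ f h)//= diff_row// (deriveE _ df).
Qed.

Lemma Ck_comp k (h : 'rV[R]_n -> R^o) (f : V -> 'rV[R]_n) :
  Ck k h -> Ck k f -> Ck k (fun x => h (f x)).
Proof.
elim: k h f => [|k IH] h f.
  by move=> ch cf x; apply: continuous_comp; [exact: cf|exact: ch].
move=> /CkSP[dh Dh] Hf; case/CkSP: (Hf) => df Df.
apply/CkSP; split=> [x|v].
  exact: (@differentiable_comp _ _ _ _ f h).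
have -> : 'D_v (fun y => h (f y)) = fun x =>
  \sum_i 'D_v f x 0 i * 'D_(delta_mx 0 i) h (f x).
  by apply/funext => x; rewrite derive_comp_row.
apply: Ck_sum => i; apply: CkM; first exact/Ck_coord/Df.
by apply: (IH ('D_(delta_mx 0 i) h)); [exact: Dh|exact: CkW].
Qed.

End CkRows.

Section Smooth.
Context {R : realType} {V : normedModType R}.
Implicit Types f g : V -> R^o.

Lemma smooth_differentiable (W : normedModType R) (f : V -> W) x :
  smooth f -> differentiable f x.
Proof. by move=> /(_ 1%N)/CkSP[]. Qed.

Lemma smooth_continuous (W : normedModType R) (f : V -> W) :
  smooth f -> continuous f.
Proof. by move=> /(_ 0%N). Qed.

Lemma smooth_derive (W : normedModType R) (f : V -> W) v :
  smooth f -> smooth ('D_v f).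
Proof. by move=> sf k; have /CkSP[_] := sf k.+1; exact. Qed.

Lemma smooth_cst (W : normedModType R) (c : W) : smooth (fun _ : V => c).
Proof. by move=> k; exact: Ck_cst. Qed.

Lemma smoothD (W : normedModType R) (f g : V -> W) :
  smooth f -> smooth g -> smooth (fun x => f x + g x).
Proof. by move=> sf sg k; exact: CkD. Qed.

Lemma smoothM f g : smooth f -> smooth g -> smooth (fun x => f x * g x : R^o).
Proof. by move=> sf sg k; exact: CkM. Qed.

Lemma smoothN f : smooth f -> smooth (fun x => - f x : R^o).
Proof.
move=> sf; have -> : (fun x => - f x : R^o) = (fun x => -1 * f x : R^o).
  by apply/funext => x; rewrite mulN1r.
by apply: smoothM => //; exact: smooth_cst.
Qed.

Lemma smoothB f g : smooth f -> smooth g -> smooth (fun x => f x - g x : R^o).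
Proof. by move=> sf sg; apply: smoothD => //; exact: smoothN. Qed.

Lemma smoothV f : (forall x, f x != 0) -> smooth f ->
  smooth (fun x => (f x)^-1 : R^o).
Proof. by move=> f0 sf k; exact: CkV. Qed.

Lemma smooth_sqrt f : (forall x, 0 < f x) -> smooth f ->
  smooth (fun x => Num.sqrt (f x) : R^o).
Proof. by move=> f0 sf k; exact: Ck_sqrt. Qed.

Lemma smooth_cos f : smooth f -> smooth (fun x => cos (f x) : R^o).
Proof. by move=> sf k; have [] := Ck_cos_sin (sf k). Qed.

Lemma smooth_sin f : smooth f -> smooth (fun x => sin (f x) : R^o).
Proof. by move=> sf k; have [] := Ck_cos_sin (sf k). Qed.

Lemma smooth_row n (f : V -> 'rV[R]_n) :
  (forall i, smooth (fun x => f x 0 i : R^o)) -> smooth f.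
Proof. by move=> sf k; apply: Ck_row => i; exact: sf. Qed.

Lemma smooth_coord n (f : V -> 'rV[R]_n) i :
  smooth f -> smooth (fun x => f x 0 i : R^o).
Proof. by move=> sf k; exact: Ck_coord. Qed.

Lemma smooth_comp n (h : 'rV[R]_n -> R^o) (f : V -> 'rV[R]_n) :
  smooth h -> smooth f -> smooth (fun x => h (f x)).
Proof. by move=> sh sf k; exact: Ck_comp. Qed.

Lemma smooth_id : smooth (fun x : V => x).
Proof.
case=> [|k]; first by move=> x; exact: cvg_id.
apply/CkSP; split=> [x|v]; first exact: ex_diff.
have -> : 'D_v (fun x : V => x) = fun _ => v.
  by apply/funext => x; exact: derive_id.
exact: Ck_cst.
Qed.

End Smooth.

(** The two difference quotients coincide. Since just the derivative along [v] is assumed, this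
    applies to a function not yet known to be differentiable. *)
Lemma is_derive_line (R : realType) (V W : normedModType R) (f : V -> W) (x v : V) (t : R) d :
  is_derive (x + t *: v) v f d -> is_derive t (1 : R) (fun t : R => f (x + t *: v)) d.
Proof.
have E : (fun h : R => h^-1 *: (((fun t : R => f (x + t *: v)) \o shift t) (h *: (1 : R))
      - f (x + t *: v))) =
    (fun h => h^-1 *: ((f \o shift (x + t *: v)) (h *: v) - f (x + t *: v))).
  by apply/funext => h /=; rewrite [h *: _]mulr1 scalerDl addrCA.
move=> [df dE]; apply: DeriveDef; first by rewrite /derivable E.
by rewrite -dE /derive E.
Qed.

(** * Partial derivatives and the mean value theorem in the plane *)

Section PlaneCalculus.
Context {R : realType}.
Local Notation plane := 'rV[R]_2.
Implicit Types (f g : plane -> R^o) (x y h c : plane) (i j : 'I_2).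

Lemma partial_cst (W : normedModType R) i (w : W) x :
  partial i (fun _ => w) x = 0.
Proof. exact: derive_cst. Qed.

Lemma partialD (W : normedModType R) i (f g : plane -> W) x :
  smooth f -> smooth g ->
  partial i (fun y => f y + g y) x = partial i f x + partial i g x.
Proof.
move=> sf sg; rewrite /partial deriveD//; apply: diff_derivable;
  exact: smooth_differentiable.
Qed.

Lemma partialM i f g x : smooth f -> smooth g ->
  partial i (fun y => f y * g y : R^o) x = partial i f x * g x + f x * partial i g x.
Proof.
move=> sf sg; rewrite /partial deriveM; first by rewrite addrC; congr (_ + _); exact: mulrC.
all: by apply: diff_derivable; exact: smooth_differentiable.
Qed.

Lemma partialN i f x : smooth f ->
  partial i (fun y => - f y : R^o) x = - partial i f x.
Proof.
move=> sf; rewrite /partial deriveN//.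
by apply: diff_derivable; exact: smooth_differentiable.
Qed.

Lemma partialB i f g x : smooth f -> smooth g ->
  partial i (fun y => f y - g y : R^o) x = partial i f x - partial i g x.
Proof.
by move=> sf sg; rewrite partialD ?partialN//; exact: smoothN.
Qed.

Lemma partial_coord (n : nat) i (f : plane -> 'rV[R]_n) k x : smooth f ->
  partial i (fun y => f y 0 k : R^o) x = partial i f x 0 k.
Proof. by move=> sf; apply: derive_coord; exact: smooth_differentiable. Qed.

Lemma partial_shift (W : normedModType R) i (f : plane -> W) c x :
  partial i (fun y => f (y + c)) x = partial i f (x + c).
Proof.
rewrite /partial /derive.
have -> : (fun y => f (y + c)) \o shift x = f \o shift (x + c).
  by apply/funext => h /=; rewrite addrA.
by [].
Qed.

Lemma smooth_shift f c : smooth f -> smooth (fun y => f (y + c)).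
Proof.
move=> sf; apply: (@smooth_comp _ _ _ f (fun y => y + c)) => //.
by apply: smoothD; [exact: smooth_id|exact: smooth_cst].
Qed.

Lemma derive_line f x h (t : R^o) : (forall y, differentiable f y) ->
  is_derive t (1 : R^o) (fun t : R^o => f (x + t *: h))
    (\sum_i h 0 i * partial i f (x + t *: h)).
Proof.
move=> df.
have dl : differentiable (fun t : R^o => x + t *: h) t.
  apply: differentiableD; first exact: differentiable_cst.
  by apply: differentiableZl; exact: ex_diff.
have dc : differentiable (fun t : R^o => f (x + t *: h)) t.
  exact: (@differentiable_comp _ _ _ _ (fun t : R^o => x + t *: h) f).
apply: DeriveDef; first exact: diff_derivable.
rewrite (@derive_comp_row _ _ _ _ f)//; apply: eq_bigr => i _.
rewrite deriveD; [|exact: derivable_cst|].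
  rewrite derive_cst add0r.
  rewrite deriveE; last by apply: differentiableZl; exact: ex_diff.
  by rewrite diffZl ?diff_val ?scale1r.
by apply: diff_derivable; apply: differentiableZl; exact: ex_diff.
Qed.

Lemma plane_MVT f x y : (forall z, differentiable f z) ->
  exists2 t : R, 0 <= t <= 1 &
    f y - f x = \sum_i (y - x) 0 i * partial i f (x + t *: (y - x)).
Proof.
move=> df; have dl t := derive_line x (y - x) t df.
have cl : {within `[0, 1], continuous (fun t : R => f (x + t *: (y - x)))}.
  apply: continuous_subspaceT => t; apply: differentiable_continuous.
  by apply/derivable1_diffP; have [] := dl t.
have [t + E] := MVT_segment ler01 (fun t _ => dl t) cl.
rewrite in_itv/= => t01; exists t => //.
by move: E; rewrite scale1r scale0r addr0 subr0 mulr1 (addrC x) subrK.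
Qed.

Lemma partial_eq0_cst f x y : smooth f -> (forall i z, partial i f z = 0) ->
  f x = f y.
Proof.
move=> sf f0; have [|t _ E] := @plane_MVT f x y.
  by move=> z; exact: smooth_differentiable.
apply/eqP; rewrite eq_sym -subr_eq0 E big1// => i _; by rewrite f0 mulr0.
Qed.

End PlaneCalculus.

Section RowNorm.
Context {R : realType} {n : nat}.
Implicit Types v : 'rV[R]_n.

Lemma row_norm_le v (M : R) : 0 <= M -> (forall i, `|v 0 i| <= M) -> `|v| <= M.
Proof.
move=> M0 vM; rewrite [leLHS]/Num.Def.normr/= mx_normrE bigmax_le//= => -[a b] _.
by rewrite /= ord1.
Qed.

Lemma row_norm_ge v i : `|v 0 i| <= `|v|.
Proof.
by rewrite [leRHS]/Num.Def.normr/= mx_normrE; exact: (le_bigmax _ _ (ord0, i)).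
Qed.

Lemma norm_delta_row_le i : `|delta_mx 0 i : 'rV[R]_n| <= 1.
Proof.
by apply: row_norm_le => // j; rewrite mxE eqxx/=; case: eqP; rewrite ?normr1 ?normr0.
Qed.

End RowNorm.

Lemma ler_dist_half (R : realType) (a b c eps : R) :
  `|a - b| <= eps / 2 -> `|c - b| <= eps / 2 -> `|a - c| <= eps.
Proof.
move=> ab cb; rewrite -(subrKA b) (le_trans (ler_normD _ _))//.
by rewrite [leRHS]splitr lerD// distrC.
Qed.

#[local] Opaque derive.

(** * Symmetry of second partial derivatives *)

Section Schwarz.
Context {R : realType}.
Local Notation plane := 'rV[R]_2.
Local Notation e i := (delta_mx 0 i : plane).
Implicit Types (f : plane -> R^o) (x : plane) (h : R) (i j : 'I_2).

Lemma plane_MVT_dir f x h i : (forall z, differentiable f z) ->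
  exists2 s : R, 0 <= s <= 1 &
    f (x + h *: e i) - f x = h * partial i f (x + (s * h) *: e i).
Proof.
move=> df; have [s s01 E] := plane_MVT x (x + h *: e i) df.
exists s => //; rewrite E addrAC subrr add0r scalerA (bigD1 i)//= big1 ?addr0.
  by rewrite !mxE !eqxx mulr1.
by move=> k /negbTE ki; rewrite !mxE ki andbF mulr0 mul0r.
Qed.

(** The mean value theorem is applied to the increment of [f] by [h *: e j], moving along [e i], and
    then to [partial i f] along [e j]. The second difference is symmetric in [i] and [j], whereas
    the right-hand side samples one of the two mixed derivatives. *)
Lemma second_difference f x h i j : smooth f ->
  exists s t : R, [/\ 0 <= s <= 1, 0 <= t <= 1 &
    f (x + h *: e i + h *: e j) - f (x + h *: e i)
      - (f (x + h *: e j) - f x) =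
    h * (h * partial j (partial i f) (x + (s * h) *: e i + (t * h) *: e j))].
Proof.
move=> sf; pose G y : R^o := f (y + h *: e j) - f y.
have sG : smooth G by apply: smoothB => //; exact: smooth_shift.
have [s s01 Es] := plane_MVT_dir x h i (fun z => smooth_differentiable z sG).
have sf' : smooth (partial i f) by exact: smooth_derive.
have [t t01 Et] := plane_MVT_dir (x + (s * h) *: e i) h j
  (fun z => smooth_differentiable z sf').
exists s, t; split=> //; rewrite -Et -/(G _) -/(G x) Es; congr (_ * _).
apply: etrans (partialB i _ (smooth_shift (h *: e j) sf) sf) _.
by congr (_ - _); exact: partial_shift.
Qed.

Lemma partialC f i j x : smooth f ->
  partial i (partial j f) x = partial j (partial i f) x.
Proof.
move=> sf; apply/eqP; rewrite -subr_eq0 -normr_le0; apply/ler_addgt0Pl => eps eps0.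
rewrite addr0.
have cA : {for x, continuous (partial i (partial j f))}.
  by apply: smooth_continuous; do 2! apply: smooth_derive.
have cB : {for x, continuous (partial j (partial i f))}.
  by apply: smooth_continuous; do 2! apply: smooth_derive.
have e20 : 0 < eps / 2 by rewrite divr_gt0.
move/cvgrPdist_lt : cA => /(_ _ e20) /nbhs_ballP[r r0 HA].
move/cvgrPdist_lt : cB => /(_ _ e20) /nbhs_ballP[r' r'0 HB].
(* The intermediate points are displaced twice, each time by at most [h], so a quarter of the radius
   keeps them strictly inside both balls. *)
pose h := Num.min r r' / 4.
have h0 : 0 < h by rewrite divr_gt0// lt_min; apply/andP; split.
have near_x s t k l : 0 <= s <= 1 -> 0 <= t <= 1 ->
    `|x - (x + (s * h) *: e k + (t * h) *: e l)| < Num.min r r'.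
  move=> /andP[s0 s1] /andP[t0 t1].
  rewrite -addrA opprD addNKr normrN (le_lt_trans (ler_normD _ _))//.
  have H (u : R) m : 0 <= u -> u <= 1 -> `|(u * h) *: e m| <= h.
    move=> u0 u1; rewrite normrZ ger0_norm; last by rewrite mulr_ge0// ltW.
    rewrite -[leRHS]mul1r -[leRHS]mulr1 ler_pM//.
    - by rewrite mulr_ge0// ltW.
    - by rewrite ler_wpM2r// ltW.
    - exact: norm_delta_row_le.
  rewrite (le_lt_trans (lerD (H s k s0 s1) (H t l t0 t1)))//.
  by rewrite /h; move: h0; rewrite /h; set m := Num.min _ _; lra.
have [s [t [s01 t01 E1]]] := second_difference x h j i sf.
have [s' [t' [s'01 t'01 E2]]] := second_difference x h i j sf.
have E : partial i (partial j f) (x + (s * h) *: e j + (t * h) *: e i) =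
         partial j (partial i f) (x + (s' * h) *: e i + (t' * h) *: e j).
  apply: (mulfI (lt0r_neq0 h0)); apply: (mulfI (lt0r_neq0 h0)).
  apply: etrans (esym E1) (etrans _ E2); rewrite (addrAC x).
  move: (f (x + h *: e i + h *: e j)) (f (x + h *: e j)) (f (x + h *: e i)) (f x).
  by move=> a b c d; rewrite !opprB addrACA [RHS]addrACA [- b + _]addrC.
have := near_x s t j i s01 t01; rewrite lt_min => /andP[p1 _].
have := near_x s' t' i j s'01 t'01; rewrite lt_min => /andP[_ p2].
have /ltW H1 : `|partial i (partial j f) x -
    partial i (partial j f) (x + (s * h) *: e j + (t * h) *: e i)| < eps / 2.
  by apply: HA; rewrite -ball_normE.
have /ltW H2 : `|partial j (partial i f) x -
    partial j (partial i f) (x + (s' * h) *: e i + (t' * h) *: e j)| < eps / 2.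
  by apply: HB; rewrite -ball_normE.
rewrite -E in H2.
exact: ler_dist_half H1 H2.
Qed.

End Schwarz.

(** * The Poincare lemma on the plane *)

Section Differentiability.
Context {R : realType}.

Lemma differentiable_approx (V W : normedModType R) (f : V -> W)
    (L : {linear V -> W}) x : continuous L ->
  (forall eps : R, 0 < eps -> exists2 delta : R, 0 < delta &
    forall h, `|h| < delta -> `|f (h + x) - f x - L h| <= eps * `|h|) ->
  differentiable f x /\ 'd f x = L :> (V -> W).
Proof.
move=> cL HL.
have E : f \o shift x = cst (f x) + L +o_ 0 id.
  apply/eqaddoP => eps eps0; have [d d0 Hd] := HL _ eps0.
  apply/nbhs_ballP; exists d => //= h; rewrite -ball_normE /= sub0r normrN => hd.
  by rewrite /= opprD addrA; exact: Hd.
have dE : 'd f x = L :> (V -> W) by exact: diff_unique.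
split=> //; apply/diff_locallyP; rewrite dE; split => //.
Qed.

Local Notation plane := 'rV[R]_2.
Local Notation e i := (delta_mx 0 i : plane).

Definition row_linear (c : 'I_2 -> R) : plane -> R^o := fun h => \sum_i h 0 i * c i.

Lemma row_linear_is_linear c : linear (row_linear c).
Proof.
move=> k u v; rewrite /row_linear scaler_sumr -big_split/=; apply: eq_bigr => i _.
by rewrite !mxE mulrDl -mulrA.
Qed.

HB.instance Definition _ c :=
  GRing.isLinear.Build R plane R^o _ (row_linear c) (row_linear_is_linear c).

Lemma continuous_row_linear c : continuous (row_linear c).
Proof.
move=> x; apply: (@Ck_continuous _ _ _ 0%N) => //; apply: Ck_sum => i.
by apply: CkM; [exact: (Ck_coord i (@smooth_id _ plane 0%N))|exact: Ck_cst].
Qed.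

(** Allows [h] of either sign and a derivative known along [e i] alone, as is needed to pass from
    partial derivatives to the differential. *)
Lemma partial_MVT (f : plane -> R^o) (a : plane -> R) i x (h : R) :
  (forall y, is_derive y (e i) f (a y)) ->
  exists2 s : R, `|s| <= `|h| &
    f (x + h *: e i) - f x = h * a (x + s *: e i).
Proof.
move=> Df.
have dl (t : R) : is_derive t (1 : R) (fun t : R => f (x + t *: e i))
    (a (x + t *: e i)) by apply: is_derive_line.
have cl A : {within A, continuous (fun t : R => f (x + t *: e i))}.
  apply: continuous_subspaceT => t; apply: differentiable_continuous.
  by apply/derivable1_diffP; have [] := dl t.
have [h0|h0] := leP 0 h.
- have [s + E] := MVT_segment h0 (fun t _ => dl t) (cl _).
  rewrite in_itv/= => /andP[s0 sh]; exists s; first by rewrite !ger0_norm.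
  by move: E; rewrite scale0r addr0 subr0 mulrC.
- have [s + E] := MVT_segment (ltW h0) (fun t _ => dl t) (cl _).
  rewrite in_itv/= => /andP[s0 sh]; exists s.
    by rewrite !ler0_norm ?lerN2// ltW.
  move: E; rewrite scale0r addr0 sub0r => E.
  by apply: oppr_inj; rewrite opprB; apply: etrans E _; rewrite mulrN mulrC.
Qed.

Lemma increment_split (A B C p q u v h0 h1 : R) :
  B - C = h0 * q -> A - B = h1 * v ->
  A - C - (h0 * p + h1 * u) = h0 * (q - p) + h1 * (v - u).
Proof.
move=> BC AB; have -> : A = h1 * v + (h0 * q + C) by rewrite -BC -AB !subrK.
ring.
Qed.

(** The increment is split into one step along each axis. Each step is a partial derivative at a
    nearby point, which continuity compares with its value at [x]. *)
Lemma differentiable_partials (f : plane -> R^o) (a : 'I_2 -> plane -> R) x :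
  (forall i y, is_derive y (e i) f (a i y)) ->
  (forall i, {for x, continuous (a i : plane -> R^o)}) ->
  differentiable f x /\ 'd f x = row_linear (a^~ x) :> (plane -> R^o).
Proof.
move=> Df ca.
apply: (@differentiable_approx _ _ f (row_linear (a^~ x) : {linear plane -> R^o})).
  exact: continuous_row_linear.
move=> eps eps0; have eps20 : 0 < eps / 2 by rewrite divr_gt0.
have [d d0 Hd] : exists2 d : R, 0 < d &
    forall i y, `|y| < d -> `|a i (x + y) - a i x| <= eps / 2.
  have H i : exists2 d : R, 0 < d &
      forall y, `|y| < d -> `|a i (x + y) - a i x| <= eps / 2.
    move/cvgrPdist_le : (ca i) => /(_ _ eps20)/nbhs_ballP[d /= d0 Hd]; exists d => // y yd.
    rewrite distrC; apply: Hd; rewrite -ball_normE/=.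
    by rewrite opprD addNKr normrN.
  have [d d0 Hd] := H 0; have [d' d'0 Hd'] := H 1.
  exists (Num.min d d'); first by rewrite lt_min d0.
  move=> i y; rewrite lt_min => /andP[yd yd'].
  by have [->|->] := ord2P i; [exact: Hd|exact: Hd'].
exists d => // h hd.
pose h0 := h 0 0; pose h1 := h 0 1.
have hE : h + x = x + h0 *: e 0 + h1 *: e 1.
  by rewrite [in LHS](row_sum_delta h) sum2 [LHS]addrC [LHS]addrA.
have nh0 : `|h0| <= `|h| by exact: row_norm_ge.
have nh1 : `|h1| <= `|h| by exact: row_norm_ge.
have [s0 s0h E0] := partial_MVT x h0 (Df 0).
have [s1 s1h E1] := partial_MVT (x + h0 *: e 0) h1 (Df 1).
have B0 : `|a 0 (x + s0 *: e 0) - a 0 x| <= eps / 2.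
  apply: Hd; rewrite (le_lt_trans _ hd)// row_norm_le// => i.
  rewrite !mxE; have [->|->] := ord2P i; rewrite /= ?mulr1 ?mulr0 ?normr0//.
  exact: le_trans s0h _.
have B1 : `|a 1 (x + h0 *: e 0 + s1 *: e 1) - a 1 x| <= eps / 2.
  rewrite -addrA; apply: Hd; rewrite (le_lt_trans _ hd)// row_norm_le// => i.
  rewrite !mxE; have [->|->] := ord2P i; rewrite /= ?mulr1 ?mulr0 ?addr0 ?add0r//.
  exact: le_trans s1h _.
have LE : row_linear (a^~ x) h = h0 * a 0 x + h1 * a 1 x.
  by rewrite /row_linear sum2.
have -> : f (h + x) - f x - row_linear (a^~ x) h =
   h0 * (a 0 (x + s0 *: e 0) - a 0 x) + h1 * (a 1 (x + h0 *: e 0 + s1 *: e 1) - a 1 x).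
  by rewrite LE hE; exact: increment_split E0 E1.
rewrite (le_trans (ler_normD _ _))// !normrM [eps]splitr mulrDl lerD// mulrC ler_pM//.
Qed.

Lemma smooth_partials (f : plane -> R^o) :
  (forall x, differentiable f x) -> (forall i, smooth (partial i f)) -> smooth f.
Proof.
move=> df sf; case=> [|k]; first by move=> x; exact: differentiable_continuous.
apply/CkSP; split=> // v.
have -> : 'D_v f = fun x => \sum_i v 0 i *: partial i f x.
  by apply/funext => x; rewrite deriveE// diff_row.
apply: Ck_sum => i; apply: (@CkM _ _ k (fun _ => v 0 i)); first exact: Ck_cst.
exact: sf.
Qed.

End Differentiability.

Section Poincare.
Context {R : realType}.
Local Notation plane := 'rV[R]_2.
Local Notation e i := (delta_mx 0 i : plane).
Local Notation mu := (@lebesgue_measure R).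

Lemma continuous_bounded_ball (g : plane -> R^o) (M : R) : continuous g ->
  exists C : R, forall y, `|y| <= M -> `|g y| <= C.
Proof.
move=> cg; have [M0|M0] := ltP M 0.
  by exists 0 => y yM; have := le_lt_trans yM M0; rewrite normr_lt0.
pose A : set plane := closed_ball_ Num.norm 0 M.
have AE y : A y = (`|y| <= M) :> Prop by rewrite /A /closed_ball_/= sub0r normrN.
have cA : compact A.
  apply: bounded_closed_compact; last exact: closed_closed_ball_.
  exists M; split; first exact: num_real.
  by move=> N MN y /=; rewrite AE => yM; rewrite (le_trans yM)// ltW.
have A0 : A !=set0 by exists 0; rewrite AE normr0.
have cn : {within A, continuous (fun y => `|g y|)}.
  apply: continuous_subspaceT => y.
  by apply: continuous_comp; [exact: cg|exact: norm_continuous].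
have [c _ Hc] := EVT_max_rV A0 cA cn.
by exists (`|g c|) => y yM; apply: Hc; rewrite inE AE.
Qed.

Lemma continuous_ray (g : plane -> R^o) y : continuous g ->
  continuous (fun u : R => g (u *: y) : R^o).
Proof.
move=> cg u.
apply: (@continuous_comp _ _ _ (fun u : R => u *: y) g); last exact: cg.
exact: scalel_continuous.
Qed.

Lemma partial_dilate (g : plane -> R^o) (u : R) i y : smooth g ->
  partial i (fun y => g (u *: y)) y = u * partial i g (u *: y).
Proof.
move=> sg; have dg := smooth_differentiable (u *: y) sg.
rewrite /partial (@derive_comp_row _ _ _ _ g (fun y => u *: y))//.
have -> : 'D_(e i) (fun y : plane => u *: y) y = u *: e i.
  by rewrite deriveZ ?derive_id//; exact: derivable_id.
rewrite (bigD1 i)//= big1 ?addr0; first by rewrite !mxE !eqxx mulr1.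
by move=> k /negbTE ki; rewrite !mxE ki andbF mulr0 scale0r.
Qed.

Lemma smooth_dilate (g : plane -> R^o) (u : R) : smooth g ->
  smooth (fun y => g (u *: y)).
Proof.
move=> sg; apply: (@smooth_comp _ _ _ g (fun y => u *: y)) => //.
apply: smooth_row => k.
have -> : (fun y : plane => (u *: y) 0 k : R^o) = fun y => u * y 0 k.
  by apply/funext => y; rewrite mxE.
apply: smoothM; first exact: smooth_cst.
by apply: smooth_coord; exact: smooth_id.
Qed.

Lemma smooth_is_derive (V W : normedModType R) (f : V -> W) x v : smooth f ->
  is_derive x v f ('D_v f x).
Proof.
move=> sf; apply: DeriveDef => //.
by apply: diff_derivable; exact: smooth_differentiable.
Qed.

Context (a : 'I_2 -> plane -> R^o).
Hypothesis sa : forall i, smooth (a i).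
Hypothesis closed_a : forall x, partial 0 (a 1) x = partial 1 (a 0) x.

(** The potential is the integral of the form along the ray from 0 to [y], with [K] as integrand in
    the ray parameter [u]. [D] is both the derivative of [K] along [e i], by closedness, and the
    derivative of [u * a i (u *: y)] in [u]; so its integral over [0, 1] is [a i y]. *)
Let K (y : plane) (u : R) : R := y 0 0 * a 0 (u *: y) + y 0 1 * a 1 (u *: y).
Let D i (y : plane) (u : R) : R := a i (u *: y) +
  u * (y 0 0 * partial 0 (a i) (u *: y) + y 0 1 * partial 1 (a i) (u *: y)).

Let da i k x : partial i (a k) x = partial k (a i) x.
Proof. by have [->|->] := ord2P i; have [->|->] := ord2P k. Qed.

Let sK u : smooth (fun y => K y u : R^o).
Proof.
by apply: smoothD; apply: smoothM; solve [exact: smooth_dilate |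
  apply: smooth_coord; exact: smooth_id].
Qed.

Let KD i y u : is_derive y (e i) (fun y => K y u : R^o) (D i y u).
Proof.
suff <- : partial i (fun y => K y u : R^o) y = D i y u.
  exact: (smooth_is_derive _ _ (sK u)).
have sc k : smooth (fun y : plane => y 0 k : R^o).
  by apply: smooth_coord; exact: smooth_id.
have sd k : smooth (fun y => a k (u *: y)) by exact: smooth_dilate.
have dc k : partial i (fun y : plane => y 0 k : R^o) y = (i == k)%:R.
  rewrite (partial_coord i k y (@smooth_id _ _)) /partial derive_id mxE eqxx/=.
  by rewrite eq_sym.
rewrite /K partialD; [|exact: smoothM..].
rewrite !partialM// !dc !partial_dilate// /D !(da _ i).
by have [->|->] := ord2P i; rewrite !(mul1r, mul0r, add0r, addr0, eqxx)/=; ring.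
Qed.

Let DF i y (u : R) : is_derive u (1 : R) (fun u : R => u * a i (u *: y)) (D i y u).
Proof.
have H := derive_line 0 y u (fun z => smooth_differentiable z (sa i)).
have E : (fun t : R^o => a i (0 + t *: y)) = (fun t : R^o => a i (t *: y)).
  by apply/funext => t; rewrite add0r.
rewrite E in H.
have := @is_deriveM R R^o (fun u => u) (fun t : R^o => a i (t *: y)) u 1 1 _
  (is_derive_id _ _) H.
move=> H'; apply: is_derive_eq H' _.
by rewrite sum2 add0r /D [LHS]addrC; congr (_ + _); rewrite /GRing.scale/= mulr1.
Qed.

(** The dominating constant for differentiation under the integral sign. *)
Let D_bounded i x : exists C : R, forall r u : R,
  -1 <= r <= 1 -> 0 <= u <= 1 -> `|D i (x + r *: e i) u| <= C.
Proof.
pose M := `|x| + 1.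
have M0 : 0 <= M by rewrite addr_ge0.
have [C0 H0] := continuous_bounded_ball M (smooth_continuous (sa i)).
have [C1 H1] := continuous_bounded_ball M
  (smooth_continuous (smooth_derive (e 0) (sa i))).
have [C2 H2] := continuous_bounded_ball M
  (smooth_continuous (smooth_derive (e 1) (sa i))).
exists (C0 + (M * C1 + M * C2)) => r u /andP[r0 r1] /andP[u0 u1].
have yM : `|x + r *: e i| <= M.
  rewrite (le_trans (ler_normD _ _))// lerD2l normrZ -[leRHS]mul1r ler_pM//.
    by rewrite ler_norml r0.
  exact: norm_delta_row_le.
set y := x + r *: e i in yM *.
have uyM : `|u *: y| <= M.
  by rewrite normrZ ger0_norm// (le_trans _ yM)// ler_piMl.
have yk k : `|y 0 k| <= M by exact: le_trans (row_norm_ge _ _) yM.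
rewrite (le_trans (ler_normD _ _))// lerD//; first exact: H0.
rewrite normrM ger0_norm// (le_trans (ler_piMl _ u1))//.
rewrite (le_trans (ler_normD _ _))// !normrM lerD// ler_pM//.
  exact: H1.
exact: H2.
Qed.

Let cK y : continuous (fun u : R => K y u).
Proof.
apply: (@Ck_continuous _ R^o R^o 0%N (fun u : R^o => K y u)).
by apply: CkD; apply: CkM; solve [exact: Ck_cst |
  apply: continuous_ray; exact: smooth_continuous].
Qed.

Let cD i y : continuous (fun u : R => D i y u).
Proof.
have cray k : continuous (fun u : R => partial k (a i) (u *: y) : R^o).
  by apply: continuous_ray; apply: smooth_continuous; exact: smooth_derive.
apply: (@Ck_continuous _ R^o R^o 0%N (fun u : R^o => D i y u)).
apply: CkD; first by apply: continuous_ray; exact: smooth_continuous.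
apply: CkM; first exact: smooth_id 0%N.
by apply: CkD; apply: CkM; solve [exact: Ck_cst | exact: cray].
Qed.

Let integrable01 (f : R -> R) : continuous f ->
  mu.-integrable `[0, 1] (EFin \o f).
Proof.
move=> cf; apply: continuous_compact_integrable; first exact: segment_compact.
exact: continuous_subspaceT.
Qed.

Let theta (y : plane) : R^o := (\int[mu]_(u in `[0%R, 1%R]) K y u)%R.

Let theta_derive i x : is_derive x (e i) theta (a i x).
Proof.
have [C HC] := D_bounded i x.
pose f (r u : R) := K (x + r *: e i) u.
have df (r u : R) : is_derive r (1 : R) (f^~ u) (D i (x + r *: e i) u).
  by apply: (@is_derive_line R plane R^o (fun y => K y u : R^o)); exact: KD.
have d1 r u : partial1of2 f r u = D i (x + r *: e i) u.
  by rewrite partial1of2E; have [_ ->] := df r u.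
have I0 : `](-1 : R), 1[%classic (0 : R) by rewrite /= in_itv/= ltrN10 ltr01.
have intf r : `](-1 : R), 1[%classic r -> mu.-integrable `[0, 1] (EFin \o f r).
  by move=> _; exact/integrable01/cK.
have derf r u : `](-1 : R), 1[%classic r -> `[0 : R, 1]%classic u ->
    derivable (f^~ u) r 1 by move=> _ _; have [] := df r u.
have C0 (u : R) : 0 <= `|C| by [].
have intG : mu.-integrable `[0, 1] (EFin \o (fun _ : R => `|C|)).
  by apply: integrable01 => u; exact: cst_continuous.
have Gub r u : `](-1 : R), 1[%classic r -> `[0 : R, 1]%classic u ->
    `|partial1of2 f r u| <= `|C|.
  rewrite /= !in_itv/= => /andP[r0 r1] u01; rewrite d1.
  by rewrite (le_trans _ (ler_norm C))// HC// !ltW.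
have := @cvg_differentiation_under_integral R _ _ mu f `[0, 1]%classic
  (measurable_itv _) 0 (-1) 1 I0 intf derf (fun _ => `|C|) C0 intG Gub.
(* [D] is the derivative of [u * a i (u *: x)], so the fundamental theorem of calculus evaluates its
   integral. *)
have -> : (\int[mu]_(u in `[0%R, 1%R]) partial1of2 f 0 u)%R = a i x.
  have -> : partial1of2 f 0 = D i x.
    by apply/funext => u; rewrite d1 scale0r addr0.
  have dF u : derivable (fun u : R => u * a i (u *: x)) u 1.
    by have [] := DF i x u.
  have cF : continuous (fun u : R => u * a i (u *: x)).
    apply: (@Ck_continuous _ R^o R^o 0%N (fun u : R^o => u * a i (u *: x))).
    apply: CkM; first exact: smooth_id 0%N.
    by apply: continuous_ray; exact: smooth_continuous.
  rewrite /Rintegral.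
  rewrite (@continuous_FTC2 _ (D i x) (fun u : R => u * a i (u *: x)) 0 1 ltr01).
  - by rewrite mul1r scale1r mul0r sube0.
  - by apply: continuous_subspaceT; exact: cD.
  - split; first by move=> u _; exact: dF.
    + exact/cvg_at_right_filter/cF.
    + exact/cvg_at_left_filter/cF.
  - by move=> u _; rewrite derive1E; have [_ ->] := DF i x u.
have E : (fun h : R => h^-1 *: ((\int[mu]_(u in `[0%R, 1%R]) f (h + 0) u)%R -
      (\int[mu]_(u in `[0%R, 1%R]) f 0 u)%R)) =
    (fun h : R => h^-1 *: ((theta \o shift x) (h *: e i) - theta x)).
  by apply/funext => h; rewrite /f addr0 scale0r addr0 /= (addrC x).
rewrite E => H.
apply: DeriveDef; first by apply/cvg_ex; exists (a i x).
exact: cvg_lim H.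
Qed.

Lemma poincare : exists theta : plane -> R^o,
  smooth theta /\ forall i, partial i theta = a i.
Proof.
have ED i : partial i theta = a i.
  by apply/funext => x; have [_ <-] := theta_derive i x.
(* The partial derivatives are continuous, which makes [theta] differentiable; being smooth, they
   then make it smooth. *)
exists theta; split=> //; apply: smooth_partials; last first.
  by move=> i; rewrite ED; exact: sa.
move=> x; have [] // := @differentiable_partials R theta a x theta_derive.
by move=> i; apply: smooth_continuous; exact: sa.
Qed.

End Poincare.

#[local] Opaque partial.

(** * Maps of rank one *)

Section AngleLift.
Context {R : realType}.
Local Notation plane := 'rV[R]_2.

Lemma unit_vector_angle (c s : R) : c ^+ 2 + s ^+ 2 = 1 ->
  exists t, c = cos t /\ s = sin t.
Proof.
move=> cs1.
have c1 : -1 <= c <= 1.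
  have s2 := sqr_ge0 s; apply/andP; split; nra.
have E : Num.sqrt (1 - c ^+ 2) = `|s|.
  by rewrite -cs1 addrAC subrr add0r sqrtr_sqr.
have [s0|s0] := leP 0 s.
- by exists (acos c); rewrite acosK ?in_itv//= sin_acos// E ger0_norm.
- exists (- acos c); rewrite cosN sinN acosK ?in_itv//= sin_acos// E.
  by rewrite ltr0_norm// opprK.
Qed.

Lemma derive_comp1 (V : normedModType R) (h : R^o -> R^o) (f : V -> R^o) v x d :
  is_derive (f x) (1 : R^o) h d -> differentiable f x ->
  'D_v (fun y => h (f y)) x = d * 'D_v f x.
Proof.
move=> [dh dE] df.
have dh' : differentiable h (f x) by exact/derivable1_diffP.
rewrite deriveE; last exact: (@differentiable_comp _ _ _ _ f h).
rewrite [X in X v](@diff_comp _ _ _ _ f h)//= deriveE//.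
by rewrite diff1E//= mulrC derive1E dE.
Qed.

(** In the plane, two vectors orthogonal to the same unit vector are parallel. This cancels the
    products of first derivatives in d(c ds - s dc). *)
Lemma unit_tangent_parallel (c s c0 s0 c1 s1 : R) : c * c + s * s = 1 ->
  c * c0 + s * s0 = 0 -> c * c1 + s * s1 = 0 -> c0 * s1 = s0 * c1.
Proof.
move=> H H0 H1; apply/eqP; rewrite -subr_eq0; apply/eqP.
transitivity ((c * c + s * s) * (c0 * s1 - s0 * c1)); first by rewrite H mul1r.
transitivity ((c * s1 - s * c1) * (c * c0 + s * s0)
              + (s * c0 - c * s0) * (c * c1 + s * s1)); first by ring.
by rewrite H0 H1 !mulr0 addr0.
Qed.

Lemma angle_form_closed (c s c0 s0 c1 s1 c01 s01 : R) : c0 * s1 = s0 * c1 ->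
  c0 * s1 + c * s01 - (s0 * c1 + s * c01) = c1 * s0 + c * s01 - (s1 * c0 + s * c01).
Proof. by move=> H; rewrite (mulrC c1) (mulrC s1) H. Qed.

(** Orthogonality to the unit vector [(c, s)] makes [(dc, ds)] the multiple [b] of [(- s, c)]. The
    two sums are the derivatives of the cosine and sine of the angle between [(co, si)] and
    [(c, s)]; they vanish because both vectors turn at the rate [b]. *)
Lemma rotated_derivative (c s dc ds co si : R) : c * c + s * s = 1 ->
  c * dc + s * ds = 0 ->
  dc * co + c * (- si * (c * ds - s * dc)) + (ds * si + s * (co * (c * ds - s * dc))) = 0
  /\ ds * co + s * (- si * (c * ds - s * dc)) - (dc * si + c * (co * (c * ds - s * dc))) = 0.
Proof.
move=> H H0; set b := c * ds - s * dc.
have Edc : dc = - s * b.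
  transitivity ((c * c + s * s) * dc - c * (c * dc + s * ds)); last by rewrite /b; ring.
  by rewrite H H0; ring.
have Eds : ds = c * b.
  transitivity ((c * c + s * s) * ds - s * (c * dc + s * ds)); last by rewrite /b; ring.
  by rewrite H H0; ring.
clearbody b; rewrite Edc Eds; split; ring.
Qed.

(* The angle is a potential of the closed form [c ds - s dc]. *)
Lemma angle_lift (c s : plane -> R^o) : smooth c -> smooth s ->
  (forall x, c x * c x + s x * s x = 1) ->
  exists2 t : plane -> R^o, smooth t & forall x, c x = cos (t x) /\ s x = sin (t x).
Proof.
move=> sc ss cs1.
have scc := smoothM sc sc; have sss := smoothM ss ss.
have sp i (f : plane -> R^o) : smooth f -> smooth (partial i f).
  exact: smooth_derive.
have dcs i x : c x * partial i c x + s x * partial i s x = 0.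
  have := partial_cst i (1 : R^o) x.
  have <- : (fun x => c x * c x + s x * s x : R^o) = fun _ => 1.
    by apply/funext.
  rewrite partialD// !partialM//; move: (c x) (s x) (partial i c x) (partial i s x).
  by move=> p q r t H; apply: (mulfI (x := 2)) => //; rewrite mulr0 -H; ring.
pose a i (x : plane) : R^o := c x * partial i s x - s x * partial i c x.
have sa i : smooth (a i).
  by apply: smoothB; apply: smoothM => //; exact: sp.
have ca x : partial 0 (a 1) x = partial 1 (a 0) x.
  have da i k : partial i (a k) x =
      partial i c x * partial k s x + c x * partial i (partial k s) x
      - (partial i s x * partial k c x + s x * partial i (partial k c) x).
    apply: etrans (partialB i x (smoothM sc (sp k s ss)) (smoothM ss (sp k c sc))) _.
    by rewrite (partialM i x sc (sp k s ss)) (partialM i x ss (sp k c sc)).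
  rewrite (da 0 1) (da 1 0) (partialC 1 0 x sc) (partialC 1 0 x ss).
  exact/angle_form_closed/(unit_tangent_parallel (cs1 x) (dcs 0 x) (dcs 1 x)).
have [t0 [st0 dt0]] := poincare sa ca.
have /unit_vector_angle[z [cz sz]] : (c 0) ^+ 2 + (s 0) ^+ 2 = 1.
  by rewrite !expr2 cs1.
(* The additive constant of the potential is adjusted so that the angle is right at the origin. *)
pose t x : R^o := t0 x + (z - t0 0).
have st : smooth t by apply: smoothD => //; exact: smooth_cst.
have dt i x : partial i t x = a i x.
  by rewrite partialD ?partial_cst ?addr0 ?dt0//; exact: smooth_cst.
have t0z : t 0 = z by rewrite /t addrCA subrr addr0.
have sct := smooth_cos st; have sst := smooth_sin st.
have dcos i x : partial i (fun y => cos (t y) : R^o) x = - sin (t x) * a i x.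
  by rewrite -dt; apply: derive_comp1; exact: smooth_differentiable.
have dsin i x : partial i (fun y => sin (t y) : R^o) x = cos (t x) * a i x.
  by rewrite -dt; apply: derive_comp1; exact: smooth_differentiable.
have smA := smoothD (smoothM sc sct) (smoothM ss sst).
have smB := smoothB (smoothM ss sct) (smoothM sc sst).
(* [A1] and [B0] say that the difference of the two angles has cosine 1 and sine 0: both expressions
   have zero derivative and the right value at 0. *)
have A1 x : c x * cos (t x) + s x * sin (t x) = 1.
  apply: etrans (partial_eq0_cst x 0 smA _) _.
    move=> i y; apply: etrans (partialD i y (smoothM sc sct) (smoothM ss sst)) _.
    rewrite (partialM i y sc sct) (partialM i y ss sst) dcos dsin.
    by have [] := rotated_derivative (cos (t y)) (sin (t y)) (cs1 y) (dcs i y).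
  by rewrite t0z -cz -sz cs1.
have B0 x : s x * cos (t x) - c x * sin (t x) = 0.
  apply: etrans (partial_eq0_cst x 0 smB _) _.
    move=> i y; apply: etrans (partialB i y (smoothM ss sct) (smoothM sc sst)) _.
    rewrite (partialM i y ss sct) (partialM i y sc sst) dcos dsin.
    by have [] := rotated_derivative (cos (t y)) (sin (t y)) (cs1 y) (dcs i y).
  by rewrite t0z -cz -sz mulrC subrr.
exists t => // x.
have := cos2Dsin2 (t x); move: (A1 x) (B0 x) => {A1 B0}.
move: (cos (t x)) (sin (t x)) (c x) (s x) => C S p q A B CS; split.
- transitivity (p * (C ^+ 2 + S ^+ 2)); first by rewrite CS mulr1.
  transitivity (C * (p * C + q * S) - S * (q * C - p * S)); first by ring.
  by rewrite A B; ring.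
- transitivity (q * (C ^+ 2 + S ^+ 2)); first by rewrite CS mulr1.
  transitivity (S * (p * C + q * S) + C * (q * C - p * S)); first by ring.
  by rewrite A B; ring.
Qed.

End AngleLift.

(** * The Euclidean inner product and calculus of vector-valued maps *)

Section Dot.
Context {R : realType}.
Local Notation quat := 'rV[R]_4.
Implicit Types p q r : quat.

Lemma dotC p q : dot p q = dot q p.
Proof. by apply: eq_bigr => i _; exact: mulrC. Qed.

Lemma dotDl p q r : dot (p + q) r = dot p r + dot q r.
Proof. by rewrite /dot -big_split/=; apply: eq_bigr => i _; rewrite mxE mulrDl. Qed.

Lemma dotZl a p q : dot (a *: p) q = a * dot p q.
Proof. by rewrite /dot mulr_sumr; apply: eq_bigr => i _; rewrite mxE mulrA. Qed.

Lemma dotDr p q r : dot r (p + q) = dot r p + dot r q.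
Proof. by rewrite dotC dotDl !(dotC r). Qed.

Lemma dotZr a p q : dot p (a *: q) = a * dot p q.
Proof. by rewrite dotC dotZl dotC. Qed.

Lemma dotNl p q : dot (- p) q = - dot p q.
Proof. by rewrite -scaleN1r dotZl mulN1r. Qed.

Lemma dotBl p q r : dot (p - q) r = dot p r - dot q r.
Proof. by rewrite dotDl dotNl. Qed.

Lemma dot_ge0 p : 0 <= dot p p.
Proof. by apply: sumr_ge0 => i _; rewrite -expr2 sqr_ge0. Qed.

Lemma dot_eq0 p : dot p p = 0 -> p = 0.
Proof.
move=> /eqP; rewrite psumr_eq0; last by move=> i _; rewrite -expr2 sqr_ge0.
move=> /allP p0; apply/rowP => i; rewrite mxE; apply/eqP.
by have := p0 i; rewrite mem_index_enum => /(_ isT)/=; rewrite mulf_eq0 orbb.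
Qed.

Lemma dot0l p : dot 0 p = 0.
Proof. by rewrite -[0](scale0r 0) dotZl mul0r. Qed.

End Dot.

Section VectorCalculus.
Context {R : realType}.
Local Notation plane := 'rV[R]_2.
Local Notation quat := 'rV[R]_4.

Lemma smooth_partial (W : normedModType R) i (f : plane -> W) :
  smooth f -> smooth (partial i f).
Proof. exact: smooth_derive. Qed.

Context {V : normedModType R}.
Implicit Types (f : V -> R^o) (v w : V -> quat).

Lemma smoothZ n f (v : V -> 'rV[R]_n) : smooth f -> smooth v -> smooth (fun x => f x *: v x).
Proof.
move=> sf sv; apply: smooth_row => k.
have -> : (fun x => (f x *: v x) 0 k : R^o) = fun x => f x * v x 0 k.
  by apply/funext => x; rewrite mxE.
by apply: smoothM => //; exact: smooth_coord.
Qed.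

Lemma smooth_sum (I : Type) (r : seq I) (F : I -> V -> R^o) :
  (forall i, smooth (F i)) -> smooth (fun x => \sum_(i <- r) F i x).
Proof. by move=> sF k; apply: Ck_sum => i; exact: sF. Qed.

Lemma smooth_dot v w : smooth v -> smooth w -> smooth (fun x => dot (v x) (w x) : R^o).
Proof.
by move=> sv sw; apply: smooth_sum => i; apply: smoothM; exact: smooth_coord.
Qed.

End VectorCalculus.

Section VectorPartials.
Context {R : realType}.
Local Notation plane := 'rV[R]_2.
Local Notation quat := 'rV[R]_4.
Implicit Types (f : plane -> R^o) (v w : plane -> quat) (i : 'I_2) (x : plane).

Lemma partial_row n i (v : plane -> 'rV[R]_n) x (d : 'rV[R]_n) :
  smooth v -> (forall k, partial i (fun y => v y 0 k : R^o) x = d 0 k) -> partial i v x = d.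
Proof. by move=> sv H; apply/rowP => k; rewrite -H partial_coord. Qed.

Lemma partial_sum i (I : Type) (r : seq I) (F : I -> plane -> R^o) x :
  (forall k, smooth (F k)) ->
  partial i (fun y => \sum_(k <- r) F k y) x = \sum_(k <- r) partial i (F k) x.
Proof.
move=> sF; elim: r => [|k r IH].
  rewrite big_nil.
  have -> : (fun y => \sum_(k <- [::]) F k y) = fun=> 0.
    by apply/funext => y; rewrite big_nil.
  exact: partial_cst.
rewrite big_cons -IH.
have -> : (fun y => \sum_(j <- k :: r) F j y) = fun y => F k y + \sum_(j <- r) F j y.
  by apply/funext => y; rewrite big_cons.
by apply: partialD => //; exact: smooth_sum.
Qed.

Lemma partial_dot i v w x : smooth v -> smooth w ->
  partial i (fun y => dot (v y) (w y) : R^o) x =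
  dot (partial i v x) (w x) + dot (v x) (partial i w x).
Proof.
move=> sv sw; rewrite /dot -big_split/=.
have sc (u : plane -> quat) k : smooth u -> smooth (fun y => u y 0 k : R^o).
  exact: smooth_coord.
apply: etrans (partial_sum i _ x _) _; first by move=> k; apply: smoothM; exact: sc.
apply: eq_bigr => k _.
rewrite (partialM i x (sc v k sv) (sc w k sw)).
by rewrite (partial_coord i k x sv) (partial_coord i k x sw).
Qed.

Lemma partialZ i f v x : smooth f -> smooth v ->
  partial i (fun y => f y *: v y) x = partial i f x *: v x + f x *: partial i v x.
Proof.
move=> sf sv; apply: partial_row => [|k]; first exact: smoothZ.
have -> : (fun y => (f y *: v y) 0 k : R^o) = fun y => f y * v y 0 k.
  by apply/funext => y; rewrite mxE.
apply: etrans (partialM i x sf (smooth_coord k sv)) _.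
by rewrite (partial_coord i k x sv) !mxE.
Qed.

Lemma partialC_row n i j (v : plane -> 'rV[R]_n) x : smooth v ->
  partial i (partial j v) x = partial j (partial i v) x.
Proof.
move=> sv; apply: partial_row => [|k]; first exact: smooth_partial.
have E l : (fun y => partial l v y 0 k : R^o) = partial l (fun y => v y 0 k : R^o).
  by apply/funext => y; rewrite (partial_coord l k y sv).
rewrite E (partialC _ _ _ (smooth_coord k sv)) -E.
by rewrite partial_coord//; exact: smooth_partial.
Qed.

End VectorPartials.

(** * Factoring a differential of rank one *)

Section RankOne.
Context {R : realType}.
Local Notation plane := 'rV[R]_2.
Local Notation quat := 'rV[R]_4.

(** The products of the entries of [(r * c, r * s)] depend only on [r] and the double angle, and the
    Gram matrix determines both: [A - C] and [2 * B] are [T] times the cosine and sine of that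
    double angle. *)
Lemma double_angle_gram (A B C T r c s : R) : A * C = B * B -> T = A + C ->
  T * (c * c - s * s) = A - C -> T * (2 * c * s) = 2 * B -> c * c + s * s = 1 ->
  r * r * 4 = T ->
  [/\ r * c * (r * c) * 4 = A, r * s * (r * s) * 4 = C & r * c * (r * s) * 4 = B].
Proof.
move=> _ TE c2 s2 cs rT.
have cT : T * (c * c) * 2 = A - C + T.
  transitivity (T * (c * c - s * s) + T * (c * c + s * s)); first by ring.
  by rewrite c2 cs mulr1.
have sT : T * (s * s) * 2 = T - (A - C).
  transitivity (T * (c * c + s * s) - T * (c * c - s * s)); first by ring.
  by rewrite c2 cs mulr1.
split.
- apply: (mulIf (x := 2)) => //; transitivity (T * (c * c) * 2).
    by rewrite -rT; ring.
  by rewrite cT TE; ring.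
- apply: (mulIf (x := 2)) => //; transitivity (T * (s * s) * 2).
    by rewrite -rT; ring.
  by rewrite sT TE; ring.
- apply: (mulfI (x := 2)) => //; rewrite -s2 -rT; ring.
Qed.

(** Rests on (A + C)^2 = (A - C)^2 + 4 A C, where a zero Gram determinant turns the last term into 4
    B^2. *)
Lemma gram_circle (A B C : R) : A + C != 0 -> A * C = B * B ->
  (A - C) * (A + C)^-1 * ((A - C) * (A + C)^-1)
  + (B + B) * (A + C)^-1 * ((B + B) * (A + C)^-1) = 1.
Proof.
move=> TN AC; transitivity ((A + C) * (A + C) * ((A + C)^-1 * (A + C)^-1)).
  have -> : (A + C) * (A + C) = (A - C) * (A - C) + (B + B) * (B + B).
    transitivity ((A - C) * (A - C) + 4 * (A * C)); first by ring.
    by rewrite AC; ring.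
  by move: (_^-1) => D; ring.
by rewrite mulrACA mulfV// mulr1.
Qed.

Lemma cos_half (t : R) :
  cos (t * 2^-1) * cos (t * 2^-1) - sin (t * 2^-1) * sin (t * 2^-1) = cos t.
Proof. by rewrite -cosD -splitr. Qed.

Lemma sin_half (t : R) : 2 * cos (t * 2^-1) * sin (t * 2^-1) = sin t.
Proof.
have -> : sin t = sin (t * 2^-1 + t * 2^-1) by rewrite -splitr.
by rewrite sinD; ring.
Qed.

(** The Gram relations give [b0 *: n1 - b1 *: n0] length zero. If each n_i is b_i u, then
    [b0 *: n0 + b1 *: n1] is T / 4 times u, which dictates the choice of [u]. *)
Lemma rank_one_factor (n0 n1 : quat) (b0 b1 T : R) :
  b0 * b0 * 4 = dot n0 n0 -> b1 * b1 * 4 = dot n1 n1 -> b0 * b1 * 4 = dot n0 n1 ->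
  (b0 * b0 + b1 * b1) * 4 = T -> T != 0 ->
  let u := (4 * T^-1) *: (b0 *: n0 + b1 *: n1) in
  [/\ n0 = b0 *: u, n1 = b1 *: u & dot u u = 4].
Proof.
move=> E0 E1 E01 bT T0 u.
have par : b0 *: n1 = b1 *: n0.
  apply/eqP; rewrite -subr_eq0; apply/eqP/dot_eq0.
  rewrite !(dotBl, dotC _ (_ - _), dotZl, dotZr) (dotC n1 n0) -E0 -E1 -E01; ring.
have uE (b : R) n : b *: (b0 *: n0 + b1 *: n1) = (b0 * b0 + b1 * b1) *: n ->
    n = b *: u.
  move=> H; rewrite /u scalerA mulrC -scalerA H scalerA -[4 * _ * _]mulrA.
  by rewrite mulrCA (mulrC 4) bT mulVf// scale1r.
have n0E : n0 = b0 *: u.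
  apply: uE; rewrite scalerDr !scalerA scalerDl; congr (_ + _).
  by rewrite (mulrC b0 b1) -!scalerA par.
have n1E : n1 = b1 *: u.
  apply: uE; rewrite scalerDr !scalerA scalerDl; congr (_ + _).
  by rewrite (mulrC b1 b0) -!scalerA par.
split=> //; apply: (mulfI T0).
transitivity ((dot n0 n0 + dot n1 n1) * 4); last first.
  by rewrite -E0 -E1 -bT; ring.
by rewrite -bT n0E n1E !dotZl !dotZr; move: (dot u u) => d; ring.
Qed.

Lemma mulr_divl_cancel (A T : R) : T != 0 -> T * (A * T^-1) = A.
Proof. by move=> T0; rewrite mulrCA mulfV// mulr1. Qed.

(** Pairing with [U] removes [D0] and [D1]. These stand for the derivatives of a vector field of
    constant length, hence orthogonal to it. *)
Lemma unit_comparison (U D0 D1 : quat) (p q b0 b1 : R) : dot U U = 4 ->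
  dot U D0 = 0 -> dot U D1 = 0 -> p *: U + b1 *: D0 = q *: U + b0 *: D1 ->
  p = q /\ b0 *: D1 = b1 *: D0.
Proof.
move=> UU U0 U1 E; have pq : p = q.
  have := congr1 (dot U) E.
  rewrite !dotDr !dotZr U0 U1 !mulr0 !addr0 UU; apply: mulIf.
  by rewrite pnatr_eq0.
by split=> //; move: E; rewrite pq => /addrI.
Qed.

(* [b i * b j] is a quarter of the Gram matrix of [d nu]; a global choice of the
   sign of [b] comes from halving a lifted angle. *)
Lemma rank_one (nu : plane -> quat) : smooth nu ->
  (forall x, dot (partial 0 nu x) (partial 0 nu x) * dot (partial 1 nu x) (partial 1 nu x)
     = dot (partial 0 nu x) (partial 1 nu x) * dot (partial 0 nu x) (partial 1 nu x)) ->
  (forall x, 0 < dot (partial 0 nu x) (partial 0 nu x)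
              + dot (partial 1 nu x) (partial 1 nu x)) ->
  exists (b : 'I_2 -> plane -> R^o) (u : plane -> quat),
    [/\ (forall i, smooth (b i)) /\ smooth u,
        forall i x, partial i nu x = b i x *: u x,
        forall x, dot (u x) (u x) = 4,
        forall x, partial 0 (b 1) x = partial 1 (b 0) x &
        forall x, b 0 x *: partial 1 u x = b 1 x *: partial 0 u x].
Proof.
move=> snu gram0 T0.
have sp i := smooth_partial i snu.
pose G i j (x : plane) : R^o := dot (partial i nu x) (partial j nu x).
have sG i j : smooth (G i j) by exact: smooth_dot (sp i) (sp j).
pose T x : R^o := G 0 0 x + G 1 1 x.
have sT : smooth T by exact: smoothD (sG 0 0) (sG 1 1).
have Tn0 x : T x != 0 by rewrite gt_eqF// /T T0.
have sTV := smoothV Tn0 sT.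
(* [(c, s)] is the direction of the double angle of the desired covector [b]; unlike [b], it has no
   sign ambiguity. *)
pose c (x : plane) : R^o := (G 0 0 x - G 1 1 x) * (T x)^-1.
pose s (x : plane) : R^o := (G 0 1 x + G 0 1 x) * (T x)^-1.
have sc : smooth c by exact: smoothM (smoothB (sG 0 0) (sG 1 1)) sTV.
have ss : smooth s by exact: smoothM (smoothD (sG 0 1) (sG 0 1)) sTV.
have cs1 x : c x * c x + s x * s x = 1 by exact: gram_circle (Tn0 x) (gram0 x).
have [t st tE] := angle_lift sc ss cs1.
pose r x : R^o := Num.sqrt (T x) * 2^-1.
have sr : smooth r.
  by apply: smoothM (smooth_sqrt _ sT) (smooth_cst _) => x; exact: T0.
have rT x : r x * r x * 4 = T x.
  rewrite /r mulrACA -expr2 sqr_sqrtr; last exact/ltW/T0.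
  by rewrite -mulrA -invfM -natrM mulVf ?mulr1// pnatr_eq0.
have sh : smooth (fun x => t x * 2^-1 : R^o) by exact: smoothM st (smooth_cst _).
pose b (i : 'I_2) (x : plane) : R^o :=
  r x * (if i == 0 then cos (t x * 2^-1) else sin (t x * 2^-1)).
have sb i : smooth (b i).
  have [->|->] := ord2P i.
    exact: smoothM sr (smooth_cos sh).
  exact: smoothM sr (smooth_sin sh).
have bG x : [/\ b 0 x * b 0 x * 4 = G 0 0 x, b 1 x * b 1 x * 4 = G 1 1 x
             & b 0 x * b 1 x * 4 = G 0 1 x].
  rewrite /b/=; apply: double_angle_gram (gram0 x) (erefl (T x)) _ _ _ (rT x).
  - have [cE _] := tE x.
    apply: etrans (mulr_divl_cancel (G 0 0 x - G 1 1 x) (Tn0 x)).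
    exact: (congr1 (fun z => T x * z) (etrans (cos_half (t x)) (esym cE))).
  - have [_ sE] := tE x.
    apply: etrans (_ : _ = G 0 1 x + G 0 1 x) _; last by rewrite mulr_natl mulr2n.
    apply: etrans (mulr_divl_cancel (G 0 1 x + G 0 1 x) (Tn0 x)).
    exact: (congr1 (fun z => T x * z) (etrans (sin_half (t x)) (esym sE))).
  - by rewrite -!expr2 cos2Dsin2.
have bT x : (b 0 x * b 0 x + b 1 x * b 1 x) * 4 = T x.
  by have [b0 b1 _] := bG x; rewrite mulrDl b0 b1.
pose u x : quat := (4 * (T x)^-1) *: (b 0 x *: partial 0 nu x + b 1 x *: partial 1 nu x).
have su : smooth u.
  apply: smoothZ; first exact: smoothM (smooth_cst _) sTV.
  by apply: smoothD; exact: smoothZ.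
have uP x : [/\ partial 0 nu x = b 0 x *: u x, partial 1 nu x = b 1 x *: u x
    & dot (u x) (u x) = 4].
  by have [E0 E1 E01] := bG x; exact: rank_one_factor E0 E1 E01 (bT x) (Tn0 x).
have nuE i x : partial i nu x = b i x *: u x.
  by have [H0 H1 _] := uP x; have [->|->] := ord2P i.
have uu x : dot (u x) (u x) = 4 by have [] := uP x.
have du i x : dot (u x) (partial i u x) = 0.
  have := partial_cst i (4 : R^o) x.
  have <- : (fun x => dot (u x) (u x) : R^o) = fun=> 4 by apply/funext.
  rewrite (partial_dot i x su su) (dotC (partial i u x)) => H.
  by apply: (mulfI (x := 2)); rewrite ?pnatr_eq0// mulr0 -H mulr_natl mulr2n.
(* Symmetry of the second derivatives of [nu], expanded by the product rule; [uc] then separates the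
   component along [u] from the rest. *)
have dd x : partial 0 (b 1) x *: u x + b 1 x *: partial 0 u x =
            partial 1 (b 0) x *: u x + b 0 x *: partial 1 u x.
  apply: etrans (esym (partialZ 0 x (sb 1) su)) (etrans _ (partialZ 1 x (sb 0) su)).
  have E i : (fun y => b i y *: u y) = partial i nu by apply/funext => y; rewrite nuE.
  by rewrite (E 0) (E 1); exact: partialC_row.
have uc x := unit_comparison (uu x) (du 0 x) (du 1 x) (dd x).
exists b, u; split.
- exact: (conj sb su).
- exact: nuE.
- exact: uu.
- by move=> x; exact: (uc x).1.
- by move=> x; exact: (uc x).2.
Qed.

End RankOne.

(** * Quaternions *)

Section QuaternionAlgebra.
Context {R : realType}.
Local Notation quat := 'rV[R]_4.
Implicit Types (p q r : quat) (a b c d : R).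

Definition q1 : quat := mkq 1 0 0 0.

Lemma inord4 (i : 'I_4) : [\/ i = inord 0, i = inord 1, i = inord 2 | i = inord 3].
Proof.
by case: i => -[|[|[|[|//]]]] i; [apply: Or41|apply: Or42|apply: Or43|apply: Or44];
  apply: val_inj; rewrite /= inordK.
Qed.

Lemma co_mkq a b c d : [/\ co (mkq a b c d) 0 = a, co (mkq a b c d) 1 = b,
  co (mkq a b c d) 2 = c & co (mkq a b c d) 3 = d].
Proof. by rewrite /co /mkq !mxE !inordK. Qed.

Lemma co_mkq0 a b c d : co (mkq a b c d) 0 = a. Proof. by case: (co_mkq a b c d). Qed.
Lemma co_mkq1 a b c d : co (mkq a b c d) 1 = b. Proof. by case: (co_mkq a b c d). Qed.
Lemma co_mkq2 a b c d : co (mkq a b c d) 2 = c. Proof. by case: (co_mkq a b c d). Qed.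
Lemma co_mkq3 a b c d : co (mkq a b c d) 3 = d. Proof. by case: (co_mkq a b c d). Qed.

Lemma coD p q k : co (p + q) k = co p k + co q k. Proof. by rewrite /co mxE. Qed.
Lemma coZ a p k : co (a *: p) k = a * co p k. Proof. by rewrite /co mxE. Qed.
Lemma coN p k : co (- p) k = - co p k. Proof. by rewrite /co mxE. Qed.

Definition coE := (co_mkq0, co_mkq1, co_mkq2, co_mkq3, coD, coZ, coN).

Lemma quatP p q : co p 0 = co q 0 -> co p 1 = co q 1 -> co p 2 = co q 2 ->
  co p 3 = co q 3 -> p = q.
Proof.
by move=> e0 e1 e2 e3; apply/rowP => i; case: (inord4 i) => ->.
Qed.

Lemma dotE p q : dot p q =
  co p 0 * co q 0 + co p 1 * co q 1 + co p 2 * co q 2 + co p 3 * co q 3.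
Proof.
rewrite /dot !big_ord_recl big_ord0 addr0 !addrA /co.
by congr (_ * _ + _ * _ + _ * _ + _ * _); congr (_ _ _); apply: val_inj;
  rewrite /= inordK.
Qed.

Lemma qmulA p q r : qmul p (qmul q r) = qmul (qmul p q) r.
Proof. by apply: quatP; rewrite /qmul !coE; ring. Qed.

Lemma qmulDl p q r : qmul (p + q) r = qmul p r + qmul q r.
Proof. by apply: quatP; rewrite /qmul !coE; ring. Qed.

Lemma qmulDr p q r : qmul r (p + q) = qmul r p + qmul r q.
Proof. by apply: quatP; rewrite /qmul !coE; ring. Qed.

Lemma qmulZl a p q : qmul (a *: p) q = a *: qmul p q.
Proof. by apply: quatP; rewrite /qmul !coE; ring. Qed.

Lemma qmulZr a p q : qmul p (a *: q) = a *: qmul p q.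
Proof. by apply: quatP; rewrite /qmul !coE; ring. Qed.

Lemma qmulNl p q : qmul (- p) q = - qmul p q.
Proof. by apply: quatP; rewrite /qmul !coE; ring. Qed.

Lemma qmulNr p q : qmul p (- q) = - qmul p q.
Proof. by apply: quatP; rewrite /qmul !coE; ring. Qed.

Lemma qmul1l p : qmul q1 p = p.
Proof. by apply: quatP; rewrite /qmul /q1 !coE; ring. Qed.

Lemma qmul1r p : qmul p q1 = p.
Proof. by apply: quatP; rewrite /qmul /q1 !coE; ring. Qed.

Lemma qconjM p q : qconj (qmul p q) = qmul (qconj q) (qconj p).
Proof. by apply: quatP; rewrite /qmul /qconj !coE; ring. Qed.

Lemma qconjK p : qconj (qconj p) = p.
Proof. by apply: quatP; rewrite /qconj !coE ?opprK. Qed.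

Lemma qconj_im p : co p 0 = 0 -> qconj p = - p.
Proof. by move=> p0; apply: quatP; rewrite /qconj !coE ?p0 ?oppr0. Qed.

Lemma qmul_conj p : qmul p (qconj p) = dot p p *: q1.
Proof. by apply: quatP; rewrite dotE /qmul /qconj /q1 !coE; ring. Qed.

Lemma qconj_mul p : qmul (qconj p) p = dot p p *: q1.
Proof. by apply: quatP; rewrite dotE /qmul /qconj /q1 !coE; ring. Qed.

Lemma dot_conj p q : dot (qconj p) (qconj q) = dot p q.
Proof. by rewrite !dotE /qconj !coE; ring. Qed.

Lemma dot_qmull p q r : dot (qmul p q) (qmul p r) = dot p p * dot q r.
Proof. by rewrite !dotE /qmul !coE; ring. Qed.

Lemma dot_qmulr p q r : dot (qmul q p) (qmul r p) = dot p p * dot q r.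
Proof. by rewrite !dotE /qmul !coE; ring. Qed.

Lemma dot_q1 p : dot p q1 = co p 0.
Proof. by rewrite dotE /q1 !coE; ring. Qed.

Lemma unit_qmulK p q : dot p p = 1 -> qmul (qconj p) (qmul p q) = q.
Proof. by move=> p1; rewrite qmulA qconj_mul p1 scale1r qmul1l. Qed.

Lemma unit_qmulVK p q : dot p p = 1 -> qmul p (qmul (qconj p) q) = q.
Proof. by move=> p1; rewrite qmulA qmul_conj p1 scale1r qmul1l. Qed.

Lemma unit_qmulVKr p q : dot p p = 1 -> qmul (qmul q (qconj p)) p = q.
Proof. by move=> p1; rewrite -qmulA qconj_mul p1 scale1r qmul1r. Qed.

Definition cross p q : quat := mkq 0 (co p 2 * co q 3 - co p 3 * co q 2)
  (co p 3 * co q 1 - co p 1 * co q 3) (co p 1 * co q 2 - co p 2 * co q 1).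

Lemma cross0 p q : co (cross p q) 0 = 0. Proof. by rewrite /cross coE. Qed.

Lemma qmul_im p q : co p 0 = 0 -> co q 0 = 0 -> qmul p q = - dot p q *: q1 + cross p q.
Proof.
by move=> p0 q0; apply: quatP; rewrite dotE /qmul /cross /q1 !coE p0 q0; ring.
Qed.

Lemma dot_qmul_im p q r : co p 0 = 0 -> co q 0 = 0 -> co r 0 = 0 ->
  dot (qmul p q) r = dot (cross p q) r.
Proof.
by move=> p0 q0 r0; rewrite qmul_im// dotDl dotZl (dotC q1) dot_q1 r0 mulr0 add0r.
Qed.

Lemma crossC p q : cross q p = - cross p q.
Proof. by apply: quatP; rewrite /cross !coE; ring. Qed.

Lemma dot_cross_l p q : dot (cross p q) p = 0.
Proof. by rewrite dotE /cross !coE; ring. Qed.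

Lemma dot_cross_r p q : dot (cross p q) q = 0.
Proof. by rewrite dotE /cross !coE; ring. Qed.

Lemma dot_cross_cross p q r t : co p 0 = 0 -> co q 0 = 0 -> co r 0 = 0 ->
  co t 0 = 0 ->
  dot (cross p q) (cross r t) = dot p r * dot q t - dot p t * dot q r.
Proof.
by move=> p0 q0 r0 t0; rewrite !dotE /cross !coE p0 q0 r0 t0; ring.
Qed.

(* An orthogonal decomposition of [dot] along 1, the plane spanned by [w0] and
   [w1], and its normal, cleared of denominators. *)
Lemma gram_expansion w0 w1 p q : co w0 0 = 0 -> co w1 0 = 0 ->
  dot (cross w0 w1) (cross w0 w1) * (dot p q - co p 0 * co q 0) =
  dot (cross w0 w1) p * dot (cross w0 w1) q +
  (dot w1 w1 * (dot p w0 * dot q w0)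
   - dot w0 w1 * (dot p w0 * dot q w1 + dot p w1 * dot q w0)
   + dot w0 w0 * (dot p w1 * dot q w1)).
Proof. by move=> w00 w10; rewrite !dotE /cross !coE w00 w10; ring. Qed.

End QuaternionAlgebra.

Section QuaternionCalculus.
Context {R : realType}.
Local Notation plane := 'rV[R]_2.
Local Notation quat := 'rV[R]_4.

Lemma smooth_co (V : normedModType R) (f : V -> quat) k : smooth f ->
  smooth (fun x => co (f x) k : R^o).
Proof. exact: smooth_coord. Qed.

Lemma smooth_mkq (V : normedModType R) (a b c d : V -> R^o) :
  smooth a -> smooth b -> smooth c -> smooth d ->
  smooth (fun x => mkq (a x) (b x) (c x) (d x)).
Proof.
move=> sa sb sc sd; apply: smooth_row => i.
have E k (F : V -> R^o) : (forall x, co (mkq (a x) (b x) (c x) (d x)) k = F x) ->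
    smooth F -> smooth (fun x => mkq (a x) (b x) (c x) (d x) 0 (inord k) : R^o).
  by move=> E; congr smooth; apply/funext => x; rewrite -E.
case: (inord4 i) => ->.
- by apply: E sa => x; rewrite coE.
- by apply: E sb => x; rewrite coE.
- by apply: E sc => x; rewrite coE.
- by apply: E sd => x; rewrite coE.
Qed.

Lemma smooth_qmul (V : normedModType R) (f g : V -> quat) :
  smooth f -> smooth g -> smooth (fun x => qmul (f x) (g x)).
Proof.
move=> sf sg; have sM k l : smooth (fun x => co (f x) k * co (g x) l : R^o).
  by apply: smoothM; exact: smooth_co.
apply: smooth_mkq.
- exact: smoothB (smoothB (smoothB (sM _ _) (sM _ _)) (sM _ _)) (sM _ _).
- exact: smoothB (smoothD (smoothD (sM _ _) (sM _ _)) (sM _ _)) (sM _ _).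
- exact: smoothD (smoothD (smoothB (sM _ _) (sM _ _)) (sM _ _)) (sM _ _).
- exact: smoothD (smoothB (smoothD (sM _ _) (sM _ _)) (sM _ _)) (sM _ _).
Qed.

Lemma smooth_qconj (V : normedModType R) (f : V -> quat) :
  smooth f -> smooth (fun x => qconj (f x)).
Proof.
move=> sf; apply: smooth_mkq; first exact: smooth_co.
all: by apply: smoothN; exact: smooth_co.
Qed.

Lemma smooth_cross (V : normedModType R) (f g : V -> quat) :
  smooth f -> smooth g -> smooth (fun x => cross (f x) (g x)).
Proof.
move=> sf sg; have sM k l : smooth (fun x => co (f x) k * co (g x) l : R^o).
  by apply: smoothM; exact: smooth_co.
apply: smooth_mkq; first exact: smooth_cst.
all: exact: smoothB (sM _ _) (sM _ _).
Qed.

Lemma partial_qmul (f g : plane -> quat) i x : smooth f -> smooth g ->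
  partial i (fun y => qmul (f y) (g y)) x =
  qmul (partial i f x) (g x) + qmul (f x) (partial i g x).
Proof.
move=> sf sg; have sM k l : smooth (fun x => co (f x) k * co (g x) l : R^o).
  by apply: smoothM; exact: smooth_co.
have pM k l : partial i (fun x => co (f x) k * co (g x) l : R^o) x =
    co (partial i f x) k * co (g x) l + co (f x) k * co (partial i g x) l.
  rewrite (partialM i x (smooth_co k sf) (smooth_co l sg)).
  by rewrite (partial_coord i _ x sf) (partial_coord i _ x sg).
apply: partial_row => [|k]; first exact: smooth_qmul.
have E l (F : plane -> R^o) :
    (forall x, co (qmul (f x) (g x)) l = F x) ->
    partial i (fun y => qmul (f y) (g y) 0 (inord l) : R^o) x = partial i F x.
  by move=> EF; congr (partial i _ x); apply/funext => y; rewrite -EF.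
have {}E l (F : plane -> R^o) d : (forall x, co (qmul (f x) (g x)) l = F x) ->
    partial i F x = d ->
    co (qmul (partial i f x) (g x) + qmul (f x) (partial i g x)) l = d ->
    partial i (fun y => qmul (f y) (g y) 0 (inord l) : R^o) x =
    (qmul (partial i f x) (g x) + qmul (f x) (partial i g x)) 0 (inord l).
  by move=> /E -> -> <-.
case: (inord4 k) => ->.
- apply: E => [y||]; first by rewrite coE.
    apply: etrans (partialB i x
      (smoothB (smoothB (sM 0 0) (sM 1 1)) (sM 2 2)) (sM 3 3)) _.
    rewrite (partialB i x (smoothB (sM 0 0) (sM 1 1)) (sM 2 2)).
    by rewrite (partialB i x (sM 0 0) (sM 1 1)) !pM.
  by rewrite !coE; ring.
- apply: E => [y||]; first by rewrite coE.
    apply: etrans (partialB i x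
      (smoothD (smoothD (sM 0 1) (sM 1 0)) (sM 2 3)) (sM 3 2)) _.
    rewrite (partialD i x (smoothD (sM 0 1) (sM 1 0)) (sM 2 3)).
    by rewrite (partialD i x (sM 0 1) (sM 1 0)) !pM.
  by rewrite !coE; ring.
- apply: E => [y||]; first by rewrite coE.
    apply: etrans (partialD i x
      (smoothD (smoothB (sM 0 2) (sM 1 3)) (sM 2 0)) (sM 3 1)) _.
    rewrite (partialD i x (smoothB (sM 0 2) (sM 1 3)) (sM 2 0)).
    by rewrite (partialB i x (sM 0 2) (sM 1 3)) !pM.
  by rewrite !coE; ring.
- apply: E => [y||]; first by rewrite coE.
    apply: etrans (partialD i x
      (smoothB (smoothD (sM 0 3) (sM 1 2)) (sM 2 1)) (sM 3 0)) _.
    rewrite (partialB i x (smoothD (sM 0 3) (sM 1 2)) (sM 2 1)).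
    by rewrite (partialD i x (sM 0 3) (sM 1 2)) !pM.
  by rewrite !coE; ring.
Qed.

Lemma partial_qconj (f : plane -> quat) i x : smooth f ->
  partial i (fun y => qconj (f y)) x = qconj (partial i f x).
Proof.
move=> sf; apply: partial_row => [|k]; first exact: smooth_qconj.
have E l (F : plane -> R^o) d : (forall x, co (qconj (f x)) l = F x) ->
    partial i F x = d -> co (qconj (partial i f x)) l = d ->
    partial i (fun y => qconj (f y) 0 (inord l) : R^o) x =
    qconj (partial i f x) 0 (inord l).
  move=> EF <- dE; apply: etrans (esym dE); congr (partial i _ x).
  by apply/funext => y; rewrite -EF.
have pc l : partial i (fun y => co (f y) l : R^o) x = co (partial i f x) l.
  exact: partial_coord.
case: (inord4 k) => ->.
- by apply: E (pc 0) _ => [y|]; rewrite coE.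
- by apply: E (partialN i x (smooth_co 1 sf)) _ => [y|]; rewrite coE ?pc.
- by apply: E (partialN i x (smooth_co 2 sf)) _ => [y|]; rewrite coE ?pc.
- by apply: E (partialN i x (smooth_co 3 sf)) _ => [y|]; rewrite coE ?pc.
Qed.

End QuaternionCalculus.

#[local] Opaque dot.

(** * The Gauss maps of a flat surface *)

Section GaussAlgebra.
Context {R : realType}.
Local Notation quat := 'rV[R]_4.

(* Here [Gk_ij] stands for the Christoffel symbols, [Akij] for the products
   <f_ij, f_k>, [Pk] and [Qk] for the derivatives of Gk_11 along the first and
   of Gk_01 along the second coordinate, [T], [S1] and [S2] for <f_011, f_0>,
   <f_11, f_00> and <f_01, f_01>. *)
Lemma gauss_algebra (g00 g01 g11 A000 A100 A001 A101 A011 A111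
    G0_00 G1_00 G0_01 G1_01 G0_11 G1_11 P0 P1 Q0 Q1 T S1 S2 h00 h01 h11 D : R) :
  D = g00 * g11 - g01 * g01 -> D != 0 ->
  A000 = g00 * G0_00 + g01 * G1_00 -> A100 = g01 * G0_00 + g11 * G1_00 ->
  A001 = g00 * G0_01 + g01 * G1_01 -> A101 = g01 * G0_01 + g11 * G1_01 ->
  A011 = g00 * G0_11 + g01 * G1_11 -> A111 = g01 * G0_11 + g11 * G1_11 ->
  T + S1 = (A000 + A000) * G0_11 + g00 * P0 + ((A100 + A001) * G1_11 + g01 * P1) ->
  T + S2 = (A001 + A001) * G0_01 + g00 * Q0 + ((A101 + A011) * G1_01 + g01 * Q1) ->
  P0 - Q0 + (G0_00 * G0_11 - G0_01 * G0_01 + (G0_01 * G1_11 - G0_11 * G1_01)) = 0 ->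
  P1 - Q1 + (G1_00 * G0_11 - G1_01 * G0_01 + (G1_01 * G1_11 - G1_11 * G1_01)) = 0 ->
  D * (S1 - g11 * g00) = D * (h11 * h00) +
    (g11 * (A011 * A000) - g01 * (A011 * A100 + A111 * A000) + g00 * (A111 * A100)) ->
  D * (S2 - g01 * g01) = D * (h01 * h01) +
    (g11 * (A001 * A001) - g01 * (A001 * A101 + A101 * A001) + g00 * (A101 * A101)) ->
  h00 * h11 - h01 * h01 + D = 0.
Proof.
move=> DE D0 -> -> -> -> -> -> E1 E2 R0 R1 N1 N2; apply: (mulfI D0).
have PE : P0 = Q0 - (G0_00 * G0_11 - G0_01 * G0_01 + (G0_01 * G1_11 - G0_11 * G1_01)).
  by apply/eqP; rewrite -subr_eq0 -R0; apply/eqP; ring.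
have P1E : P1 = Q1 - (G1_00 * G0_11 - G1_01 * G0_01 + (G1_01 * G1_11 - G1_11 * G1_01)).
  by apply/eqP; rewrite -subr_eq0 -R1; apply/eqP; ring.
(* Only the difference of [S1] and [S2] enters, so the third-order quantity [T] cancels between [E1]
   and [E2]. *)
transitivity (D * (h11 * h00) - D * (h01 * h01) + D * D); first by ring.
have subl (a b c : R) : a = b + c -> b = a - c by move=> ->; rewrite addrK.
have subr (a b c : R) : a + b = c -> b = c - a by move=> <-; rewrite addrC addKr.
rewrite (subl _ _ _ N1) (subl _ _ _ N2) (subr _ _ _ E1) (subr _ _ _ E2).
by rewrite PE P1E DE; ring.
Qed.

(** [cross n0 n1] is parallel to [nu], because [n0] and [n1] are orthogonal to it. Its component
    along [nu] is, up to the factor [d], the determinant of the pairings with [w0] and [w1]. When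
    that vanishes, so does the squared length of the cross product, which is the Gram
    determinant. *)
Lemma gram_dependent (nu w0 w1 n0 n1 : quat) (d : R) :
  co nu 0 = 0 -> co w0 0 = 0 -> co w1 0 = 0 -> co n0 0 = 0 -> co n1 0 = 0 ->
  cross w0 w1 = d *: nu -> d != 0 -> dot nu nu = 1 ->
  dot nu n0 = 0 -> dot nu n1 = 0 ->
  dot w0 n0 * dot w1 n1 - dot w0 n1 * dot w1 n0 = 0 ->
  dot n0 n0 * dot n1 n1 = dot n0 n1 * dot n0 n1.
Proof.
move=> inu i0 i1 j0 j1 wE d0 nu1 nn0 nn1 M0.
have cn : dot nu (cross n0 n1) = 0.
  by apply: (mulfI d0); rewrite mulr0 -dotZl -wE dot_cross_cross.
have cc : cross nu (cross n0 n1) = dot nu n1 *: n0 - dot nu n0 *: n1.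
  by apply: quatP; rewrite !dotE /cross !coE ?inu ?j0 ?j1; ring.
rewrite nn0 nn1 !scale0r subr0 in cc.
have := dot_cross_cross inu (cross0 n0 n1) inu (cross0 n0 n1).
rewrite cc dot0l nu1 mul1r cn mul0r subr0 (dot_cross_cross j0 j1 j0 j1) (dotC n1 n0).
by move/esym/subr0_eq.
Qed.

(** Crossing with the unit normal is a quarter turn of the tangent plane, hence an isometry. *)
Lemma dot_cross_unit (nu w v : quat) : co nu 0 = 0 -> co w 0 = 0 -> co v 0 = 0 ->
  dot nu nu = 1 -> dot w nu = 0 -> dot (cross w nu) (cross v nu) = dot w v.
Proof.
by move=> inu iw iv nu1 wn; rewrite dot_cross_cross// nu1 mulr1 wn mul0r subr0.
Qed.

Lemma dot_crossC (p q r : quat) : dot p (cross q r) = - dot (cross q p) r.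
Proof. by rewrite !dotE /cross !coE; ring. Qed.

(** The pairing matrix is [- h] plus an antisymmetric part with entries [d] and [- d], so its
    determinant is that of [h] plus [d * d]. *)
Lemma gauss_cross_det (h00 h01 h11 d D : R) : h00 * h11 - h01 * h01 + D = 0 ->
  D = d * d -> - h00 * - h11 - (- h01 - d) * (- h01 + d) = 0.
Proof. by move=> H DE; rewrite -H DE; ring. Qed.

End GaussAlgebra.

Section InverseMatrix.
Context {R : realType}.

Lemma invmx2 (G : 'M[R]_2) : G 0 0 * G 1 1 - G 0 1 * G 1 0 != 0 ->
  let D := G 0 0 * G 1 1 - G 0 1 * G 1 0 in
  [/\ invmx G 0 0 = G 1 1 / D, invmx G 0 1 = - G 0 1 / D,
      invmx G 1 0 = - G 1 0 / D & invmx G 1 1 = G 0 0 / D].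
Proof.
move=> D0 D.
pose B : 'M[R]_2 := \matrix_(i, j) ((if i == 0 then if j == 0 then G 1 1 else - G 0 1
   else if j == 0 then - G 1 0 else G 0 0) / D).
have GB : G *m B = 1%:M.
  apply/matrixP => i j; rewrite !mxE sum2 !mxE /=.
  have [k -> Dk] : exists2 k, D^-1 = k & D * k = 1.
    by exists D^-1 => //; rewrite mulfV.
  rewrite /D in Dk.
  by have [->|->] := ord2P i; have [->|->] := ord2P j; rewrite /= -?Dk; ring.
have uG : G \in unitmx by have [] := mulmx1_unit GB.
have -> : invmx G = B by rewrite -[RHS](mulKmx uG) GB mulmx1.
by rewrite !mxE.
Qed.

End InverseMatrix.

(** * Second-order geometry of a surface in the 3-sphere at one point *)

Section PointwiseSurface.
Context {R : realType}.
Local Notation quat := 'rV[R]_4.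
Variables (f : quat) (fd : 'I_2 -> quat).
Hypothesis f1 : dot f f = 1.
Hypothesis fdf : forall i, dot (fd i) f = 0.
Hypothesis immf : forall c0 c1 : R, c0 *: fd 0 + c1 *: fd 1 = 0 -> c0 = 0 /\ c1 = 0.

Let w i := qmul (qconj f) (fd i).
Let cf1 : dot (qconj f) (qconj f) = 1. Proof. by rewrite dot_conj. Qed.

Lemma co_ltr (p : quat) : co (qmul (qconj f) p) 0 = dot p f.
Proof.
rewrite -dot_q1; have -> : q1 = qmul (qconj f) f by rewrite qconj_mul f1 scale1r.
by rewrite dot_qmull cf1 mul1r.
Qed.

Lemma dot_ltr (p q : quat) : dot (qmul (qconj f) p) (qmul (qconj f) q) = dot p q.
Proof. by rewrite dot_qmull cf1 mul1r. Qed.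

Let w_im i : co (w i) 0 = 0. Proof. by rewrite /w co_ltr fdf. Qed.
Let dot_w i j : dot (w i) (w j) = dot (fd i) (fd j). Proof. exact: dot_ltr. Qed.

Let D := dot (cross (w 0) (w 1)) (cross (w 0) (w 1)).

Lemma area_gram : D = dot (fd 0) (fd 0) * dot (fd 1) (fd 1)
  - dot (fd 0) (fd 1) * dot (fd 0) (fd 1).
Proof. by rewrite /D dot_cross_cross// !dot_w (dotC (fd 1) (fd 0)). Qed.

Lemma area_gt0 : 0 < D.
Proof.
rewrite lt_neqAle eq_sym dot_ge0 andbT; apply/eqP.
rewrite area_gram => /subr0_eq D0.
have z0 : dot (fd 1) (fd 1) *: fd 0 + - dot (fd 0) (fd 1) *: fd 1 = 0.
  apply: dot_eq0; rewrite !(dotDl, dotDr, dotZl, dotZr) (dotC (fd 1) (fd 0)).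
  move: D0; set a := dot (fd 0) (fd 0); set b := dot _ (fd 1); set c := dot (fd 0) _.
  move=> D0; transitivity (b * (a * b - c * c)); first by ring.
  by rewrite D0 subrr mulr0.
have [/dot_eq0 b0 _] := immf z0.
have [_ /eqP] : (0 : R) = 0 /\ (1 : R) = 0.
  by apply: immf; rewrite b0 scaler0 scale0r addr0.
by rewrite oner_eq0.
Qed.

Variable nu : quat.
Hypothesis nuE : nu = (Num.sqrt D)^-1 *: cross (w 0) (w 1).

Let delta_neq0 : Num.sqrt D != 0. Proof. by rewrite gt_eqF// sqrtr_gt0 area_gt0. Qed.

Let sqrtD2 : Num.sqrt D * Num.sqrt D = D.
Proof. by rewrite -expr2 sqr_sqrtr//; exact/ltW/area_gt0. Qed.

Let cross_w : cross (w 0) (w 1) = Num.sqrt D *: nu.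
Proof. by rewrite nuE scalerA mulfV// scale1r. Qed.

Lemma normal_im : co nu 0 = 0.
Proof. by rewrite nuE coZ cross0 mulr0. Qed.

Lemma normal_unit : dot nu nu = 1.
Proof.
rewrite nuE dotZl dotZr -/D mulrA -invfM sqrtD2 mulVf//.
by rewrite gt_eqF// area_gt0.
Qed.

Lemma normal_orth i : dot (w i) nu = 0.
Proof.
rewrite nuE dotZr dotC.
by have [->|->] := ord2P i; rewrite ?dot_cross_l ?dot_cross_r mulr0.
Qed.

Variables (fdd : 'I_2 -> 'I_2 -> quat) (nud : 'I_2 -> quat).
Hypothesis fddC : fdd 1 0 = fdd 0 1.
Hypothesis nud_im : forall i, co (nud i) 0 = 0.
Hypothesis nud_orth : forall i, dot nu (nud i) = 0.
(** The derivative in direction [i] of the orthogonality of [w j] and [nu]. *)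
Hypothesis dwnu : forall i j,
  dot (qmul (qconj (fd i)) (fd j) + qmul (qconj f) (fdd i j)) nu
  + dot (w j) (nud i) = 0.

Let h i j := dot (qmul (qconj f) (fdd i j)) nu.

Let hC : h 1 0 = h 0 1. Proof. by rewrite /h fddC. Qed.

(** Differentiating [w j] also differentiates the left translation by [qconj f]. That contributes
    [qmul (qconj (fd i)) (fd j) = - qmul (w i) (w j)], whose component along [nu] is the
    antisymmetric term added to the second fundamental form. *)
Lemma weingarten i j : dot (w j) (nud i) = - h i j + dot (cross (w i) (w j)) nu.
Proof.
have fdE k : fd k = qmul f (w k) by rewrite /w unit_qmulVK.
have E : qmul (qconj (fd i)) (fd j) = - qmul (w i) (w j).
  rewrite [in LHS](fdE i) [in LHS](fdE j) qconjM -qmulA unit_qmulK//.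
  by rewrite (qconj_im (w_im i)) qmulNl.
have := dwnu i j; rewrite E dotDl dotNl.
rewrite (dot_qmul_im (w_im i) (w_im j) normal_im) -/(h i j) => H.
by apply/eqP; rewrite -subr_eq0 -H; apply/eqP; ring.
Qed.

Hypothesis fddf : forall i j, dot (fdd i j) f = - dot (fd j) (fd i).

(** Splits second derivatives into parts along [f], along the normal and tangent to the surface. By
    [fddf] the part along [f] is the metric up to sign; the factor [D] avoids dividing by the
    area. *)
Lemma second_products i j k l :
  D * (dot (fdd i j) (fdd k l) - dot (fd j) (fd i) * dot (fd l) (fd k)) =
  D * (h i j * h k l)
  + (dot (fd 1) (fd 1) * (dot (fdd i j) (fd 0) * dot (fdd k l) (fd 0))
     - dot (fd 0) (fd 1) * (dot (fdd i j) (fd 0) * dot (fdd k l) (fd 1)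
                           + dot (fdd i j) (fd 1) * dot (fdd k l) (fd 0))
     + dot (fd 0) (fd 0) * (dot (fdd i j) (fd 1) * dot (fdd k l) (fd 1))).
Proof.
have := gram_expansion (qmul (qconj f) (fdd i j)) (qmul (qconj f) (fdd k l))
  (w_im 0) (w_im 1).
rewrite -/D !dot_ltr !co_ltr !fddf mulrNN => ->; congr (_ + _).
by rewrite cross_w !dotZl mulrACA sqrtD2 !(dotC nu).
Qed.

Hypothesis gauss : h 0 0 * h 1 1 - h 0 1 * h 0 1 + D = 0.

Let cross_nu : dot (cross (w 0) (w 1)) nu = Num.sqrt D.
Proof. by rewrite cross_w dotZl normal_unit mulr1. Qed.

Let cross_ww i : cross (w i) (w i) = 0.
Proof. by apply: quatP; rewrite /cross !coE /co ?mxE; ring. Qed.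

Lemma lgauss_gram :
  dot (nud 0) (nud 0) * dot (nud 1) (nud 1) = dot (nud 0) (nud 1) * dot (nud 0) (nud 1).
Proof.
apply: (gram_dependent normal_im (w_im 0) (w_im 1) (nud_im 0) (nud_im 1) cross_w
  delta_neq0 normal_unit (nud_orth 0) (nud_orth 1)).
rewrite !weingarten !cross_ww !dot0l !addr0 (crossC (w 0)) dotNl cross_nu hC.
exact: gauss_cross_det gauss (esym sqrtD2).
Qed.

(** Up to conjugation by [f], this is the derivative of the right Gauss map, as [partial_rgauss]
    shows. *)
Let mu i := nud i + 2 *: cross (w i) nu.

Let mu_im i : co (mu i) 0 = 0.
Proof. by rewrite /mu coD coZ cross0 nud_im mulr0 addr0. Qed.

Let mu_orth i : dot nu (mu i) = 0.
Proof. by rewrite /mu dotDr nud_orth dotZr dotC dot_cross_r mulr0 addr0. Qed.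

(** The term [2 *: cross (w i) nu] reverses the antisymmetric part of the pairing matrix, which
    leaves the determinant unchanged. *)
Lemma rgauss_gram :
  dot (mu 0) (mu 0) * dot (mu 1) (mu 1) = dot (mu 0) (mu 1) * dot (mu 0) (mu 1).
Proof.
apply: (gram_dependent normal_im (w_im 0) (w_im 1) (mu_im 0) (mu_im 1) cross_w
  delta_neq0 normal_unit (mu_orth 0) (mu_orth 1)).
have wmu i j : dot (w j) (mu i) = - h i j - dot (cross (w i) (w j)) nu.
  by rewrite /mu dotDr dotZr weingarten dot_crossC; ring.
rewrite !wmu !cross_ww !dot0l !subr0 (crossC (w 0)) dotNl cross_nu hC opprK.
by apply: etrans (gauss_cross_det gauss (esym sqrtD2)); ring.
Qed.

(** [mu i - nud i] is twice a quarter turn of [w i]. A combination killing both differentials thus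
    kills the tangent vectors, and the immersion property applies. *)
Lemma gauss_kernel (c0 c1 : R) : c0 *: nud 0 + c1 *: nud 1 = 0 ->
  c0 *: mu 0 + c1 *: mu 1 = 0 -> c0 = 0 /\ c1 = 0.
Proof.
rewrite /mu !scalerDr addrACA => -> /eqP; rewrite add0r !(scalerA _ 2) !(mulrC _ 2).
rewrite -!scalerA -scalerDr scaler_eq0 pnatr_eq0/= => /eqP H.
apply: immf; set v := _ + _.
have vE : qmul (qconj f) v = c0 *: w 0 + c1 *: w 1 by rewrite /v qmulDr !qmulZr.
have crossE : cross (qmul (qconj f) v) nu = c0 *: cross (w 0) nu + c1 *: cross (w 1) nu.
  by rewrite vE; apply: quatP; rewrite /cross !coE; ring.
have vi : co (qmul (qconj f) v) 0 = 0 by rewrite vE coD !coZ !w_im !mulr0 addr0.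
have vn : dot (qmul (qconj f) v) nu = 0.
  by rewrite vE dotDl !dotZl !normal_orth !mulr0 addr0.
apply: dot_eq0; rewrite -dot_ltr -(dot_cross_unit normal_im vi vi normal_unit vn).
by rewrite crossE H dot0l.
Qed.

Let two_vectors_gram (a b : quat) : 0 < dot a a + dot b b \/ (a = 0 /\ b = 0).
Proof.
have := dot_ge0 a; rewrite le_eqVlt => /predU1P[/esym/dot_eq0 ->|a0]; last first.
  by left; rewrite ltr_pwDl// dot_ge0.
have := dot_ge0 b; rewrite le_eqVlt => /predU1P[/esym/dot_eq0 ->|b0]; first by right.
by left; rewrite ltr_wpDl// dot_ge0.
Qed.

Let gram_null (a b : quat) : dot a a * dot b b = dot a b * dot a b ->
  exists c0 c1 : R, c0 *: a + c1 *: b = 0 /\ ((c0 != 0) || (c1 != 0)).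
Proof.
move=> H; have [b0|b0] := eqVneq (dot b b) 0.
  by exists 0, 1; rewrite scale0r (dot_eq0 b0) scaler0 addr0 oner_eq0 orbT.
exists (dot b b), (- dot a b); split; last by rewrite b0.
apply: dot_eq0; rewrite !(dotDl, dotDr, dotZl, dotZr) (dotC b a).
transitivity (dot b b * (dot a a * dot b b - dot a b * dot a b)); first by ring.
by rewrite H subrr mulr0.
Qed.

(** If [nud] vanished, the null direction of [mu] given by [gram_null] would lie in both kernels. *)
Lemma lgauss_trace : 0 < dot (nud 0) (nud 0) + dot (nud 1) (nud 1).
Proof.
have [//|[n0 n1]] := two_vectors_gram (nud 0) (nud 1).
have [c0 [c1 [E]]] := gram_null rgauss_gram.
have [|-> ->] := gauss_kernel _ E; last by rewrite eqxx.
by rewrite n0 n1 !scaler0 addr0.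
Qed.

Lemma rgauss_trace : 0 < dot (mu 0) (mu 0) + dot (mu 1) (mu 1).
Proof.
have [//|[n0 n1]] := two_vectors_gram (mu 0) (mu 1).
have [c0 [c1 [E]]] := gram_null lgauss_gram.
have [|-> ->] := gauss_kernel E; last by rewrite eqxx.
by rewrite n0 n1 !scaler0 addr0.
Qed.

End PointwiseSurface.

(** * The Gauss equation of a flat metric *)

Section GaussEquation.
Context {R : realType}.
Local Notation plane := 'rV[R]_2.
Local Notation quat := 'rV[R]_4.
Variables (f : plane -> quat) (fd : 'I_2 -> plane -> quat)
  (fdd : 'I_2 -> 'I_2 -> plane -> quat).
Hypothesis fdE : forall i, partial i f = fd i.
Hypothesis fddE : forall i j, partial i (fd j) = fdd i j.
Hypothesis sfd : forall i, smooth (fd i).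
Hypothesis sfdd : forall i j, smooth (fdd i j).
Hypothesis fddC : forall i j x, fdd i j x = fdd j i x.
Hypothesis fdddC : forall x, partial 0 (fdd 1 1) x = partial 1 (fdd 0 1) x.

Local Notation g := (first_fundamental_form f).
Let G i j (x : plane) : R^o := dot (fd i x) (fd j x).
Let A i j k (x : plane) : R^o := dot (fdd i j x) (fd k x).
Variable D : plane -> R^o.
Hypothesis DE : forall x, D x = G 0 0 x * G 1 1 x - G 0 1 x * G 0 1 x.
Hypothesis sD : smooth D.
Hypothesis D0 : forall x, D x != 0.

Let Gam0 i j x : R^o := (G 1 1 x * A i j 0 x - G 0 1 x * A i j 1 x) * (D x)^-1.
Let Gam1 i j x : R^o := (G 0 0 x * A i j 1 x - G 0 1 x * A i j 0 x) * (D x)^-1.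

Let sG i j : smooth (G i j). Proof. exact: smooth_dot. Qed.
Let sA i j k : smooth (A i j k). Proof. exact: smooth_dot. Qed.
Let sDV : smooth (fun x => (D x)^-1 : R^o).
Proof.
exact: smoothV D0 sD.
Qed.
Let sGam0 i j : smooth (Gam0 i j).
Proof.
exact: smoothM (smoothB (smoothM (sG 1 1) (sA i j 0)) (smoothM (sG 0 1) (sA i j 1))) sDV.
Qed.
Let sGam1 i j : smooth (Gam1 i j).
Proof.
exact: smoothM (smoothB (smoothM (sG 0 0) (sA i j 1)) (smoothM (sG 0 1) (sA i j 0))) sDV.
Qed.

Let AC i j k x : A i j k x = A j i k x. Proof. by rewrite /A fddC. Qed.

Let dG k i j x : partial k (G i j) x = A k i j x + A k j i x.
Proof.
apply: etrans (partial_dot k x (sfd i) (sfd j)) _.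
by rewrite !fddE (dotC (fd i x)).
Qed.

Let gE i j x : g x i j = G i j x.
Proof. by rewrite mxE !fdE. Qed.

(** By symmetry of second derivatives, the three metric derivatives combine to twice <f_ij, f_l>;
    the other terms cancel in pairs. *)
Lemma christoffelE k i j x :
  christoffel g k i j x = \sum_l invmx (g x) k l * A i j l x.
Proof.
rewrite /christoffel mulr_sumr; apply: eq_bigr => l _; rewrite mulrCA; congr (_ * _).
have E a b : (fun y => g y a b : R^o) = G a b by apply/funext => y; exact: gE.
rewrite !E !dG (AC j i l) (AC l j i) (AC l i j).
by apply: (mulfI (x := 2)); rewrite ?pnatr_eq0// mulrA mulfV ?pnatr_eq0// mul1r; ring.
Qed.

Let inv_entries x : [/\ invmx (g x) 0 0 = G 1 1 x / D x, invmx (g x) 0 1 = - G 0 1 x / D x,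
      invmx (g x) 1 0 = - G 0 1 x / D x & invmx (g x) 1 1 = G 0 0 x / D x].
Proof.
have GC : G 1 0 x = G 0 1 x by exact: dotC.
have := @invmx2 R (g x); rewrite !gE GC -DE => H.
exact: (H (D0 x)).
Qed.

Let Gam0E i j : christoffel g 0 i j = Gam0 i j.
Proof.
apply/funext => x; rewrite christoffelE sum2; have [-> -> _ _] := inv_entries x.
by rewrite /Gam0; move: (G 1 1 x) (G 0 1 x) (A i j 0 x) (A i j 1 x) (D x)^-1; intros; ring.
Qed.

Let Gam1E i j : christoffel g 1 i j = Gam1 i j.
Proof.
apply/funext => x; rewrite christoffelE sum2; have [_ _ -> ->] := inv_entries x.
by rewrite /Gam1; move: (G 0 0 x) (G 0 1 x) (A i j 0 x) (A i j 1 x) (D x)^-1; intros; ring.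
Qed.

(** Cramer's rule, with [k] the inverse determinant. *)
Let rel (a b c p q k : R) : (a * b - c * c) * k = 1 ->
  p = a * ((b * p - c * q) * k) + c * ((a * q - c * p) * k) /\
  q = c * ((b * p - c * q) * k) + b * ((a * q - c * p) * k).
Proof.
move=> H; split.
- by transitivity (((a * b - c * c) * k) * p); [rewrite H mul1r|ring].
- by transitivity (((a * b - c * c) * k) * q); [rewrite H mul1r|ring].
Qed.

Let DK x : (G 0 0 x * G 1 1 x - G 0 1 x * G 0 1 x) * (D x)^-1 = 1.
Proof. by rewrite -DE mulfV. Qed.

Let rel0 i j x : A i j 0 x = G 0 0 x * Gam0 i j x + G 0 1 x * Gam1 i j x.
Proof. exact: (rel (A i j 0 x) (A i j 1 x) (DK x)).1. Qed.

Let rel1 i j x : A i j 1 x = G 0 1 x * Gam0 i j x + G 1 1 x * Gam1 i j x.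
Proof. exact: (rel (A i j 0 x) (A i j 1 x) (DK x)).2. Qed.

(** Differentiates [rel0] rather than the quotients defining the Christoffel symbols, so that their
    derivatives enter linearly, as they do in the curvature. *)
Let drel k i j x : dot (partial k (fdd i j) x) (fd 0 x) + dot (fdd i j x) (fdd k 0 x) =
  (A k 0 0 x + A k 0 0 x) * Gam0 i j x + G 0 0 x * partial k (Gam0 i j) x
  + ((A k 0 1 x + A k 1 0 x) * Gam1 i j x + G 0 1 x * partial k (Gam1 i j) x).
Proof.
have := partial_dot k x (sfdd i j) (sfd 0); rewrite fddE => <-.
have -> : (fun y => dot (fdd i j y) (fd 0 y) : R^o) =
    fun y => G 0 0 y * Gam0 i j y + G 0 1 y * Gam1 i j y.
  by apply/funext => y; exact: rel0.
apply: etrans (partialD k x (smoothM (sG 0 0) (sGam0 i j))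
  (smoothM (sG 0 1) (sGam1 i j))) _.
rewrite (partialM k x (sG 0 0) (sGam0 i j)) (partialM k x (sG 0 1) (sGam1 i j)).
by rewrite !dG.
Qed.

Variable h : 'I_2 -> 'I_2 -> plane -> R.
Hypothesis second_products : forall i j k l x,
  D x * (dot (fdd i j x) (fdd k l x) - G j i x * G l k x) =
  D x * (h i j x * h k l x)
  + (G 1 1 x * (A i j 0 x * A k l 0 x)
     - G 0 1 x * (A i j 0 x * A k l 1 x + A i j 1 x * A k l 0 x)
     + G 0 0 x * (A i j 1 x * A k l 1 x)).
Hypothesis flat_f : flat_metric g.

Lemma gauss_equation x : h 0 0 x * h 1 1 x - h 0 1 x * h 0 1 x + D x = 0.
Proof.
(* [R0] and [R1] are the two components of R(d_0, d_1) d_1 = 0. Below, [E1] and [E2] differentiate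
   <f_11, f_0> along the first and <f_01, f_0> along the second coordinate, and contain the same
   third derivative of [f]. *)
have R0 := flat_f 0 1 0 1 x; have R1 := flat_f 1 1 0 1 x.
rewrite /riemann sum2 !Gam0E !Gam1E in R0.
rewrite /riemann sum2 !Gam0E !Gam1E in R1.
have GamC0 : Gam0 1 0 x = Gam0 0 1 x by rewrite /Gam0 !(AC 1 0).
have GamC1 : Gam1 1 0 x = Gam1 0 1 x by rewrite /Gam1 !(AC 1 0).
rewrite GamC0 in R0; rewrite GamC1 in R1.
have E1 := drel 0 1 1 x; have E2 := drel 1 0 1 x.
rewrite -fdddC (fddC 1 0 x) (AC 1 0 0) (AC 1 0 1) in E2.
rewrite fdddC in E1; rewrite fdddC in E2.
have N1 := second_products 1 1 0 0 x; have N2 := second_products 0 1 0 1 x.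
have G10 : G 1 0 x = G 0 1 x by exact: dotC.
rewrite G10 in N2.
exact: (gauss_algebra (DE x) (D0 x) (rel0 0 0 x) (rel1 0 0 x) (rel0 0 1 x)
  (rel1 0 1 x) (rel0 1 1 x) (rel1 1 1 x) E1 E2 R0 R1 N1 N2).
Qed.

End GaussEquation.

(** * The two Gauss maps along the whole surface *)

Section FlatSurface.
Context {R : realType}.
Local Notation plane := 'rV[R]_2.
Local Notation quat := 'rV[R]_4.

Section Definitions.
Variable f : plane -> quat.

Definition ltang (i : 'I_2) (x : plane) : quat := qmul (qconj (f x)) (partial i f x).

Definition larea (x : plane) : R^o :=
  dot (cross (ltang 0 x) (ltang 1 x)) (cross (ltang 0 x) (ltang 1 x)).

(* The unit normal of the surface [f] in the unit sphere is [f * lgauss f]. *)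
Definition lgauss (x : plane) : quat :=
  (Num.sqrt (larea x))^-1 *: cross (ltang 0 x) (ltang 1 x).

Definition rgauss (x : plane) : quat := qmul (qmul (f x) (lgauss x)) (qconj (f x)).

End Definitions.

Lemma lgauss_shift f l x : (forall y, f (y + l) = f y) -> lgauss f (x + l) = lgauss f x.
Proof.
move=> fl; have E : (fun y => f (y + l)) = f by apply/funext.
have pl i : partial i f (x + l) = partial i f x by rewrite -partial_shift E.
by rewrite /lgauss /larea /ltang !pl fl.
Qed.

Lemma rgauss_shift f l x : (forall y, f (y + l) = f y) -> rgauss f (x + l) = rgauss f x.
Proof. by move=> fl; rewrite /rgauss fl lgauss_shift. Qed.

(** Writing [fi = qmul f w] with [w] imaginary, the derivatives of the two outer factors give the
    commutator of [w] and [nu], which is twice their vector product. *)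
Lemma rgauss_product_rule (f fi nu n : quat) : dot f f = 1 -> dot fi f = 0 ->
  co nu 0 = 0 ->
  qmul (qmul fi nu + qmul f n) (qconj f) + qmul (qmul f nu) (qconj fi) =
  qmul (qmul f (n + 2 *: cross (qmul (qconj f) fi) nu)) (qconj f).
Proof.
move=> f1 fi0 inu; set w := qmul (qconj f) fi.
have wi : co w 0 = 0 by rewrite /w co_ltr.
have fiE : fi = qmul f w by rewrite /w unit_qmulVK.
have -> : 2 *: cross w nu = qmul w nu - qmul nu w.
  rewrite (qmul_im wi inu) (qmul_im inu wi) (crossC w nu) (dotC nu w).
  by apply: quatP; rewrite !coE; ring.
clearbody w; rewrite fiE qconjM (qconj_im wi).
rewrite !(qmulDr, qmulDl, qmulNl, qmulNr) !qmulA.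
by rewrite [RHS]addrA; congr (_ - _); exact: addrC.
Qed.

Lemma gram_transport (a b c a' b' c' : R) : a = a' -> b = b' -> c = c' ->
  a' * b' = c' * c' -> 0 < a' + b' -> a * b = c * c /\ 0 < a + b.
Proof. by move=> -> -> ->. Qed.

Lemma unit_conj_eq0 (f p : quat) : dot f f = 1 ->
  qmul (qmul f p) (qconj f) = 0 -> p = 0.
Proof.
move=> f1 H; apply: dot_eq0; have := dot0l (0 : quat).
by rewrite -{1 2}H dot_qmulr dot_conj f1 mul1r dot_qmull f1 mul1r.
Qed.

Lemma unit_conj_comb (f p q : quat) (a b : R) :
  qmul (qmul f (a *: p + b *: q)) (qconj f) =
  a *: qmul (qmul f p) (qconj f) + b *: qmul (qmul f q) (qconj f).
Proof. by rewrite qmulDr !qmulZr qmulDl !qmulZl. Qed.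

Variable f : plane -> quat.
Hypothesis sf : smooth f.
Hypothesis f1 : forall x, dot (f x) (f x) = 1.
Hypothesis immf : forall x (c0 c1 : R),
  c0 *: partial 0 f x + c1 *: partial 1 f x = 0 -> c0 = 0 /\ c1 = 0.

Local Notation nu := (lgauss f).

Let fd i := partial i f.
Let fdd i j := partial i (partial j f).
Let sfd i : smooth (fd i). Proof. exact: smooth_partial. Qed.
Let sfdd i j : smooth (fdd i j). Proof. by do 2! apply: smooth_partial. Qed.

Lemma partial_dot_cst (c : R) i (v : plane -> quat) x : smooth v ->
  (forall y, dot (v y) (v y) = c) -> dot (v x) (partial i v x) = 0.
Proof.
move=> sv vc; have := partial_cst i (c : R^o) x.
have <- : (fun x => dot (v x) (v x) : R^o) = fun=> c by apply/funext.
rewrite (partial_dot i x sv sv) (dotC (partial i v x)) => H.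
by apply: (mulfI (x := 2)); rewrite ?pnatr_eq0// mulr0 -H mulr_natl mulr2n.
Qed.

Lemma partial_dot_eq0 i (v w : plane -> quat) x : smooth v -> smooth w ->
  (forall y, dot (v y) (w y) = 0) ->
  dot (partial i v x) (w x) + dot (v x) (partial i w x) = 0.
Proof.
move=> sv sw vw; rewrite -(partial_dot i x sv sw).
have -> : (fun x => dot (v x) (w x) : R^o) = fun=> 0 by apply/funext.
exact: partial_cst.
Qed.

Lemma dot_partial_self i x : dot (fd i x) (f x) = 0.
Proof. by rewrite dotC; exact: partial_dot_cst sf f1. Qed.

Let immx x := @immf x.
Let fdfx x i := dot_partial_self i x.

Lemma smooth_ltang i : smooth (ltang f i).
Proof. exact: smooth_qmul (smooth_qconj sf) (sfd i). Qed.

Lemma smooth_larea : smooth (larea f).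
Proof.
have sc := smooth_cross (smooth_ltang 0) (smooth_ltang 1).
exact: (smooth_dot sc sc).
Qed.

Lemma larea_gt0 x : 0 < larea f x.
Proof. exact: (area_gt0 (f1 x) (fdfx x) (@immx x)). Qed.

Lemma smooth_lgauss : smooth nu.
Proof.
apply: smoothZ; last exact: smooth_cross (smooth_ltang 0) (smooth_ltang 1).
apply: smoothV; first by move=> x; rewrite gt_eqF// sqrtr_gt0 larea_gt0.
by apply: smooth_sqrt; [exact: larea_gt0|exact: smooth_larea].
Qed.

Lemma smooth_rgauss : smooth (rgauss f).
Proof. exact: smooth_qmul (smooth_qmul sf smooth_lgauss) (smooth_qconj sf). Qed.

Lemma lgauss_unit x : dot (nu x) (nu x) = 1.
Proof. exact: (normal_unit (f1 x) (fdfx x) (@immx x) erefl). Qed.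

Lemma lgauss_im x : co (nu x) 0 = 0.
Proof. by rewrite /lgauss coZ cross0 mulr0. Qed.

Lemma lgauss_orth i x : dot (ltang f i x) (nu x) = 0.
Proof. exact: (@normal_orth R (f x) (fd^~ x) (nu x) erefl). Qed.

Lemma partial_lgauss_im i x : co (partial i nu x) 0 = 0.
Proof.
rewrite /co -(partial_coord i _ x smooth_lgauss).
have -> : (fun y => nu y 0 (inord 0) : R^o) = fun=> 0.
  by apply/funext => y; exact: lgauss_im.
exact: partial_cst.
Qed.

Lemma partial_rgauss i x : partial i (rgauss f) x =
  qmul (qmul (f x) (partial i nu x + 2 *: cross (ltang f i x) (nu x))) (qconj (f x)).
Proof.
apply: etrans (rgauss_product_rule (partial i nu x) (f1 x) (fdfx x i) (lgauss_im x)).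
have sn := smooth_lgauss.
apply: etrans (partial_qmul i x (smooth_qmul sf sn) (smooth_qconj sf)) _.
by rewrite (partial_qmul i x sf sn) (partial_qconj i x sf).
Qed.

Lemma dot_partial_rgauss i j x :
  dot (partial i (rgauss f) x) (partial j (rgauss f) x) =
  dot (partial i nu x + 2 *: cross (ltang f i x) (nu x))
      (partial j nu x + 2 *: cross (ltang f j x) (nu x)).
Proof.
by rewrite !partial_rgauss dot_qmulr dot_conj f1 mul1r dot_qmull f1 mul1r.
Qed.

Lemma gauss_maps_kernel x c0 c1 :
  c0 *: partial 0 nu x + c1 *: partial 1 nu x = 0 ->
  c0 *: partial 0 (rgauss f) x + c1 *: partial 1 (rgauss f) x = 0 ->
  c0 = 0 /\ c1 = 0.
Proof.
move=> H0 H1.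
rewrite (partial_rgauss 0 x) (partial_rgauss 1 x) in H1.
have K := @gauss_kernel R (f x) (fd^~ x) (f1 x) (fdfx x) (@immx x) (nu x) erefl
  (fun i => partial i nu x) c0 c1 H0.
apply: K; exact: (unit_conj_eq0 (f1 x) (etrans (unit_conj_comb _ _ _ _ _) H1)).
Qed.

Hypothesis flat_f : flat_metric (first_fundamental_form f).

Let h i j x := dot (qmul (qconj (f x)) (fdd i j x)) (nu x).

Let fddC i j x : fdd i j x = fdd j i x.
Proof. exact: (partialC_row i j x sf). Qed.

Let dwnu x i j : dot (qmul (qconj (fd i x)) (fd j x) + qmul (qconj (f x)) (fdd i j x)) (nu x)
  + dot (ltang f j x) (partial i nu x) = 0.
Proof.
have := partial_dot_eq0 i x (smooth_ltang j) smooth_lgauss (lgauss_orth j).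
by rewrite (partial_qmul i x (smooth_qconj sf) (sfd j)) (partial_qconj i x sf).
Qed.

Let fddf x i j : dot (fdd i j x) (f x) = - dot (fd j x) (fd i x).
Proof.
have := partial_dot_eq0 i x (sfd j) sf (dot_partial_self j).
by move/eqP; rewrite addr_eq0 => /eqP.
Qed.

Let gaussE x : h 0 0 x * h 1 1 x - h 0 1 x * h 0 1 x + larea f x = 0.
Proof.
have gram y : larea f y = dot (fd 0 y) (fd 0 y) * dot (fd 1 y) (fd 1 y)
    - dot (fd 0 y) (fd 1 y) * dot (fd 0 y) (fd 1 y).
  exact: (@area_gram R (f y) (fd^~ y) (f1 y) (fdfx y)).
have D0 y : larea f y != 0 by rewrite gt_eqF// larea_gt0.
have C3 y : partial 0 (fdd 1 1) y = partial 1 (fdd 0 1) y.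
  exact: (partialC_row 0 1 y (sfd 1)).
exact: (@gauss_equation R f fd fdd (fun=> erefl) (fun _ _ => erefl) sfd sfdd fddC C3
  (larea f) gram smooth_larea D0 h (fun i j k l y =>
    @second_products R (f y) (fd^~ y) (f1 y) (fdfx y) (@immx y) (nu y) erefl
      (fun i j => fdd i j y) (fddf y) i j k l) flat_f x).
Qed.

Lemma lgauss_rank_one x :
  dot (partial 0 nu x) (partial 0 nu x) * dot (partial 1 nu x) (partial 1 nu x) =
  dot (partial 0 nu x) (partial 1 nu x) * dot (partial 0 nu x) (partial 1 nu x) /\
  0 < dot (partial 0 nu x) (partial 0 nu x) + dot (partial 1 nu x) (partial 1 nu x).
Proof.
have no i := partial_dot_cst i x smooth_lgauss lgauss_unit.
split.
- exact: (@lgauss_gram R (f x) (fd^~ x) (f1 x) (fdfx x) (@immx x) (nu x) erefl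
    (fun i j => fdd i j x) (fun i => partial i nu x) (fddC 1 0 x)
    (partial_lgauss_im^~ x) no (dwnu x) (gaussE x)).
- exact: (@lgauss_trace R (f x) (fd^~ x) (f1 x) (fdfx x) (@immx x) (nu x) erefl
    (fun i j => fdd i j x) (fun i => partial i nu x) (fddC 1 0 x)
    (partial_lgauss_im^~ x) no (dwnu x) (gaussE x)).
Qed.

Lemma rgauss_rank_one x : let m i := partial i (rgauss f) x in
  dot (m 0) (m 0) * dot (m 1) (m 1) = dot (m 0) (m 1) * dot (m 0) (m 1) /\
  0 < dot (m 0) (m 0) + dot (m 1) (m 1).
Proof.
have no i := partial_dot_cst i x smooth_lgauss lgauss_unit.
apply: (gram_transport (dot_partial_rgauss 0 0 x) (dot_partial_rgauss 1 1 x)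
  (dot_partial_rgauss 0 1 x)).
- exact: (@rgauss_gram R (f x) (fd^~ x) (f1 x) (fdfx x) (@immx x) (nu x) erefl
    (fun i j => fdd i j x) (fun i => partial i nu x) (fddC 1 0 x)
    (partial_lgauss_im^~ x) no (dwnu x) (gaussE x)).
- exact: (@rgauss_trace R (f x) (fd^~ x) (f1 x) (fdfx x) (@immx x) (nu x) erefl
    (fun i j => fdd i j x) (fun i => partial i nu x) (fddC 1 0 x)
    (partial_lgauss_im^~ x) no (dwnu x) (gaussE x)).
Qed.

End FlatSurface.

(** * Global inversion under uniform bounds *)

Section GlobalInverse.
Context {R : realType}.
Local Notation plane := 'rV[R]_2.
Local Notation e i := (delta_mx 0 i : plane).

Lemma row_sum2_le (v : plane) (a b K : R) : `|a| <= K -> `|b| <= K ->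
  `|v 0 0 * a + v 0 1 * b| <= 2 * K * `|v|.
Proof.
move=> aK bK; have -> : 2 * K * `|v| = `|v| * K + `|v| * K by ring.
by rewrite (le_trans (ler_normD _ _))// !normrM lerD// ler_pM// row_norm_ge.
Qed.

Lemma norm_mulmx_le (v : plane) (M : 'M[R]_2) (B : R) :
  (forall i j, `|M i j| <= B) -> `|v *m M| <= 2 * B * `|v|.
Proof.
move=> MB; have B0 : 0 <= B by exact: le_trans (normr_ge0 _) (MB 0 0).
apply: row_norm_le => [|j]; first by rewrite !mulr_ge0.
by rewrite mxE sum2 row_sum2_le.
Qed.

Lemma linear_remainder (v : plane) (p q a b a0 b0 : R) :
  p - q = v 0 0 * a + v 0 1 * b ->
  p - q - (v 0 0 * a0 + v 0 1 * b0) = v 0 0 * (a - a0) + v 0 1 * (b - b0).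
Proof. by move=> ->; ring. Qed.

Lemma segment_ball (x0 x y : plane) (t r : R) : 0 <= t <= 1 ->
  `|x - x0| <= r -> `|y - x0| <= r -> `|x + t *: (y - x) - x0| <= r.
Proof.
move=> /andP[t0 t1] xr yr.
have -> : x + t *: (y - x) - x0 = (1 - t) *: (x - x0) + t *: (y - x0).
  by apply/rowP => i; rewrite !mxE; ring.
rewrite (le_trans (ler_normD _ _))// !normrZ (ger0_norm t0) ger0_norm ?subr_ge0//.
have -> : r = (1 - t) * r + t * r by ring.
by rewrite lerD// ler_wpM2l// subr_ge0.
Qed.

(* [HB.pack_for] gives row vectors the complete normed module structure that
   the Banach fixed point theorem asks for. *)
Lemma row_fixed_point n (U : set 'rV[R]_n) (N : 'rV[R]_n -> 'rV[R]_n) : closed U -> U !=set0 ->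
  {homo N : x / U x >-> U x} ->
  (forall x x', U x -> U x' -> `|N x' - N x| <= 2^-1 * `|x' - x|) ->
  exists2 x, U x & x = N x.
Proof.
move=> cU U0 NU NB.
pose X : completeNormedModType R := HB.pack_for (completeNormedModType R) 'rV[R]_n.
pose F : {fun (U : set X) >-> (U : set X)} := @mkfun_fun X X U U N NU.
have ctr : @is_contraction R X X U U F.
  have h2 : 0 <= (2^-1 : R) by [].
  exists (NngNum h2); split; first by rewrite /= invf_lt1// ltr1n.
  by move=> [x' x] [/= Ux' Ux]; exact: NB.
exact: (@banach_fixed_point R X U F ctr cU U0).
Qed.

Variables (Psi : plane -> plane) (Minv : plane -> 'M[R]_2) (K B : R).
Hypothesis sPsi : smooth Psi.
Let P k (x : plane) : R^o := Psi x 0 k.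
Let sP k : smooth (P k). Proof. exact: (smooth_coord k sPsi). Qed.
Let dP i k x := partial i (P k) x.
Hypothesis Kbound : forall i j k x,
  `|partial i (partial j (fun y => Psi y 0 k : R^o)) x| <= K.
Hypothesis Bbound : forall i j x, `|Minv x i j| <= B.
Let J x : 'M[R]_2 := \matrix_(i, k) partial i (fun y => Psi y 0 k : R^o) x.
Hypothesis Minv_left : forall x, (\matrix_(i, k) partial i (fun y => Psi y 0 k : R^o) x) *m Minv x = 1%:M.
Hypothesis sMinv : forall i j, smooth (fun x => Minv x i j : R^o).

Let K0 : 0 <= K. Proof. exact: le_trans (normr_ge0 _) (Kbound 0 0 0 0). Qed.
Let B0 : 0 <= B. Proof. exact: le_trans (normr_ge0 _) (Bbound 0 0 0). Qed.

Let dP_lip i k x y : `|dP i k y - dP i k x| <= 2 * K * `|y - x|.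
Proof.
have [|t _ ->] := @plane_MVT R (partial i (P k)) x y.
  by move=> z; apply: smooth_differentiable; exact: smooth_partial.
by rewrite sum2; apply: row_sum2_le; exact: Kbound.
Qed.

(** [2 * B] bounds the inverse Jacobian as an operator in the sup norm, [2 * K] is a Lipschitz
    constant for the entries of the Jacobian, and the remaining 2 counts coordinates. *)
Let kap := 2 * B * (2 * (2 * K)).

Let kap0 : 0 <= kap. Proof. by rewrite !mulr_ge0. Qed.

(** On the ball of radius [r] the Jacobian varies by an amount proportional to [r]. So [Psi]
    followed by the inverse of its differential at [x0] is the identity up to an error with
    Lipschitz constant [kap * r]. *)
Lemma linearization x0 x x' r : `|x - x0| <= r -> `|x' - x0| <= r ->
  `|(Psi x' - Psi x) *m Minv x0 - (x' - x)| <= kap * r * `|x' - x|.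
Proof.
move=> xr x'r.
have r0 : 0 <= r by exact: le_trans xr.
have -> : (Psi x' - Psi x) *m Minv x0 - (x' - x) =
    (Psi x' - Psi x - (x' - x) *m J x0) *m Minv x0.
  have JM : J x0 *m Minv x0 = 1%:M by exact: Minv_left.
  by rewrite [RHS]mulmxBl -[X in _ = _ - X]mulmxA JM mulmx1.
rewrite (le_trans (norm_mulmx_le _ (fun i j => Bbound i j x0)))//.
rewrite /kap -!(mulrA (2 * B)) ler_wpM2l ?mulr_ge0//.
apply: row_norm_le => [|k]; first by rewrite !mulr_ge0.
have [|t t01 E] := @plane_MVT R (P k) x x'.
  by move=> z; exact: smooth_differentiable.
set z := x + t *: (x' - x) in E.
have zr : `|z - x0| <= r by exact: segment_ball.
have H i : `|dP i k z - dP i k x0| <= 2 * K * r.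
  by rewrite (le_trans (dP_lip i k x0 z))// ler_wpM2l// mulr_ge0.
have -> : (Psi x' - Psi x - (x' - x) *m J x0) 0 k =
   (x' - x) 0 0 * (dP 0 k z - dP 0 k x0) + (x' - x) 0 1 * (dP 1 k z - dP 1 k x0).
  apply: etrans (linear_remainder _ _ (etrans E (sum2 _))).
  by rewrite !mxE sum2 !mxE.
rewrite (le_trans (row_sum2_le _ (H 0) (H 1)))//.
by rewrite (mulrA 2 (2 * K)).
Qed.

(** At this radius the linearization error has Lipschitz constant at most 1/2; adding 1 covers the
    case where [kap] is 0. *)
Let rad := (2 * (kap + 1))^-1.
Let rad0 : 0 < rad.
Proof. by rewrite invr_gt0 mulr_gt0// ltr_wpDl. Qed.

Let kap_rad : kap * rad <= 2^-1.
Proof.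
rewrite /rad invfM mulrCA -[leRHS]mulr1 ler_wpM2l// ler_pdivrMr ?ltr_wpDl// mul1r.
by rewrite lerDl.
Qed.

(** The linearization error absorbs at most half of the displacement, so the image controls the
    other half, at a scale independent of the point. *)
Lemma local_inj x x' : `|x' - x| <= rad -> `|x' - x| <= 4 * B * `|Psi x' - Psi x|.
Proof.
move=> xx'; have xx : `|x - x| <= rad by rewrite subrr normr0 ltW.
have H := linearization xx xx'.
have H2 := norm_mulmx_le (Psi x' - Psi x) (fun i j => Bbound i j x).
have H3 : `|x' - x| <= `|(Psi x' - Psi x) *m Minv x| +
    `|(Psi x' - Psi x) *m Minv x - (x' - x)|.
  rewrite -{1}(subKr ((Psi x' - Psi x) *m Minv x) (x' - x)).
  exact: ler_normB.
have H4 : kap * rad * `|x' - x| <= 2^-1 * `|x' - x| by rewrite ler_wpM2r.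
move: H H2 H3 H4; move: `|_ *m _ - _| `|_ *m _| `|x' - x| `|Psi x' - Psi x|.
by move=> a b c d; lra.
Qed.

(** Chosen so that the first Newton step, of length at most [2 * B * rho], is at most half of
    [rad / 3]. *)
Let rho := rad / 3 / 2 / (2 * B + 1).
Let rho0 : 0 < rho.
Proof. by rewrite !divr_gt0// ltr_wpDl// mulr_ge0. Qed.

Lemma local_surj x0 w : `|w - Psi x0| <= rho ->
  exists2 x, `|x - x0| <= rad / 3 & Psi x = w.
Proof.
move=> wr; have rad3 : 0 < rad / 3 by rewrite divr_gt0.
pose U : set plane := closed_ball_ Num.norm x0 (rad / 3).
have UE x : U x <-> `|x - x0| <= rad / 3 by rewrite /U /closed_ball_/= distrC.
(* Newton's method with the differential frozen at [x0]: it contracts by 1/2 the ball of radius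
   [rad / 3], and its fixed points solve [Psi x = w]. *)
pose N (x : plane) : plane := x - (Psi x - w) *m Minv x0.
have NB x x' : U x -> U x' -> `|N x' - N x| <= 2^-1 * `|x' - x|.
  move=> /UE Ux /UE Ux'.
  have -> : N x' - N x = - ((Psi x' - Psi x) *m Minv x0 - (x' - x)).
    rewrite /N !mulmxBl; apply/rowP => i; rewrite !mxE.
    by move: (\sum_j _) (\sum_j _) (\sum_j _) => a b c; ring.
  rewrite normrN (le_trans (linearization Ux Ux'))// ler_wpM2r//.
  rewrite (le_trans _ kap_rad)// ler_wpM2l// ler_pdivrMr// ler_pMr//.
  by rewrite (_ : 1 = 1%:R)// ler_nat.
have Nx0 : `|N x0 - x0| <= rad / 3 / 2.
  rewrite /N addrAC subrr add0r normrN.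
  rewrite (le_trans (norm_mulmx_le _ (fun i j => Bbound i j x0)))//.
  rewrite distrC (le_trans (ler_wpM2l _ wr)) ?mulr_ge0// /rho mulrCA.
  rewrite -[leRHS]mulr1 ler_wpM2l ?divr_ge0 ?(ltW rad0)// ler_pdivrMr ?ltr_wpDl ?mulr_ge0//.
  by rewrite mul1r lerDl.
have Ux0 : U x0 by apply/UE; rewrite subrr normr0 ltW.
have NU : {homo N : x / U x >-> U x}.
  move=> x Ux; apply/UE; have H := NB _ _ Ux0 Ux.
  rewrite -(subrKA (N x0)) (le_trans (ler_normD _ _))//.
  rewrite [leRHS]splitr lerD// (le_trans H)// mulrC ler_wpM2r//.
  exact/UE.
have [x Ux xE] := row_fixed_point (@closed_closed_ball_ R plane x0 _) (ex_intro _ x0 Ux0) NU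
  (fun x x' Ux Ux' => NB x x' Ux Ux').
exists x; first exact/UE.
have MJ : Minv x0 *m J x0 = 1%:M by apply: mulmx1C; exact: Minv_left.
have H : (Psi x - w) *m Minv x0 = 0.
  by move/eqP: xE; rewrite /N -subr_eq0 opprB addrC subrK => /eqP.
by apply/eqP; rewrite -subr_eq0 -[_ - _]mulmx1 -MJ mulmxA H mul0mx.
Qed.

Let rad3 : rad / 3 <= rad.
Proof. by rewrite ler_pdivrMr// ler_pMr// (_ : 1 = 1%:R)// ler_nat. Qed.

Let cPsi : continuous Psi. Proof. exact: smooth_continuous. Qed.

(** Distinct points of one fibre are more than [rad] apart, so a continuous path in a fibre is
    locally constant. *)
Lemma locally_constant_path (z : R -> plane) : continuous z ->
  (forall s t, Psi (z s) = Psi (z t)) -> forall s t, z s = z t.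
Proof.
move=> cz Pz s t; apply/rowP => i.
apply: (@is_derive_0_is_cst R (fun t => z t 0 i)) => u.
have H : \forall v \near u, cst (z u 0 i) v = z v 0 i.
  move/cvgrPdist_lt : (cz u) => /(_ _ rad0); apply: filterS => v zuv.
  suff zE : z u = z v by rewrite /cst zE.
  apply/eqP; rewrite -subr_eq0 -normr_le0.
  have := local_inj (ltW zuv).
  by rewrite (Pz u v) subrr normr0 mulr0.
by apply: near_eq_is_derive H _; exact: is_derive_cst.
Qed.

(* The image of the path is contracted radially to [w] in [n] steps small
   enough to be lifted by the local inverses, which fix both ends. *)
Lemma lift_loop (w : plane) (t0 t1 : R) n (z : R -> plane) : continuous z ->
  (forall t, `|Psi (z t) - w| <= n%:R * rho) -> Psi (z t0) = w -> Psi (z t1) = w ->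
  z t0 = z t1.
Proof.
elim: n z => [|n IH] z cz zn z0 z1.
  apply: locally_constant_path => // s t.
  have H u : Psi (z u) = w.
    by apply/eqP; rewrite -subr_eq0 -normr_le0; have := zn u; rewrite mul0r.
  by rewrite !H.
(* Shrinking by n / (n + 1) brings the image from distance (n + 1) rho to n rho of [w], and moves
   each point by at most rho, within the reach of [local_surj]. *)
pose q : R := n%:R / n.+1%:R.
have n10 : (0 : R) < n.+1%:R by rewrite ltr0n.
have qE : 1 - q = n.+1%:R^-1.
  have nn0 := lt0r_neq0 n10; apply: (mulIf nn0).
  by rewrite mulVf// mulrBl mul1r /q mulfVK// -natrB// subSnn.
have q0 : 0 <= q by rewrite divr_ge0.
have q1 : q <= 1 by rewrite -subr_ge0 qE invr_ge0 ltW.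
pose W t := w + q *: (Psi (z t) - w).
have WP t : `|W t - Psi (z t)| <= rho.
  have -> : W t - Psi (z t) = - ((1 - q) *: (Psi (z t) - w)).
    by rewrite /W; apply/rowP => i; rewrite !mxE; ring.
  rewrite normrN normrZ qE ger0_norm ?invr_ge0 ?(ltW n10)// mulrC ler_pdivrMr// mulrC.
  exact: zn.
(* The lift is chosen pointwise; staying within [rad / 3] of [z], it gets its continuity from
   [local_inj]. *)
have [z' z'P] := choice (fun t => let: ex_intro2 x a b := local_surj (WP t) in
  ex_intro (fun x => `|x - z t| <= rad / 3 /\ Psi x = W t) x (conj a b)).
have cW : continuous W.
  move=> t; apply: cvgD; first exact: cvg_cst.
  apply: cvgZl_tmp; apply: cvgB; last exact: cvg_cst.
  by apply: continuous_comp; [exact: cz|exact: cPsi].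
(* Three displacements of [rad / 3] add up to the range of [local_inj], whence the divisor 3. *)
have near_z t : \forall s \near t, `|z' s - z' t| <= rad.
  have r30 : 0 < rad / 3 by rewrite divr_gt0.
  move/cvgrPdist_lt : (cz t) => /(_ _ r30); apply: filterS => s zts.
  have [a _] := z'P s; have [b _] := z'P t; have c := ltW zts.
  have -> : z' s - z' t = (z' s - z s) - (z t - z s) - (z' t - z t).
    by apply/rowP => i; rewrite !mxE; ring.
  rewrite (le_trans (ler_normB _ _))// (le_trans (lerD (ler_normB _ _) (lexx _)))//.
  by rewrite (le_trans (lerD (lerD a c) b))//; lra.
have cz' : continuous z'.
  move=> t; apply/cvgrPdist_lt => eps eps0.
  have e0 : 0 < eps / (4 * B + 1) by rewrite divr_gt0// ltr_wpDl// mulr_ge0.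
  move/cvgrPdist_lt : (cW t) => /(_ _ e0).
  apply: filterS2 (near_z t) => s zs Ws.
  rewrite distrC (le_lt_trans (local_inj zs))//.
  have [_ ->] := z'P s; have [_ ->] := z'P t.
  rewrite distrC (le_lt_trans (_ : _ <= (4 * B + 1) * `|W t - W s|))//.
    by rewrite ler_wpM2r// lerDl.
  by rewrite mulrC -ltr_pdivlMr// ltr_wpDl// mulr_ge0.
have end_fix t : Psi (z t) = w -> z' t = z t.
  move=> ztw; have [a b] := z'P t.
  apply/eqP; rewrite -subr_eq0 -normr_le0.
  have := local_inj (le_trans a rad3).
  by rewrite b /W ztw subrr scaler0 addr0 subrr normr0 mulr0.
rewrite -(end_fix t0 z0) -(end_fix t1 z1); apply: IH => // [t||].
- have [_ ->] := z'P t; rewrite /W addrAC subrr add0r normrZ ger0_norm//.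
  rewrite (le_trans (ler_wpM2l q0 (zn t)))// mulrA ler_wpM2r ?(ltW rho0)//.
  have nn0 := lt0r_neq0 n10; by rewrite /q mulfVK.
- by rewrite end_fix.
- by rewrite end_fix.
Qed.

(** A segment between two preimages of a point is mapped to a loop, to which [lift_loop] applies. *)
Lemma Psi_inj : injective Psi.
Proof.
move=> x y xy.
(* The squared sine traverses the segment while keeping the path defined, continuous and bounded on
   the whole line. *)
pose z (t : R) := x + (sin t ^+ 2) *: (y - x).
have z0 : z 0 = x by rewrite /z sin0 expr0n/= scale0r addr0.
have z1 : z (pi / 2) = y by rewrite /z sin_pihalf expr1n scale1r addrC subrK.
have cz : continuous z.
  move=> t; apply: cvgD; first exact: cvg_cst.
  apply: (@cvgZr_tmp _ _ _ _ _ (fun t => sin t ^+ 2)); rewrite expr2.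
  by under eq_fun do rewrite expr2; apply: cvgM; exact: continuous_sin.
have [C HC] : exists C : R, forall t, `|Psi (z t) - Psi x| <= C.
  have Hk k := continuous_bounded_ball (`|x| + `|y - x|) (smooth_continuous (sP k)).
  have [C0 H0] := Hk 0; have [C1 H1] := Hk 1.
  exists (Num.max C0 C1 + `|Psi x|) => t.
  have zt : `|z t| <= `|x| + `|y - x|.
    rewrite (le_trans (ler_normD _ _))// lerD2l normrZ ger0_norm ?sqr_ge0//.
    by rewrite ler_piMl// -(cos2Dsin2 t) lerDr sqr_ge0.
  rewrite (le_trans (ler_normB _ _))// lerD2r row_norm_le// => [|k].
    by rewrite (le_trans (normr_ge0 (P 0 (z t))))// le_max (H0 _ zt).
  by have [->|->] := ord2P k; rewrite le_max ?(H0 _ zt) ?(H1 _ zt) ?orbT.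
pose n := (Num.truncn (C / rho)).+1.
rewrite -z0 -[y]z1; apply: (@lift_loop (Psi x) 0 (pi / 2) n z cz) => [t||].
- rewrite (le_trans (HC t))// -ler_pdivrMr//.
  by rewrite /n ltW// truncnS_gt.
- by rewrite z0.
- by rewrite z1.
Qed.

Lemma Psi_surj w : exists x, Psi x = w.
Proof.
pose C := `|w - Psi 0|; pose n := (Num.truncn (C / rho)).+1.
have n0 : (0 : R) < n%:R by rewrite ltr0n.
have Cn : C / n%:R <= rho.
  by rewrite ler_pdivrMr// mulrC -ler_pdivrMr// /n ltW// truncnS_gt.
(* The segment from [Psi 0] to [w] is walked in [n] steps of length at most [rho], each lifted by
   [local_surj]. *)
suff [x xE] : exists x, Psi x = Psi 0 + (n%:R / n%:R) *: (w - Psi 0).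
  by exists x; rewrite xE mulfV ?lt0r_neq0// scale1r addrC subrK.
elim: {1}n => [|k [x xE]]; first by exists 0; rewrite mul0r scale0r addr0.
have [|x' _ x'E] := @local_surj x (Psi 0 + (k.+1%:R / n%:R) *: (w - Psi 0)); last by exists x'.
rewrite xE opprD addrACA subrr add0r -scalerBl -mulrBl -natrB// subSnn normrZ.
have nn := ltW n0; by rewrite div1r ger0_norm ?invr_ge0// mulrC.
Qed.

Lemma mulmx_continuous (M : 'M[R]_2) : continuous (fun v : plane => v *m M).
Proof.
apply: (@Ck_row R plane 2 0) => j; under eq_fun do rewrite mxE.
apply: (Ck_sum _ (k := 0) (W := R^o)) => i; apply: CkM; last exact: Ck_cst.
exact: (smooth_coord i smooth_id 0).
Qed.

Theorem global_inverse : exists phi : plane -> plane,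
  [/\ smooth phi, cancel phi Psi, cancel Psi phi &
      forall w, 'd phi w = mulmxr (Minv (phi w)) :> (plane -> plane)].
Proof.
have [phi phiK] := choice Psi_surj.
have PsiK : cancel Psi phi by move=> x; apply: Psi_inj; rewrite phiK.
have phi_lip w w0 : `|w - w0| <= rho -> `|phi w - phi w0| <= 4 * B * `|w - w0|.
  move=> ww0; have [|x xx0 xw] := @local_surj (phi w0) w; first by rewrite phiK.
  have -> : phi w = x by rewrite -xw PsiK.
  have := local_inj (le_trans xx0 rad3).
  by rewrite xw phiK.
have dphi w : differentiable phi w /\
    'd phi w = mulmxr (Minv (phi w)) :> (plane -> plane).
  apply: differentiable_approx => [|eps eps0].
    exact: mulmx_continuous.
  (* [linearization], with the displacement of [phi] itself as radius, has a quadratic error;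
     [4 * B] is the Lipschitz constant of [phi] at scale [rho], and the added 1 makes [c]
     positive. *)
  pose c := kap * (4 * B * (4 * B)) + 1.
  have c0 : 0 < c by rewrite ltr_wpDl// !mulr_ge0.
  exists (Num.min rho (eps / c)); first by rewrite lt_min rho0 divr_gt0.
  move=> h; rewrite lt_min => /andP[/ltW hr he].
  have := phi_lip (h + w) w; rewrite addrK => /(_ hr).
  have xx : `|phi w - phi w| <= `|phi (h + w) - phi w| by rewrite subrr normr0.
  have := linearization xx (lexx _); rewrite !phiK addrK.
  rewrite -normrN opprB; move: he; rewrite ltr_pdivlMr// /c /=.
  have h0 := normr_ge0 h; have d0 := normr_ge0 (phi (h + w) - phi w).
  move: h0 d0; move: `|_ - _ - _| `|h| `|_ - _| => a b d b0 d0 be ad db.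
  have B4 : 0 <= 4 * B by rewrite mulr_ge0.
  have dd : d * d <= 4 * B * b * (4 * B * b) by rewrite ler_pM.
  rewrite (le_trans ad)// -mulrA (le_trans (ler_wpM2l kap0 dd))//.
  have -> : kap * (4 * B * b * (4 * B * b)) = b * (kap * (4 * B * (4 * B))) * b by ring.
  by rewrite ler_wpM2r// (le_trans _ (ltW be))// ler_wpM2l// lerDl.
exists phi; split => // [k|w]; last by have [] := dphi w.
(* Bootstrap: the differential of [phi] is [Minv] evaluated along [phi], hence as regular as
   [phi]. *)
elim: k => [|k IH]; first by move=> w; apply: differentiable_continuous; have [] := dphi w.
split=> [w|v]; first by have [] := dphi w.
have -> : 'D_v phi = fun w => v *m Minv (phi w).
  by apply/funext => w; have [dw dE] := dphi w; rewrite deriveE// dE.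
apply: Ck_row => j; under eq_fun do rewrite mxE.
apply: Ck_sum => i; apply: CkM; first exact: Ck_cst.
exact: (Ck_comp (sMinv i j k) IH).
Qed.

End GlobalInverse.

(** * Periods and the covering *)

Section Periods.
Context {R : realType}.
Local Notation plane := 'rV[R]_2.
Local Notation quat := 'rV[R]_4.
Local Notation e i := (delta_mx 0 i : plane).

Lemma ptE (s t : R) : pt s t = t *: e 1 + s *: e 0.
Proof.
by apply/rowP => i; have [->|->] := ord2P i; rewrite !mxE/= ?mulr1 ?mulr0 ?addr0 ?add0r.
Qed.

Lemma pt0 (s t : R) : pt s t 0 0 = s. Proof. by rewrite mxE. Qed.
Lemma pt1 (s t : R) : pt s t 0 1 = t. Proof. by rewrite mxE. Qed.

Lemma partial_dir_eq0 n (g : plane -> 'rV[R]_n) i : smooth g ->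
  (forall x, partial i g x = 0) -> forall x h, g (x + h *: e i) = g x.
Proof.
move=> sg g0 x h; apply/rowP => k; apply/eqP; rewrite -subr_eq0.
have sgk := smooth_coord k sg.
have [|s _ ->] := @plane_MVT_dir R (fun y => g y 0 k) x h i.
  by move=> z; exact: smooth_differentiable.
by rewrite partial_coord// g0 mxE mulr0.
Qed.

(** Subtracting integer parts moves any point into the unit ball. Periodicity is asked of the
    absolute value because signs may change under the lattice. *)
Lemma quasi_periodic_bounded (g : plane -> R^o) : continuous g ->
  (forall (l x : plane), (forall i, l 0 i \is a Num.int) -> `|g (x + l)| = `|g x|) ->
  exists C : R, forall x, `|g x| <= C.
Proof.
move=> cg gper; have [C HC] := continuous_bounded_ball 1 cg; exists C => x.
pose l : plane := \row_i (- (Num.floor (x 0 i))%:~R).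
rewrite -(gper l); last by move=> i; rewrite mxE rpredN intr_int.
apply: HC; apply: row_norm_le => // i; rewrite !mxE.
have /andP[a b] := floor_itv (x 0 i).
by rewrite ler_norml; apply/andP; split; move: a b; rewrite intrD1; lra.
Qed.

Lemma additive_int (V : zmodType) (g : int -> V) :
  (forall m n, g (m + n) = g m + g n) -> forall n, g n = g 1 *~ n.
Proof.
move=> gD n; have g0 : g 0 = 0.
  by have := gD 0 0; rewrite addr0 -{1}(addr0 (g 0)) => /addrI.
have gS (k : nat) : g k%:Z = g 1 *+ k.
  by elim: k => [//|k IH]; rewrite -addn1 PoszD gD IH mulrnDr.
have gN m : g (- m) = - g m by apply/eqP; rewrite -addr_eq0 -gD addNr g0.
case: n => k; first by rewrite gS.
by rewrite NegzE gN gS mulrNz.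
Qed.

Lemma integer_combination (a r : R) (i j m n : int) :
  a *~ (j - i) + (a * r) *~ (m - n) = a * (m%:~R * r - i%:~R - (n%:~R * r - j%:~R)).
Proof. by rewrite -[a *~ _]mulrzr -[_ *~ (m - n)]mulrzr !intrB; ring. Qed.

(* Dirichlet's pigeonhole argument. *)
Lemma small_integer_combination (a b d : R) : 0 < d ->
  exists n m : int, (n, m) != (0, 0) /\ `|a *~ n + b *~ m| < d.
Proof.
move=> d0; have [->|a0] := eqVneq a 0.
  by exists 1, 0; rewrite mul0rz add0r mulr0z normr0.
pose r := b / a; pose x (n : nat) : R := n%:R * r - (Num.floor (n%:R * r))%:~R.
have x01 n : 0 <= x n < 1.
  have /andP[u v] := floor_itv (n%:R * r); move: u v; rewrite intrD1 /x.
  by move=> u v; apply/andP; split; lra.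
(* Among N + 1 fractional parts two fall into the same of N bins, hence differ by less than 1 / N,
   and [|a|] / N is below [d]. *)
pose N := (Num.truncn (`|a| / d)).+1.
have N0 : (0 : R) < N%:R by rewrite ltr0n.
have Nd : `|a| < N%:R * d by rewrite -ltr_pdivrMr// truncnS_gt.
have binP n : (Num.truncn (N%:R * x n) < N)%N.
  have /andP[u v] := x01 n.
  by rewrite ltnS truncn_le_nat -/N gtr_pMr.
pose bin (n : 'I_N.+1) : 'I_N := Ordinal (binP n).
have /injectivePn[n [m nm /(congr1 val)/= binE]] : ~~ injectiveb bin.
  by apply/injectiveP => /leq_card; rewrite !card_ord ltnn.
have close : `|x n - x m| < N%:R^-1.
  have /andP[u _] := x01 n; have /andP[v _] := x01 m.
  have /andP[p q] := truncn_itv (mulr_ge0 (ltW N0) u).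
  have /andP[p' q'] := truncn_itv (mulr_ge0 (ltW N0) v).
  rewrite -(ltr_pM2l N0) mulfV ?lt0r_neq0// -{1}(gtr0_norm N0) -normrM mulrBr.
  move: p q p' q'; rewrite binE; move: (_ * x n) (_ * x m) => y z.
  by rewrite -addn1 natrD ltr_norml => p q p' q'; apply/andP; split; lra.
exists (Num.floor (m%:R * r) - Num.floor (n%:R * r)), (n%:Z - m%:Z); split.
  rewrite xpair_eqE negb_and; apply/orP; right; rewrite subr_eq0.
  by apply: contraNneq nm => -[nE]; apply/eqP/val_inj.
have bE : b = a * r by rewrite /r mulrCA mulfV// mulr1.
rewrite [X in _ + X *~ _]bE (integer_combination _ _ _ _ n%:Z m%:Z) -/(x n) -/(x m).
rewrite normrM (le_lt_trans (ler_wpM2l _ (ltW close)))//.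
by rewrite ltr_pdivrMr// mulrC.
Qed.

(* A function of the [k]-th coordinate alone with nonzero derivative has no
   arbitrarily small periods. *)
Lemma axis_period (h : plane -> quat) (k i : 'I_2) (c : int -> int -> plane) : smooth h ->
  k != i -> (forall x, partial i h x = 0) -> partial k h 0 != 0 ->
  (forall n m, h (c n m) = h 0) ->
  (forall n m, c n m = c 1 0 *~ n + c 0 1 *~ m) ->
  exists n m, (n, m) != (0, 0) /\ c n m 0 k = 0.
Proof.
move=> sh ki hi hk hc cD.
have [j hj] : exists j, partial k h 0 0 j != 0.
  apply/not_existsP => H; move/eqP: hk; apply; apply/rowP => j.
  by apply/eqP; rewrite mxE; apply: contra_notT (H j).
pose hj' (y : plane) : R^o := h y 0 j.
have shj : smooth hj' := smooth_coord j sh.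
have ck := @continuous_ray R _ (e k) (smooth_continuous (smooth_partial k shj)).
(* Within [d] of 0 on the axis, the derivative differs from its value at 0 by less than the size of
   that value, so it cannot vanish. *)
move/cvgrPdist_lt : (ck 0) => /(_ `|partial k h 0 0 j|).
rewrite normr_gt0 => /(_ hj) /nbhs_normP[d /= d0 Hd].
have [n [m [nm0 small]]] := small_integer_combination (c 1 0 0 k) (c 0 1 0 k) d0.
exists n, m; split => //; set y := c n m 0 k.
have yE : y = c 1 0 0 k *~ n + c 0 1 0 k *~ m.
  by rewrite /y cD -(scaler_int n) -(scaler_int m) !mxE (mulrzl _ n) (mulrzl _ m).
(* As [h] ignores the coordinate [i], the period can be projected to the axis; the mean value
   theorem then forces [y = 0]. *)
have : hj' (0 + y *: e k) - hj' 0 = 0.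
  apply/eqP; rewrite subr_eq0 /hj' -(hc n m) -(partial_dir_eq0 sh hi _ (c n m 0 i)).
  apply/eqP; congr (h _ 0 j); apply/rowP => l; rewrite /y !mxE.
  move: ki; have [->|->] := ord2P k; have [->|->] := ord2P i => //= _;
  by have [->|->] := ord2P l; rewrite /= ?mulr1 ?mulr0 ?add0r ?addr0.
have [|s /andP[s0 s1] ->] := @plane_MVT_dir R hj' 0 y k.
  by move=> z; exact: smooth_differentiable.
move/eqP; rewrite mulf_eq0 => /orP[/eqP//|/eqP].
have := Hd (s * y); rewrite /ball_/= sub0r normrN normrM (ger0_norm s0).
have ys : s * `|y| < d.
  by rewrite (le_lt_trans _ small)// yE ler_piMl.
move=> /(_ ys) /[swap]; rewrite scale0r !add0r => ->.
by rewrite subr0 partial_coord// ltxx.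
Qed.

End Periods.

(** * The covering of the torus *)

Section Covering.
Context {R : realType} {M : topologicalType}.
Local Notation plane := 'rV[R]_2.
Variables (p : plane -> M) (phi Psi : plane -> plane).
Hypothesis tp : torus p.
Hypothesis sphi : smooth phi.
Hypothesis sPsi : smooth Psi.
Hypothesis phiK : cancel phi Psi.
Hypothesis PsiK : cancel Psi phi.
Let lat (z : int * int) : plane := pt z.1%:~R z.2%:~R.

Lemma intr_norm_lt1 (n : int) : `|n%:~R : R| < 1 -> n = 0.
Proof.
move=> n1; apply/eqP; rewrite -normr_le0 -ltzD1 add0r.
by rewrite -(ltr_int R) intr_norm.
Qed.

Lemma int_vector (y : plane) : (forall i, y 0 i \is a Num.int) -> exists z, y = lat z.
Proof.
move=> yint; have /intrP[n nE] := yint 0; have /intrP[m mE] := yint 1.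
exists (n, m); apply/rowP => i; have [->|->] := ord2P i; rewrite ?pt0 ?pt1//.
Qed.

Lemma lat_int z i : lat z 0 i \is a Num.int.
Proof. by have [->|->] := ord2P i; rewrite /lat ?pt0 ?pt1 intr_int. Qed.

(** The sheets over the image of a small ball are the preimages under the diffeomorphism [phi] of
    its integer translates. With sup-norm radius 1/4, congruent points of two translates differ
    exactly by the difference of the translation vectors, since a nonzero integer vector has norm at
    least 1; so the sheets are disjoint and [p] is injective on each translate. *)
Lemma covering_torus : covering_map (p \o phi).
Proof.
have [cp op sp ep] := tp.
have cphi := smooth_continuous sphi; have cPsi := smooth_continuous sPsi.
have cV z : continuous (fun w => phi w - lat z).
  apply: smooth_continuous; apply: smooth_row => i.
  under eq_fun do rewrite !mxE.
  by apply: smoothB; [exact: smooth_coord|exact: smooth_cst].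
split=> [x|y|y].
- by apply: continuous_comp; [exact: cphi|exact: cp].
- by have [x <-] := sp y; exists (Psi x); rewrite /= PsiK.
have [x0 <-] := sp y; have q0 : (0 : R) < 4^-1 by [].
pose B := [set x : plane | `|x0 - x| < 4^-1].
have oB : open B by have := @ball_open _ plane x0 4^-1; rewrite -ball_normE.
exists (p @` B); split; first by split; [exact: op|exists x0 => //=; rewrite /B/= subrr normr0].
pose V z := [set w | B (phi w - lat z)].
exists (int * int)%type, V.
have BB x x' z z' : B (x - lat z) -> B (x' - lat z') ->
    (forall i, (x - x') 0 i \is a Num.int) -> x - x' = lat z - lat z'.
  move=> xB x'B xx'; have : exists l, x - x' - (lat z - lat z') = lat l.
    apply: int_vector => i; move: (xx' i); rewrite !mxE => h.
    by rewrite rpredB// rpredB//; have := lat_int z i; have := lat_int z' i; rewrite !mxE.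
  move=> [l lE]; suff l0 : lat l = 0 by apply/eqP; rewrite -subr_eq0 lE l0.
  have ll : `|lat l| < 1.
    have -> : lat l = (x0 - (x' - lat z')) - (x0 - (x - lat z)).
      by rewrite -lE; apply/rowP => i; rewrite !mxE; ring.
    rewrite (le_lt_trans (ler_normB _ _))// (lt_le_trans (ltrD x'B xB))//.
    by lra.
  have l1 : l.1 = 0 by apply: intr_norm_lt1; rewrite -(pt0 l.1%:~R l.2%:~R) (le_lt_trans _ ll)// row_norm_ge.
  have l2 : l.2 = 0 by apply: intr_norm_lt1; rewrite -(pt1 l.1%:~R l.2%:~R) (le_lt_trans _ ll)// row_norm_ge.
  rewrite /lat l1 l2; apply/rowP => i; have [->|->] := ord2P i; by rewrite ?pt0 ?pt1 mxE.
split.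
- move=> z; apply: (@open_comp plane plane (fun w => phi w - lat z)) => // w _.
- move=> z z' _ _ [w [wz wz']].
  have := BB _ _ _ _ wz wz'.
  rewrite subrr => /(_ _)/esym/eqP; rewrite subr_eq0 => H.
  have /eqP zz : lat z == lat z' by apply: H => i; rewrite mxE.
  have z1 : z.1%:~R = z'.1%:~R :> R by have := congr1 (fun y : plane => y 0 0) zz; rewrite /lat !pt0.
  have z2 : z.2%:~R = z'.2%:~R :> R by have := congr1 (fun y : plane => y 0 1) zz; rewrite /lat !pt1.
  by move: z1 z2; case: z {wz H zz} => ? ?; case: z' {wz'} => ? ? /= /intr_inj -> /intr_inj ->.
- apply/seteqP; split => [w [b Bb /= pb]|w [z _ /= wz]].
    have [/(_ (esym pb)) wb _] := ep (phi w) b.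
    have [z zE] := int_vector wb.
    by exists z => //=; rewrite /V/= -zE opprB addrC subrK.
  exists (phi w - lat z) => //; apply/ep => i.
  by rewrite addrAC subrr add0r mxE rpredN lat_int.
- move=> z; split.
    split.
    + move=> w /= wz; exists (phi w - lat z) => //; apply/ep => i.
      by rewrite addrAC subrr add0r mxE rpredN lat_int.
    + move=> w w' /set_mem wz /set_mem wz' /= /ep ww'.
      have := BB _ _ _ _ wz wz' ww'; rewrite subrr => /eqP; rewrite subr_eq0 => /eqP.
      exact: (can_inj phiK).
    + move=> _ [b Bb <-]; exists (Psi (b + lat z)).
        by rewrite /V/= PsiK addrK.
      rewrite /= PsiK; apply/ep => i.
      by rewrite addrAC subrr add0r lat_int.
  move=> A oA _.
  have -> : (p \o phi) @` A = p @` (Psi @^-1` A).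
    apply/seteqP; split=> [_ [w Aw <-]|_ [x Ax <-]].
      by exists (phi w) => //=; rewrite phiK.
    by exists (Psi x) => //=; rewrite PsiK.
  apply: op; apply: open_comp => // x _; exact: cPsi.
Qed.

End Covering.

(** * Asymptotic coordinates *)

Section QuasiPeriods.
Context {R : realType}.
Local Notation plane := 'rV[R]_2.
Local Notation quat := 'rV[R]_4.

Lemma collinear_coefficient (B C : R) (U' U : quat) : dot U' U' = 4 ->
  B *: U' = C *: U -> B = C * (4^-1 * dot U U').
Proof.
move=> U4 /(congr1 (fun z => dot z U')); rewrite !dotZl U4 => H.
have -> : C * (4^-1 * dot U U') = 4^-1 * (C * dot U U') by ring.
by rewrite -H; field.
Qed.

Lemma smooth_shift_row n (u : plane -> 'rV[R]_n) l : smooth u -> smooth (fun x => u (x + l)).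
Proof.
move=> su; apply: smooth_row => i.
exact: (smooth_shift l (smooth_coord i su)).
Qed.

(** Differentiating the square gives twice [eps] times its derivative equal to 0, with [eps]
    nonzero. *)
Lemma square1_cst (eps : plane -> R^o) : smooth eps -> (forall x, eps x * eps x = 1) ->
  forall x y, eps x = eps y.
Proof.
move=> se e1 x y; apply: partial_eq0_cst => // i z.
have : partial i (fun x => eps x * eps x : R^o) z = 0.
  by under eq_fun do rewrite e1; exact: partial_cst.
rewrite (partialM i z se se) => H.
have e0 : eps z != 0 by apply/eqP => e0; move/eqP: (e1 z); rewrite e0 mul0r eq_sym oner_eq0.
apply: (mulfI e0); rewrite mulr0; move: H; rewrite mulrC.
by move: (eps z * _) => q; lra.
Qed.

(* The coefficients of a periodic rank one map are periodic up to sign; the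
   sign is that of [dot (u (x + l)) (u x)], constant by continuity. *)
Lemma quasi_period (nu : plane -> quat) (b : 'I_2 -> plane -> R^o) (u : plane -> quat) (l : plane) :
  smooth u -> (forall i x, partial i nu x = b i x *: u x) ->
  (forall x, dot (u x) (u x) = 4) ->
  (forall x, 0 < dot (partial 0 nu x) (partial 0 nu x) + dot (partial 1 nu x) (partial 1 nu x)) ->
  (forall x, nu (x + l) = nu x) ->
  exists2 eps : R, eps * eps = 1 & forall i x, b i (x + l) = eps * b i x.
Proof.
move=> su nuE u4 tr nul.
pose eps (x : plane) : R^o := 4^-1 * dot (u x) (u (x + l)).
have se : smooth eps.
  apply: smoothM; first exact: smooth_cst.
  by apply: smooth_dot => //; exact: smooth_shift_row.
have bu i x : b i (x + l) *: u (x + l) = b i x *: u x.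
  by rewrite -!nuE -partial_shift; congr (partial i _ x); apply/funext.
have b1 i x : b i (x + l) = b i x * eps x.
  exact: (collinear_coefficient (u4 _) (bu i x)).
have b2 i x : b i x = b i (x + l) * eps x.
  by rewrite /eps dotC; exact: (collinear_coefficient (u4 _) (esym (bu i x))).
(* Translating forth and back multiplies [b] by the square of [eps], which is therefore 1 wherever
   [b] is nonzero; by the trace hypothesis that is everywhere. *)
have bb i x : b i x * (eps x * eps x - 1) = 0.
  by rewrite mulrBr mulrA -b1 -b2 mulr1 subrr.
have e1 x : eps x * eps x = 1.
  apply/eqP; rewrite -subr_eq0; apply/negPn/negP => e0.
  have b0 i : b i x = 0 by have /eqP := bb i x; rewrite mulf_eq0 (negbTE e0) orbF => /eqP.
  by have := tr x; rewrite !nuE !b0 !scale0r !dot0l addr0 ltxx.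
exists (eps 0) => // i x.
by rewrite b1 mulrC; congr (_ * _); exact: square1_cst.
Qed.

Lemma bounded_family (I : finType) (g : I -> plane -> R^o) :
  (forall i, exists C : R, forall x, `|g i x| <= C) ->
  exists C : R, forall i x, `|g i x| <= C.
Proof.
move=> /choice[C HC]; exists (\sum_i `|C i|) => i x.
rewrite (le_trans (HC i x))// (le_trans (ler_norm _))//.
by rewrite (bigD1 i)//= lerDl sumr_ge0.
Qed.

Lemma abs_eps (eps a : R) : eps * eps = 1 -> `|eps * a| = `|a|.
Proof.
move=> e1; have : `|eps| ^+ 2 == 1 by rewrite -normrX expr2 e1 normr1.
by rewrite sqrp_eq1// => /eqP e; rewrite normrM e mul1r.
Qed.

End QuasiPeriods.

Section AsymptoticCoordinates.
Context {R : realType}.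
Local Notation plane := 'rV[R]_2.
Local Notation quat := 'rV[R]_4.
Local Notation e i := (delta_mx 0 i : plane).

Variables (nu mu : plane -> quat) (b c : 'I_2 -> plane -> R^o) (u v : plane -> quat).
Hypotheses (sb : forall i, smooth (b i)) (sc : forall i, smooth (c i))
  (su : smooth u) (sv : smooth v).
Hypotheses (nuE : forall i x, partial i nu x = b i x *: u x)
  (muE : forall i x, partial i mu x = c i x *: v x).
Hypotheses (u4 : forall x, dot (u x) (u x) = 4) (v4 : forall x, dot (v x) (v x) = 4).
Hypotheses (tr_nu : forall x, 0 < dot (partial 0 nu x) (partial 0 nu x)
                                + dot (partial 1 nu x) (partial 1 nu x))
  (tr_mu : forall x, 0 < dot (partial 0 mu x) (partial 0 mu x)
                                + dot (partial 1 mu x) (partial 1 mu x)).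
Hypothesis ker : forall x (c0 c1 : R),
  c0 *: partial 0 nu x + c1 *: partial 1 nu x = 0 ->
  c0 *: partial 0 mu x + c1 *: partial 1 mu x = 0 -> c0 = 0 /\ c1 = 0.
Hypotheses (nu_per : forall l : plane, (forall i, l 0 i \is a Num.int) -> forall x, nu (x + l) = nu x)
  (mu_per : forall l : plane, (forall i, l 0 i \is a Num.int) -> forall x, mu (x + l) = mu x).
Variables (S T : plane -> R^o).
Hypotheses (sS : smooth S) (sT : smooth T).
Hypotheses (SE : forall i, partial i S = c i) (TE : forall i, partial i T = b i).

Definition asym_det (x : plane) : R^o := c 0 x * b 1 x - c 1 x * b 0 x.
Definition asym_coord (x : plane) : plane := pt (S x) (T x).
(** The cofactor inverse of the Jacobian of [asym_coord], whose row index is the direction of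
    differentiation. Row 0 spans the kernel of [b], row 1 that of [c]. *)
Definition asym_inv (x : plane) : 'M[R]_2 := \matrix_(i, k)
  ((if i == 0 then (if k == 0 then b 1 x else - b 0 x)
    else (if k == 0 then - c 1 x else c 0 x)) * (asym_det x)^-1).
Local Notation Psi := asym_coord.
Local Notation d := asym_det.

(** [(b 1, - b 0)] is killed by d nu, and also by d mu if the determinant vanishes. The common
    kernel is 0, while [b] is nonzero by the trace hypothesis. *)
Lemma asym_det_neq0 x : d x != 0.
Proof.
apply/eqP => dx0.
have [||b10 /eqP] := @ker x (b 1 x) (- b 0 x).
- by rewrite !nuE !scalerA -scalerDl mulNr mulrC subrr scale0r.
- rewrite !muE !scalerA -scalerDl mulNr mulrC [b 0 x * _]mulrC.
  by rewrite -[_ - _]/(d x) dx0 scale0r.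
rewrite oppr_eq0 => /eqP b00.
by have := tr_nu x; rewrite !nuE b10 b00 !scale0r !dot0l addr0 ltxx.
Qed.

Lemma asym_inv_left x :
  (\matrix_(i, k) partial i (fun y => Psi y 0 k : R^o) x) *m asym_inv x = 1%:M.
Proof.
have P0 : (fun y => Psi y 0 0 : R^o) = S by apply/funext => y; exact: pt0.
have P1 : (fun y => Psi y 0 1 : R^o) = T by apply/funext => y; exact: pt1.
have d0 := asym_det_neq0 x.
apply/matrixP => i k; rewrite mxE sum2 !mxE P0 P1 SE TE /=.
have [->|->] := ord2P i; have [->|->] := ord2P k; rewrite /=.
- by apply: (mulIf d0); rewrite mulrDl !mulrA !mulfVK// /d mul1r; ring.
- by rewrite mulrA mulrA -mulrDl mulrN [b 0 x * _]mulrC addNr mul0r.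
- by rewrite !mulrA -mulrDl mulrN [b 1 x * _]mulrC subrr mul0r.
- by apply: (mulIf d0); rewrite mulrDl !mulrA !mulfVK// /d mul1r; ring.
Qed.

Let smooth_dV : smooth (fun x => (d x)^-1 : R^o).
Proof. by apply: smoothV; [exact: asym_det_neq0|apply: smoothB; exact: smoothM]. Qed.

Lemma smooth_asym_inv i k : smooth (fun x => asym_inv x i k : R^o).
Proof.
under eq_fun do rewrite mxE.
by apply: smoothM => //; have [->|->] := ord2P i; have [->|->] := ord2P k;
  rewrite /=; [|exact: smoothN|exact: smoothN|].
Qed.

Lemma smooth_asym_coord : smooth Psi.
Proof.
apply: smooth_row => i; have [->|->] := ord2P i.
  by under eq_fun do rewrite pt0.
by under eq_fun do rewrite pt1.
Qed.

Let b_per (l : plane) : (forall i, l 0 i \is a Num.int) ->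
  exists2 eps : R, eps * eps = 1 & forall i x, b i (x + l) = eps * b i x.
Proof. by move=> lZ; apply: quasi_period su nuE u4 tr_nu (nu_per lZ). Qed.
Let c_per (l : plane) : (forall i, l 0 i \is a Num.int) ->
  exists2 eps : R, eps * eps = 1 & forall i x, c i (x + l) = eps * c i x.
Proof. by move=> lZ; apply: quasi_period sv muE v4 tr_mu (mu_per lZ). Qed.

Let partial_scaled (f : plane -> R^o) (l x : plane) (eps : R) i : smooth f ->
  (forall x, f (x + l) = eps * f x) -> partial i f (x + l) = eps * partial i f x.
Proof.
move=> sf fl; rewrite -partial_shift.
have -> : (fun y => f (y + l)) = (fun y => (cst eps y : R^o) * f y) by apply/funext.
rewrite (partialM i x (smooth_cst (eps : R^o)) sf).
by rewrite (partial_cst i (eps : R^o)) mul0r add0r.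
Qed.

(** Second derivatives of [S] and [T] are first derivatives of [c] and [b], hence periodic up to
    sign. *)
Lemma asym_coord_hessian_bounded : exists K : R, forall i j k x,
  `|partial i (partial j (fun y => Psi y 0 k : R^o)) x| <= K.
Proof.
have [K HK] : exists K : R, forall (z : 'I_2 * 'I_2 * 'I_2) x,
    `|partial z.1.1 (partial z.1.2 (fun y => Psi y 0 z.2 : R^o)) x| <= K.
  apply: bounded_family => -[[i j] k] /=.
  have [->|->] := ord2P k.
    have -> : (fun y => Psi y 0 0 : R^o) = S by apply/funext => y; exact: pt0.
    rewrite SE; apply: quasi_periodic_bounded => [|l x lZ].
      by apply: smooth_continuous; exact: smooth_partial.
    have [eps e1 E] := c_per lZ.
    by rewrite (partial_scaled x i (sc j) (E j)) abs_eps.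
  have -> : (fun y => Psi y 0 1 : R^o) = T by apply/funext => y; exact: pt1.
  rewrite TE; apply: quasi_periodic_bounded => [|l x lZ].
    by apply: smooth_continuous; exact: smooth_partial.
  have [eps e1 E] := b_per lZ.
  by rewrite (partial_scaled x i (sb j) (E j)) abs_eps.
by exists K => i j k x; exact: (HK (i, j, k)).
Qed.

Lemma asym_inv_bounded : exists B : R, forall i k x, `|asym_inv x i k| <= B.
Proof.
have [B HB] : exists B : R, forall (z : 'I_2 * 'I_2) x, `|asym_inv x z.1 z.2| <= B.
  apply: bounded_family => -[i k] /=; apply: quasi_periodic_bounded => [|l x lZ].
    by apply: smooth_continuous; exact: smooth_asym_inv.
  have [eb eb1 Eb] := b_per lZ; have [ec ec1 Ec] := c_per lZ.
  have dl : `|d (x + l)| = `|d x|.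
    rewrite /d !Eb !Ec.
    have -> : ec * c 0 x * (eb * b 1 x) - ec * c 1 x * (eb * b 0 x) =
      ec * (eb * (c 0 x * b 1 x - c 1 x * b 0 x)) by ring.
    by rewrite !abs_eps.
  rewrite !mxE !normrM !normfV dl; congr (_ * _).
  have [->|->] := ord2P i; have [->|->] := ord2P k;
  by rewrite /= ?normrN ?Eb ?Ec abs_eps.
by exists B => i k x; exact: (HB (i, k)).
Qed.

(* Translations by doubled lattice vectors preserve [b] and [c]: the sign is squared. *)
Lemma asym_coord_period (l x : plane) : (forall i, l 0 i \is a Num.int) ->
  Psi (x + (l + l)) = Psi (0 + (l + l)) - Psi 0 + Psi x.
Proof.
move=> lZ.
have aux (f : plane -> R^o) : smooth f ->
    (forall i y, partial i f (y + (l + l)) = partial i f y) ->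
    f (x + (l + l)) = f (0 + (l + l)) - f 0 + f x.
  move=> sf fl; have sfl := smooth_shift (l + l) sf.
  have E := @partial_eq0_cst R (fun y => f (y + (l + l)) - f y) x 0 (smoothB sfl sf).
  rewrite -E ?subrK// => i z.
  by rewrite (partialB i z sfl sf) partial_shift fl subrr.
have double (a : 'I_2 -> plane -> R^o) : (exists2 eps : R, eps * eps = 1 &
    forall i x, a i (x + l) = eps * a i x) -> forall i y, a i (y + (l + l)) = a i y.
  by move=> [eps e1 E] i y; rewrite addrA !E mulrA e1 mul1r.
apply/rowP => i; rewrite [RHS]mxE.
have BE : (Psi (0 + (l + l)) - Psi 0) 0 i = Psi (0 + (l + l)) 0 i - Psi 0 0 i.
  by rewrite mxE; congr (_ + _); rewrite mxE.
rewrite BE; have [->|->] := ord2P i.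
  by rewrite !pt0; apply: aux => // j y; rewrite SE; exact: double (c_per lZ) _ _.
by rewrite !pt1; apply: aux => // j y; rewrite TE; exact: double (b_per lZ) _ _.
Qed.

End AsymptoticCoordinates.

(** * Factorization into horizontal curves *)

Section UnitQuaternions.
Context {R : realType}.
Local Notation quat := 'rV[R]_4.

Lemma cross_unit_recover (w n : quat) : co w 0 = 0 -> co n 0 = 0 -> dot n n = 1 ->
  dot w n = 0 -> w = cross n (cross w n).
Proof.
move=> iw inn nn wn.
have -> : cross n (cross w n) = dot n n *: w - dot w n *: n.
  by apply: quatP; rewrite /cross !dotE !coE iw inn; ring.
by rewrite nn wn scale1r scale0r subr0.
Qed.

Lemma cross_scaler (a : R) (p q : quat) : cross p (a *: q) = a *: cross p q.
Proof. by apply: quatP; rewrite /cross !coE; ring. Qed.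

Lemma unit_conj_dot (a p q : quat) : dot a a = 1 ->
  dot (qmul (qmul a p) (qconj a)) (qmul (qmul a q) (qconj a)) = dot p q.
Proof. by move=> a1; rewrite dot_qmulr dot_conj a1 mul1r dot_qmull a1 mul1r. Qed.

Lemma co_unit_conj (a p : quat) : dot a a = 1 ->
  co (qmul (qmul a p) (qconj a)) 0 = co p 0.
Proof.
move=> a1; rewrite -[RHS]dot_q1 -(unit_conj_dot p q1 a1) qmul1r qmul_conj a1 scale1r.
by rewrite dot_q1.
Qed.

Lemma rotate_to_I (n : quat) : co n 0 = 0 -> dot n n = 1 ->
  exists2 a, dot a a = 1 & qmul (qmul a n) (qconj a) = @qI R.
Proof.
move=> n0 n1.
suff [a a0 aE] : exists2 a : quat, 0 < dot a a & qmul a n = qmul (qI R) a.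
  pose r := (Num.sqrt (dot a a))^-1.
  have rr : r * r * dot a a = 1.
    rewrite /r -invfM -expr2 sqr_sqrtr ?ltW// mulVf// gt_eqF//.
  have a1 : dot (r *: a) (r *: a) = 1 by rewrite dotZl dotZr mulrA.
  exists (r *: a) => //.
  by rewrite qmulZl aE -qmulZr -qmulA qmul_conj a1 scale1r qmul1r.
have nE : co n 1 * co n 1 + co n 2 * co n 2 + co n 3 * co n 3 = 1.
  by move: n1; rewrite dotE n0 mul0r add0r.
have [n11|n11] := eqVneq (co n 1) (-1).
  have n2 : co n 2 = 0 by move: nE; rewrite n11; move: (co n 2) (co n 3) => x y H; nra.
  have n3 : co n 3 = 0 by move: nE; rewrite n11 n2; move: (co n 3) => y H; nra.
  (* [J] anticommutes with [I], so conjugation by [J] takes [- I] to [I]. *)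
  exists (qJ R); first by rewrite dotE /qJ !coE; lra.
  by apply: quatP; rewrite /qJ /qI !coE n0 n11 n2 n3; ring.
(* [1 - I n] intertwines [n] and [I], and vanishes only for [n = - I]. *)
exists (q1 - qmul (qI R) n).
  rewrite dotE /q1 /qmul /qI !coE n0.
  have : co n 1 < -1 \/ -1 < co n 1 by apply/orP; rewrite -neq_lt.
  move: nE n11; move: (co n 1) (co n 2) (co n 3) => x y z nE _ [] H; nra.
apply: quatP; rewrite /q1 /qmul /qI !coE n0; move: nE;
  by move: (co n 1) (co n 2) (co n 3) => x y z nE; lra.
Qed.

Lemma JK_angle (X : quat) : dot X X = 1 -> co X 0 = 0 -> dot X (qI R) = 0 ->
  exists t : R, X = cos t *: qJ R + sin t *: qK R.
Proof.
move=> X1 X0 XI; have Xi : co X 1 = 0 by move: XI; rewrite dotE /qI !coE; lra.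
have [|t [tc ts]] := @unit_vector_angle R (co X 2) (co X 3).
  by move: X1; rewrite dotE X0 Xi !expr2 !mul0r !add0r.
by exists t; apply: quatP; rewrite /qJ /qK !coE -?tc -?ts ?X0 ?Xi; ring.
Qed.

End UnitQuaternions.

Section HorizontalLines.
Context {R : realType}.
Local Notation plane := 'rV[R]_2.
Local Notation quat := 'rV[R]_4.
Local Notation e i := (delta_mx 0 i : plane).

Lemma partial_qmul_cst i (a : quat) (f : plane -> quat) x : smooth f ->
  partial i (fun y => qmul a (f y)) x = qmul a (partial i f x).
Proof.
move=> sf; apply: etrans (partial_qmul i x (smooth_cst a) sf) _.
by rewrite (partial_cst i a x) -(scale0r q1) qmulZl scale0r add0r.
Qed.

Lemma derive1_line (q : plane -> quat) i t : smooth q ->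
  derive1 (fun t : R => q (t *: e i)) t = partial i q (t *: e i).
Proof.
move=> sq; have D : is_derive (0 + t *: e i) (e i) q (partial i q (0 + t *: e i)).
  exact: smooth_is_derive.
have := is_derive_line D.
under [X in is_derive _ _ X _]eq_fun do rewrite add0r.
by move=> [_ H]; rewrite derive1E H add0r.
Qed.

Lemma smooth_line (q : plane -> quat) i : smooth q ->
  smooth (fun t : R^o => q (t *: e i)).
Proof.
move=> sq; apply: smooth_row => k.
apply: (smooth_comp (smooth_coord k sq)); apply: smooth_row => j.
under eq_fun do rewrite mxE.
by apply: smoothM; [exact: smooth_id|exact: smooth_cst].
Qed.

(** A curve of unit quaternions is orthogonal to its derivative, so the product with the conjugate
    is imaginary; orthogonality to [I] leaves the plane of [J] and [K]. *)
Lemma horizontal_line (q : plane -> quat) i : smooth q ->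
  (forall x, dot (q x) (q x) = 1) ->
  (forall x, dot (partial i q x) (partial i q x) = 1) ->
  (forall t : R, dot (qmul (partial i q (t *: e i)) (qconj (q (t *: e i)))) (qI R) = 0) ->
  horizontal (fun t : R => q (t *: e i)).
Proof.
move=> sq qq1 dq1 qi; split.
  split=> [|s|s]; [exact: smooth_line|exact: qq1|].
  by rewrite derive1_line// dq1.
suff /choice[psi H] : forall s : R, exists t : R,
    qmul (partial i q (s *: e i)) (qconj (q (s *: e i))) = cos t *: qJ R + sin t *: qK R.
  exists psi => s; rewrite derive1_line// /qinv qq1 invr1 scale1r; exact: H.
move=> s; apply: JK_angle => //; first by rewrite dot_qmulr dot_conj qq1 mul1r dq1.
have H : dot (q (s *: e i)) (partial i q (s *: e i)) = 0 by exact: (partial_dot_cst _ _ sq qq1).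
have Q : q1 = qmul (q (s *: e i)) (qconj (q (s *: e i))).
  by rewrite qmul_conj qq1 scale1r.
by rewrite -dot_q1 Q dot_qmulr (dotC (partial i q _)) H mulr0.
Qed.

End HorizontalLines.

(** * Splitting the surface in asymptotic coordinates *)

Section Factorization.
Context {R : realType}.
Local Notation plane := 'rV[R]_2.
Local Notation quat := 'rV[R]_4.
Local Notation e i := (delta_mx 0 i : plane).

Variables F N U V : plane -> quat.
Hypotheses (sF : smooth F) (sN : smooth N) (sU : smooth U).
Hypotheses (F1 : forall x, dot (F x) (F x) = 1) (N1 : forall x, dot (N x) (N x) = 1)
  (N_im : forall x, co (N x) 0 = 0) (U4 : forall x, dot (U x) (U x) = 4)
  (V4 : forall x, dot (V x) (V x) = 4).
Hypothesis N_orth : forall i x, dot (ltang F i x) (N x) = 0.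
Local Notation mu := (fun x => qmul (qmul (F x) (N x)) (qconj (F x))).
Hypotheses (N_s : forall x, partial 0 N x = 0) (N_t : forall x, partial 1 N x = U x)
  (U_s : forall x, partial 0 U x = 0)
  (mu_s : forall x, partial 0 mu x = V x) (mu_t : forall x, partial 1 mu x = 0).
Local Notation W := (ltang F).

Let FF i x : dot (partial i F x) (F x) = 0.
Proof. by rewrite dotC; exact: (partial_dot_cst i x sF F1). Qed.

Let W_im i x : co (W i x) 0 = 0.
Proof. by rewrite /ltang (co_ltr (F1 x)) FF. Qed.

Let mu_i i x : partial i mu x =
  qmul (qmul (F x) (partial i N x + 2 *: cross (W i x) (N x))) (qconj (F x)).
Proof.
apply: etrans (rgauss_product_rule (partial i N x) (F1 x) (FF i x) (N_im x)).
apply: etrans (partial_qmul i x (smooth_qmul sF sN) (smooth_qconj sF)) _.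
by rewrite (partial_qmul i x sF sN) (partial_qconj i x sF).
Qed.

Let partial_FW i x : partial i F x = qmul (F x) (W i x).
Proof. by rewrite /ltang unit_qmulVK. Qed.

(** Up to conjugation by [F], [V] is twice a quarter turn of [W 0], so its length 2 means unit speed
    in [s]. *)
Let W_s1 x : dot (W 0 x) (W 0 x) = 1.
Proof.
have := V4 x; rewrite -mu_s mu_i N_s add0r unit_conj_dot// dotZl dotZr.
rewrite dot_cross_unit// => H.
by move: H; move: (dot _ _) => a; lra.
Qed.

Let W_tE x : U x = - (2 *: cross (W 1 x) (N x)).
Proof.
apply/eqP; rewrite -addr_eq0; apply/eqP.
by apply: (unit_conj_eq0 (F1 x)); rewrite -N_t -mu_i mu_t.
Qed.

Let W_t1 x : dot (W 1 x) (W 1 x) = 1.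
Proof.
have := U4 x; rewrite W_tE dotNl dotC dotNl opprK dotZl dotZr.
rewrite dot_cross_unit// => H.
by move: H; move: (dot _ _) => a; lra.
Qed.

(* [conj F * F_t = - (N x U) / 2] involves only functions of [t]. *)
Let W_t_cst x h : W 1 (x + h *: e 0) = W 1 x.
Proof.
have WE y : W 1 y = - 2^-1 *: cross (N y) (U y).
  rewrite W_tE -(scaleN1r (2 *: _)) !cross_scaler !scalerA.
  have -> : - 2^-1 * (-1 * 2) = 1 :> R by field.
  rewrite scale1r.
  exact: cross_unit_recover.
by rewrite !WE (partial_dir_eq0 sN N_s) (partial_dir_eq0 sU U_s).
Qed.

(** [G] compares [F] at two points with the same [t]. As [W 1] is equal at both points and
    imaginary, the two terms of the product rule cancel, so [G] does not depend on [t]. *)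
Lemma factorization s t :
  F (t *: e 1 + s *: e 0) = qmul (qmul (F (s *: e 0)) (qconj (F 0))) (F (t *: e 1)).
Proof.
pose Fs x := F (x + s *: e 0); pose G x := qmul (Fs x) (qconj (F x)).
have sFs : smooth Fs by exact: smooth_shift_row.
have sG : smooth G by exact: smooth_qmul sFs (smooth_qconj sF).
have G_t x : partial 1 G x = 0.
  apply: etrans (partial_qmul 1 x sFs (smooth_qconj sF)) _.
  rewrite (partial_qconj 1 x sF) partial_shift !partial_FW W_t_cst.
  rewrite qconjM (qconj_im (W_im 1 x)) qmulNl qmulNr -[qmul (qmul _ _) _]qmulA.
  by rewrite subrr.
have := partial_dir_eq0 sG G_t 0 t; rewrite /G /Fs !add0r => <-.
by rewrite unit_qmulVKr.
Qed.

Variable a : quat.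
Hypotheses (a1 : dot a a = 1) (aI : qmul (qmul a (mu 0)) (qconj a) = qI R).

(** Its conjugate ends in [qconj a], which cancels the [a] of [right_factor] in the product. *)
Definition left_factor (s : R) : quat := qmul (qmul a (F 0)) (qconj (F (s *: e 0))).
Definition right_factor (t : R) : quat := qmul a (F (t *: e 1)).

Lemma factors_product s t :
  qmul (qconj (left_factor s)) (right_factor t) = F (t *: e 1 + s *: e 0).
Proof.
rewrite factorization /left_factor /right_factor !qconjM qconjK -!qmulA.
by rewrite unit_qmulK.
Qed.

(** The derivative times the inverse is [W 1] conjugated by [a] times [F]. As [mu] is constant in
    [t] and [a] rotates it to [I], the same conjugation takes [N] to [I], and [W 1] is orthogonal to
    [N]. *)
Lemma horizontal_right_factor : horizontal right_factor.
Proof.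
pose q x := qmul a (F x).
have dq x : partial 1 q x = qmul a (partial 1 F x).
  exact: partial_qmul_cst.
apply: (@horizontal_line R q 1) => [|x|x|t].
- exact: smooth_qmul (smooth_cst a) sF.
- by rewrite dot_qmull a1 mul1r F1.
- by rewrite dq dot_qmull a1 mul1r partial_FW dot_qmull F1 mul1r W_t1.
rewrite dq partial_FW -aI.
have -> : mu 0 = mu (0 + t *: e 1).
  have smu : smooth mu := smooth_qmul (smooth_qmul sF sN) (smooth_qconj sF).
  by rewrite (partial_dir_eq0 smu mu_t).
rewrite add0r; set x := t *: e 1.
have -> : qmul (qmul a (qmul (F x) (W 1 x))) (qconj (q x)) =
   qmul (qmul a (qmul (qmul (F x) (W 1 x)) (qconj (F x)))) (qconj a).
  by rewrite /q qconjM !qmulA.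
by rewrite !unit_conj_dot.
Qed.

(** Here the conjugating quaternion is the constant [A]: it turns [N], which is constant in [s],
    into [I], and the derivative times the inverse is the conjugate of [- W 0]. *)
Lemma horizontal_left_factor : horizontal left_factor.
Proof.
pose A := qmul a (F 0); pose q x := qmul A (qconj (F x)).
have A1 : dot A A = 1 by rewrite dot_qmull a1 mul1r.
have sFc := smooth_qconj sF.
have dq x : partial 0 q x = qmul A (qconj (partial 0 F x)).
  by apply: etrans (partial_qmul_cst 0 A x sFc) _; rewrite (partial_qconj 0 x sF).
apply: (@horizontal_line R q 0) => [|x|x|s].
- exact: smooth_qmul (smooth_cst A) sFc.
- by rewrite dot_qmull A1 mul1r dot_conj.
- by rewrite dq dot_qmull A1 mul1r dot_conj partial_FW dot_qmull F1 mul1r W_s1.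
set x := s *: e 0.
have -> : qI R = qmul (qmul A (N x)) (qconj A).
  have -> : N x = N 0 by rewrite -(partial_dir_eq0 sN N_s 0 s) add0r.
  by rewrite -aI /A qconjM !qmulA.
rewrite dq partial_FW.
have -> : qmul (qmul A (qconj (qmul (F x) (W 0 x)))) (qconj (q x)) =
   qmul (qmul A (- W 0 x)) (qconj A).
  rewrite /q qconjM qconjM qconjK (qconj_im (W_im 0 x)) -!qmulA.
  by rewrite unit_qmulK.
by rewrite unit_conj_dot// dotNl N_orth oppr0.
Qed.

End Factorization.

(** * Lattice translations in asymptotic coordinates *)

Section AxisTranslations.
Context {R : realType}.
Local Notation plane := 'rV[R]_2.
Local Notation quat := 'rV[R]_4.
Local Notation e i := (delta_mx 0 i : plane).

Lemma partial_reparam n (g : plane -> 'rV[R]_n) (phi : plane -> plane) (m : 'M[R]_2) w i :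
  smooth g -> smooth phi -> 'd phi w = mulmxr m :> (plane -> plane) ->
  partial i (fun w => g (phi w)) w =
  m i 0 *: partial 0 g (phi w) + m i 1 *: partial 1 g (phi w).
Proof.
move=> sg sphi dphi.
have dg := smooth_differentiable (phi w) sg; have dp := smooth_differentiable w sphi.
apply: etrans (derive_comp_row (e i) dg dp) _; rewrite sum2.
have -> : 'D_(e i) phi w = row i m by rewrite deriveE// dphi rowE.
by rewrite !mxE.
Qed.

Lemma smooth_reparam n (g : plane -> 'rV[R]_n) (phi : plane -> plane) :
  smooth g -> smooth phi -> smooth (fun w => g (phi w)).
Proof.
by move=> sg sphi; apply: smooth_row => k; exact: smooth_comp (smooth_coord k sg) sphi.
Qed.

Lemma immersive_independent n (f : plane -> 'rV[R]_n) x (c0 c1 : R) : immersive f ->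
  c0 *: partial 0 f x + c1 *: partial 1 f x = 0 -> c0 = 0 /\ c1 = 0.
Proof.
move=> [df injf] H.
have E : pt c0 c1 = 0.
  by apply: (injf x); rewrite linear0 diff_row// sum2 pt0 pt1.
have := congr1 (fun y : plane => y 0 1) E; have := congr1 (fun y : plane => y 0 0) E.
by rewrite /= pt0 pt1 !mxE.
Qed.

Lemma closed_curve_translation (g : R -> quat) L : L != 0 ->
  (forall t, g (t + L) = g t) -> closed_curve g.
Proof.
move=> L0 gL; have [L1|L1] := ltP 0 L; first by exists L.
exists (- L); first by rewrite oppr_gt0 lt_neqAle L0.
by move=> t; rewrite -gL subrK.
Qed.

Variables Psi phi : plane -> plane.
Hypotheses (phiK : cancel phi Psi) (PsiK : cancel Psi phi).
(** The translation of the coordinates (s, t) induced by the doubled lattice vector [l + l]. *)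
Let per (l : plane) : plane := Psi (0 + (l + l)) - Psi 0.
Hypothesis Psi_per : forall l x : plane, (forall i, l 0 i \is a Num.int) ->
  Psi (x + (l + l)) = Psi (0 + (l + l)) - Psi 0 + Psi x.

Lemma phi_period (l w : plane) : (forall i, l 0 i \is a Num.int) ->
  phi (w + (Psi (0 + (l + l)) - Psi 0)) = phi w + (l + l).
Proof.
by move=> lZ; apply: (can_inj PsiK); rewrite phiK Psi_per// phiK addrC.
Qed.

(** [per] is additive, so [axis_period] finds a nonzero lattice vector whose translation lies on the
    axis [i]; injectivity of [Psi] makes that translation nonzero. *)
Lemma axis_translation (H : plane -> quat) (k i : 'I_2) : smooth H -> k != i ->
  (forall x, partial i H x = 0) -> partial k H 0 != 0 ->
  (forall l w : plane, (forall i, l 0 i \is a Num.int) -> H (w + per l) = H w) ->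
  exists (l : plane) (L : R), [/\ forall i, l 0 i \is a Num.int, L != 0 & per l = L *: e i].
Proof.
move=> sH ki Hi Hk Hper.
pose l (n m : int) : plane := pt n%:~R m%:~R.
have lZ n m j : l n m 0 j \is a Num.int.
  by have [->|->] := ord2P j; rewrite /l ?pt0 ?pt1 intr_int.
have lD n m n' m' : l (n + n') (m + m') = l n m + l n' m'.
  by apply/rowP => j; have [->|->] := ord2P j; rewrite [RHS]mxE !(pt0, pt1) intrD.
have perD n m n' m' : per (l (n + n') (m + m')) = per (l n m) + per (l n' m').
  have E : 0 + (l n m + l n' m' + (l n m + l n' m')) =
      0 + (l n m + l n m) + (l n' m' + l n' m') by rewrite -[RHS]addrA (addrACA (l n m)).
  by rewrite /per lD E (Psi_per (0 + (l n m + l n m)) (lZ n' m')) -[LHS]addrA [LHS]addrC.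
have perE n m : per (l n m) = per (l 1 0) *~ n + per (l 0 1) *~ m.
  rewrite -{1}(addr0 n) -{1}(add0r m) perD.
  have A := @additive_int _ (fun n => per (l n 0)) _ n.
  have B := @additive_int _ (fun m => per (l 0 m)) _ m.
  by rewrite A ?B // => p q; rewrite -perD addr0.
have [||n [m [nm nmk]]] := @axis_period R H k i (fun n m => per (l n m)) sH ki Hi Hk.
- by move=> n m; rewrite -[X in H X]add0r Hper.
- exact: perE.
exists (l n m), (per (l n m) 0 i); split => //.
- apply: contra nm => /eqP nmi.
  have : per (l n m) = 0.
    apply/rowP => j; rewrite [RHS]mxE; move: ki nmk nmi.
    have [->|->] := ord2P k; have [->|->] := ord2P i => //= _; by have [->|->] := ord2P j.
  rewrite /per => /eqP; rewrite subr_eq0 => /eqP /(can_inj PsiK); rewrite add0r => ll.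
  have l0 j : l n m 0 j = 0.
    have := congr1 (fun y : plane => y 0 j) ll; rewrite /= !mxE => H0.
    by move: H0; move: (nth _ _ _) => y; lra.
  have := l0 0; have := l0 1; rewrite pt0 pt1 => /eqP + /eqP.
  by rewrite !intr_eq0 => /eqP -> /eqP ->.
- apply/rowP => j; rewrite [RHS]mxE [X in _ * X]mxE; move: ki nmk.
  have [->|->] := ord2P k; have [->|->] := ord2P i => //= _;
  by have [->|->] := ord2P j; rewrite /= ?mulr1 ?mulr0.
Qed.

End AxisTranslations.

(** * Assembling the factorization of a flat periodic surface *)

Section FlatPeriodicSurface.
Context {R : realType}.
Local Notation plane := 'rV[R]_2.
Local Notation quat := 'rV[R]_4.
Local Notation e i := (delta_mx 0 i : plane).

Lemma collinear_comb_eq0 (a b D : R) (p q : quat) : a *: q = b *: p ->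
  (b * D) *: p + (- a * D) *: q = 0.
Proof. by move=> H; rewrite ![_ * D]mulrC -!scalerA scaleNr H scalerN subrr. Qed.

Lemma dot_comb_eq0 (a b : R) (z p q n : quat) : dot (qmul z p) n = 0 ->
  dot (qmul z q) n = 0 -> dot (qmul z (a *: p + b *: q)) n = 0.
Proof. by move=> P Q; rewrite qmulDr !qmulZr dotDl !dotZl P Q !mulr0 addr0. Qed.

Lemma det_comb (a b a' b' : R) (p : quat) : a * b' - a' * b != 0 ->
  (b' * (a * b' - a' * b)^-1) *: (a *: p) + (- b * (a * b' - a' * b)^-1) *: (a' *: p) = p /\
  (- a' * (a * b' - a' * b)^-1) *: (b *: p) + (a * (a * b' - a' * b)^-1) *: (b' *: p) = p.
Proof.
move=> D0; rewrite !scalerA -!scalerDl.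
have -> : b' * (a * b' - a' * b)^-1 * a + - b * (a * b' - a' * b)^-1 * a' = 1 by field.
have -> : - a' * (a * b' - a' * b)^-1 * b + a * (a * b' - a' * b)^-1 * b' = 1 by field.
by rewrite scale1r.
Qed.

Lemma factorize_flat_surface (f : plane -> quat) : smooth f -> immersive f ->
  (forall x, dot (f x) (f x) = 1) -> flat_metric (first_fundamental_form f) ->
  (forall l : plane, (forall i, l 0 i \is a Num.int) -> forall x, f (x + l) = f x) ->
  exists (phi Psi : plane -> plane) (g1 g2 : R -> quat),
    [/\ smooth phi, smooth Psi, cancel phi Psi & cancel Psi phi] /\
    [/\ immersive phi, horizontal g1 /\ closed_curve g1, horizontal g2 /\ closed_curve g2 &
        forall s t, f (phi (pt s t)) = qmul (qconj (g1 s)) (g2 t)].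
Proof.
move=> sf imf f1 flat_f fper.
have indep x c0 c1 := @immersive_independent R 4 f x c0 c1 imf.
have snu := smooth_lgauss sf f1 indep; have smu := smooth_rgauss sf f1 indep.
have nu_rank := lgauss_rank_one sf f1 indep flat_f.
have mu_rank := rgauss_rank_one sf f1 indep flat_f.
have ker x c0 c1 := @gauss_maps_kernel R f sf f1 indep x c0 c1.
have [b [u [[sb su] nuE u4 bclosed bu]]] :=
  rank_one snu (fun x => (nu_rank x).1) (fun x => (nu_rank x).2).
have [c [v [[sc sv] muE v4 cclosed cv]]] :=
  rank_one smu (fun x => (mu_rank x).1) (fun x => (mu_rank x).2).
have [S [sS SE]] := poincare sc cclosed; have [T [sT TE]] := poincare sb bclosed.
have tr_nu x := (nu_rank x).2; have tr_mu x := (mu_rank x).2.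
have nu_per l lZ x : lgauss f (x + l) = lgauss f x := lgauss_shift x (fper l lZ).
have mu_per l lZ x : rgauss f (x + l) = rgauss f x := rgauss_shift x (fper l lZ).
pose Psi := asym_coord S T; pose Minv := asym_inv b c.
have sPsi : smooth Psi := smooth_asym_coord sS sT.
have [K HK] : exists K : R, forall i j k x,
    `|partial i (partial j (fun y => Psi y 0 k : R^o)) x| <= K.
  exact: (asym_coord_hessian_bounded sb sc su sv nuE muE u4 v4 tr_nu tr_mu nu_per mu_per SE TE).
have [B HB] : exists B : R, forall i k x, `|Minv x i k| <= B.
  exact: (asym_inv_bounded sb sc su sv nuE muE u4 v4 tr_nu tr_mu ker nu_per mu_per).
have det0 x : asym_det b c x != 0 := asym_det_neq0 nuE muE tr_nu ker x.
have Minv_left x : (\matrix_(i, k) partial i (fun y => Psi y 0 k : R^o) x) *m Minv x = 1%:M.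
  exact: (asym_inv_left nuE muE tr_nu ker SE TE).
have sMinv i k : smooth (fun x => Minv x i k : R^o).
  exact: (smooth_asym_inv sb sc nuE muE tr_nu ker).
have [phi [sphi phiK PsiK dphi]] := global_inverse sPsi HK HB Minv_left sMinv.
have Psi_per (l x : plane) : (forall i, l 0 i \is a Num.int) ->
    Psi (x + (l + l)) = Psi (0 + (l + l)) - Psi 0 + Psi x.
  exact: (asym_coord_period su sv nuE muE u4 v4 tr_nu tr_mu nu_per mu_per sS sT SE TE).
have mE w : [/\ Minv (phi w) 0 0 = b 1 (phi w) * (asym_det b c (phi w))^-1,
    Minv (phi w) 0 1 = - b 0 (phi w) * (asym_det b c (phi w))^-1,
    Minv (phi w) 1 0 = - c 1 (phi w) * (asym_det b c (phi w))^-1 &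
    Minv (phi w) 1 1 = c 0 (phi w) * (asym_det b c (phi w))^-1].
  by rewrite /Minv !mxE.
pose F w := f (phi w); pose N w := lgauss f (phi w).
pose U w := u (phi w); pose V w := v (phi w).
have sF : smooth F := smooth_reparam sf sphi.
have sN : smooth N := smooth_reparam snu sphi.
have sU : smooth U := smooth_reparam su sphi.
(* In the new coordinates [partial 0] is differentiation along row 0 of [Minv], which annihilates
   [b], hence d nu and, by [bu], also du. Row 1 annihilates [c], hence d mu. *)
have N_s w : partial 0 N w = 0.
  apply: etrans (partial_reparam 0 snu sphi (dphi w)) _.
  have [-> -> _ _] := mE w; rewrite !nuE.
  by apply: collinear_comb_eq0; rewrite !scalerA mulrC.
have N_t w : partial 1 N w = U w.
  apply: etrans (partial_reparam 1 snu sphi (dphi w)) _.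
  have [_ _ -> ->] := mE w; rewrite !nuE.
  exact: (det_comb _ (det0 _)).2.
have U_s w : partial 0 U w = 0.
  apply: etrans (partial_reparam 0 su sphi (dphi w)) _.
  by have [-> -> _ _] := mE w; exact: collinear_comb_eq0.
have mu_s w : partial 0 (fun w => rgauss f (phi w)) w = V w.
  apply: etrans (partial_reparam 0 smu sphi (dphi w)) _.
  by have [-> -> _ _] := mE w; rewrite !muE; exact: (det_comb _ (det0 _)).1.
have mu_t w : partial 1 (fun w => rgauss f (phi w)) w = 0.
  apply: etrans (partial_reparam 1 smu sphi (dphi w)) _.
  have [_ _ -> ->] := mE w; rewrite !muE addrC.
  by apply: collinear_comb_eq0; rewrite !scalerA mulrC.
have N_orth i w : dot (ltang F i w) (N w) = 0.
  apply: etrans (congr1 (fun y => dot (qmul (qconj (F w)) y) (N w))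
    (partial_reparam i sf sphi (dphi w))) _.
  exact: (dot_comb_eq0 _ _ (lgauss_orth f 0 (phi w)) (lgauss_orth f 1 (phi w))).
have F1 w : dot (F w) (F w) = 1 by exact: f1.
have N1 w : dot (N w) (N w) = 1 by exact: (lgauss_unit sf f1 indep).
have N_im w : co (N w) 0 = 0 by exact: (lgauss_im f).
have U4 w : dot (U w) (U w) = 4 by exact: u4.
have V4 w : dot (V w) (V w) = 4 by exact: v4.
have [a a1 aI] : exists2 a : quat, dot a a = 1 &
    qmul (qmul a (rgauss f (phi 0))) (qconj a) = qI R.
  apply: rotate_to_I; first by rewrite (co_unit_conj _ (f1 _)); exact: lgauss_im.
  by rewrite (unit_conj_dot _ _ (f1 _)); exact: N1.
have nz (w : quat) : dot w w = 4 -> w != 0.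
  by move=> w4; apply/eqP => w0; move/eqP: w4; rewrite w0 dot0l eq_sym pnatr_eq0.
have F_per (l w : plane) : (forall i, l 0 i \is a Num.int) ->
    F (w + (Psi (0 + (l + l)) - Psi 0)) = F w.
  by move=> lZ; rewrite /F (phi_period phiK PsiK Psi_per)// addrA !fper.
(* [N] is a function of [t], so it provides a translation purely along [s], which closes the left
   factor; [rgauss] does the same for the right factor. *)
have [l [L [lZ L0 lL]]] : exists (l : plane) (L : R), [/\ forall i, l 0 i \is a Num.int,
    L != 0 & Psi (0 + (l + l)) - Psi 0 = L *: e 0].
  have N_t0 : partial 1 N 0 != 0 by rewrite N_t; exact: nz (u4 _).
  have N_per (l w : plane) : (forall i, l 0 i \is a Num.int) ->
      N (w + (Psi (0 + (l + l)) - Psi 0)) = N w.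
    by move=> lZ; rewrite /N (phi_period phiK PsiK Psi_per w lZ) addrA !nu_per.
  exact: (axis_translation PsiK Psi_per sN (isT : (1 : 'I_2) != 0) N_s N_t0 N_per).
have [l' [L' [lZ' L0' lL']]] : exists (l : plane) (L : R), [/\ forall i, l 0 i \is a Num.int,
    L != 0 & Psi (0 + (l + l)) - Psi 0 = L *: e 1].
  have smu' : smooth (fun w => rgauss f (phi w)) := smooth_reparam smu sphi.
  have mu_s0 : partial 0 (fun w => rgauss f (phi w)) 0 != 0 by rewrite mu_s; exact: nz (v4 _).
  have mu_per' (k w : plane) : (forall i, k 0 i \is a Num.int) ->
      rgauss f (phi (w + (Psi (0 + (k + k)) - Psi 0))) = rgauss f (phi w).
    by move=> kZ; rewrite (phi_period phiK PsiK Psi_per w kZ) addrA !mu_per.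
  exact: (axis_translation PsiK Psi_per smu' (isT : (0 : 'I_2) != 1) mu_t mu_s0 mu_per').
exists phi, Psi, (left_factor F a), (right_factor F a); split => //; split.
- split=> [w|w]; first exact: smooth_differentiable.
  move=> x y; rewrite dphi /=.
  move=> /(congr1 (mulmxr (\matrix_(i, k) partial i (fun y => Psi y 0 k : R^o) (phi w)))).
  by rewrite /= -!mulmxA (mulmx1C (Minv_left _)) !mulmx1.
- split; first exact: (horizontal_left_factor sF sN F1 N1 N_im V4 N_orth N_s mu_s a1 aI).
  apply: (closed_curve_translation L0) => t.
  by rewrite /left_factor scalerDl -lL F_per.
- split; first exact: (horizontal_right_factor sF sN F1 N1 N_im U4 N_orth N_t mu_t a1 aI).
  apply: (closed_curve_translation L0') => t.
  by rewrite /right_factor scalerDl -lL' F_per.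
- move=> s t; rewrite ptE -/(F _).
  exact/esym/(factors_product sF sN sU F1 N1 N_im N_orth N_s N_t U_s mu_t a1).
Qed.

End FlatPeriodicSurface.

Theorem theorem5 (R : realType) (M : topologicalType) (p : 'rV[R]_2 -> M)
    (F : M -> 'rV[R]_4) :
  torus p -> immersion_S3 p F -> flat p F ->
  exists (pi : 'rV[R]_2 -> M) (g1 g2 : R -> 'rV[R]_4),
    [/\ smooth_covering p pi,
        horizontal g1 /\ closed_curve g1,
        horizontal g2 /\ closed_curve g2 &
        forall s t : R, F (pi (pt s t)) = qmul (qconj (g1 s)) (g2 t)].
Proof.
move=> tp [F1 sF iF] flF.
have Fper (l : 'rV[R]_2) : (forall i, l 0 i \is a Num.int) ->
    forall x, (F \o p) (x + l) = (F \o p) x.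
  move=> lZ x /=; congr F; have [_ _ _ ep] := tp; apply/ep => i.
  by rewrite addrAC subrr add0r.
have [phi [Psi [g1 [g2 [[sphi sPsi phiK PsiK] [iphi h1 h2 E]]]]]] :=
  factorize_flat_surface sF iF (fun x => F1 (p x)) flF Fper.
exists (p \o phi), g1, g2; split => //; split; first exact: (covering_torus tp sphi sPsi phiK PsiK).
by exists phi.
Qed.
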